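(* Let $p,q\in(0,\infty)$ be given. (a) If $0<q<p<\infty$, then the space $\mathcal C_w\big(\mathcal F^p(\mathbb C),\mathcal F^q(\mathbb C)\big)$ is path connected. (b) If $0<p\le q<\infty$, then the path connected components of $\mathcal C_w\big(\mathcal F^p(\mathbb C),\mathcal F^q(\mathbb C)\big)$ are the sets appearing in the decomposition $$\mathcal C_w\big(\mathcal F^p(\mathbb C),\mathcal F^q(\mathbb C)\big)=\mathcal C_{w,0}\big(\mathcal F^p(\mathbb C),\mathcal F^q(\mathbb C)\big)\ \cup\ \bigcup_{\varphi\in\mathcal S_1}\{W_{\psi,\varphi}:\psi\in\mathcal F(\varphi,p,q)\},$$ i.e. the set $\mathcal C_{w,0}\big(\mathcal F^p(\mathbb C),\mathcal F^q(\mathbb C)\big)$ and, for each $\varphi\in\mathcal S_1$, the set $\{W_{\psi,\varphi}:\psi\in\mathcal F(\varphi,p,q)\}$.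
   Context: $dA$ is Lebesgue measure on $\mathbb C$. For $0<p<\infty$, the Fock space $\mathcal F^p(\mathbb C)$ is the set of entire functions $f$ with $\|f\|_p=\left(\frac{p}{2\pi}\int_{\mathbb C}|f(z)|^pe^{-\frac{p|z|^2}{2}}\,dA(z)\right)^{1/p}<\infty$ (a Banach space if $p\ge1$; a complete metric space with distance $\|f-g\|_p^p$ if $0<p<1$). For entire functions $\psi,\varphi$, the weighted composition operator is $W_{\psi,\varphi}f=\psi\cdot(f\circ\varphi)$. A linear operator $T:\mathcal F^p(\mathbb C)\to\mathcal F^q(\mathbb C)$ is bounded if it maps $\mathcal F^p(\mathbb C)$ into $\mathcal F^q(\mathbb C)$ and $\|T\|=\sup_{\|f\|_p\le1}\|Tf\|_q<\infty$. $\mathcal C_w(\mathcal F^p(\mathbb C),\mathcal F^q(\mathbb C))$ is the set of all nonzero bounded weighted composition operators from $\mathcal F^p(\mathbb C)$ into $\mathcal F^q(\mathbb C)$ with the operator norm topology, i.e. the topology of the metric $\|S-T\|^{\min(1,q)}$. (Any such operator has $\psi\in\mathcal F^q(\mathbb C)\setminus\{0\}$ and $\varphi(z)=az+b$ with $|a|\le1$.) For $\varphi(z)=az+b$ with $|a|\le1$, $\mathcal F(\varphi,p,q)$ is the set of all nonzero $\psi\in\mathcal F^q(\mathbb C)$ such that $W_{\psi,\varphi}:\mathcal F^p(\mathbb C)\to\mathcal F^q(\mathbb C)$ is bounded. $\mathcal S_0=\{\varphi(z)=az+b:|a|<1\}$, $\mathcal S_1=\{\varphi(z)=az+b:|a|=1\}$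 (with $a,b\in\mathbb C$), and $\mathcal C_{w,0}(\mathcal F^p(\mathbb C),\mathcal F^q(\mathbb C))=\{W_{\psi,\varphi}:\varphi\in\mathcal S_0,\ \psi\in\mathcal F(\varphi,p,q)\}$. *)

(* Defs.v *)
From HB Require Import structures.
From mathcomp Require Import all_boot all_order all_algebra.
From mathcomp Require Import complex.
From mathcomp Require Import all_classical all_reals all_analysis.

Set Implicit Arguments.
Unset Strict Implicit.
Unset Printing Implicit Defensive.

Import Order.TTheory GRing.Theory Num.Theory.
Import numFieldNormedType.Exports.

Local Open Scope classical_set_scope.
Local Open Scope ring_scope.

Section Fock.
Context {R : realType}.
Local Notation C := R[i].

(* Since [C^o] is normed over the field [C] itself, the increments in
   [derivable] are complex. *)
Definition entire (f : C -> C) : Prop :=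
  forall z : C, derivable (f : C^o -> C^o) z 1.

(* dA is the product of two copies of Lebesgue measure, (x, y) standing for
   x + iy.  The norm is extended-real valued: F^p is the set of entire functions
   of finite norm. *)
Definition fock_norm (p : R) (f : C -> C) : \bar R :=
  (((p / (2 * pi))%:E *
    \int[lebesgue_measure \x lebesgue_measure]_(z in [set: R * R])
      (Normc.normc (f (Complex z.1 z.2)) `^ p *
       expR (- (p * Normc.normc (Complex z.1 z.2) ^+ 2 / 2)))%:E) `^ p^-1)%E.

Definition fock (p : R) : set (C -> C) :=
  [set f | entire f /\ (fock_norm p f < +oo)%E].

(* A map from F^p to F^q is represented by a map from F^p to functions on C;
   that its values lie in F^q is part of [bounded_op]. *)
Definition wcomp (p : R) (psi phi : C -> C) : fock p -> C -> C :=
  fun f z => psi z * (\val f) (phi z).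

Definition op_norm (p q : R) (T : fock p -> C -> C) : \bar R :=
  ereal_sup [set fock_norm q (T f) |
             f in [set f : fock p | (fock_norm p (\val f) <= 1)%E]].

Definition bounded_op (p q : R) (T : fock p -> C -> C) : Prop :=
  (forall f, fock q (T f)) /\ (op_norm q T < +oo)%E.

Definition Cw (p q : R) : set (fock p -> C -> C) :=
  [set T | [/\ exists psi phi, [/\ entire psi, entire phi & T = wcomp psi phi],
               bounded_op q T & T <> (fun _ _ => 0)]].

Definition op_dist (p q : R) (S T : fock p -> C -> C) : \bar R :=
  ((op_norm q (fun f z => (S f z - T f z)%R)) `^ (Num.min 1 q)%R)%E.

Definition Cw_space (p q : R) : Type := set_type (@Cw p q).

HB.instance Definition _ (p q : R) := gen_eqMixin (Cw_space p q).
HB.instance Definition _ (p q : R) := gen_choiceMixin (Cw_space p q).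

(* The topology of the metric [op_dist]: a set is open when it contains a ball
   around each of its points. *)
Definition Cw_ball (p q : R) (T : Cw_space p q) (e : R) : set (Cw_space p q) :=
  [set S | (op_dist q (\val S) (\val T) < e%:E)%E].

Definition Cw_open (p q : R) : set_system (Cw_space p q) :=
  [set U | forall T, U T -> exists2 e : R, 0 < e & Cw_ball T e `<=` U].

Lemma Cw_openT (p q : R) : @Cw_open p q setT.
Proof. by move=> T _; exists 1. Qed.

Lemma Cw_openI (p q : R) : setI_closed (@Cw_open p q).
Proof.
move=> U V oU oV T [UT VT].
have [e e0 eU] := oU _ UT; have [d d0 dV] := oV _ VT.
exists (Num.min e d); first by rewrite lt_min e0 d0.
move=> S TS; split; [apply: eU | apply: dV]; apply: lt_le_trans TS _;
  by rewrite lee_fin ge_min lexx ?orbT.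
Qed.

Lemma Cw_open_bigU (p q : R) (I : Type) (U : I -> set (Cw_space p q)) :
  (forall i, Cw_open (U i)) -> Cw_open (\bigcup_i U i).
Proof.
move=> oU T [i _ UT]; have [e e0 eU] := oU i _ UT.
by exists e => // S TS; exists i => //; exact: eU.
Qed.

HB.instance Definition _ (p q : R) :=
  isOpenTopological.Build (Cw_space p q)
    (@Cw_openT p q) (@Cw_openI p q) (@Cw_open_bigU p q).

Definition calF (phi : C -> C) (p q : R) : set (C -> C) :=
  [set psi | [/\ fock q psi, psi <> (fun=> 0) &
                 bounded_op q (wcomp psi phi : fock p -> C -> C)]].

Definition S0 : set (C -> C) :=
  [set phi | exists a b : C, `|a| < 1 /\ phi = (fun z => a * z + b)].

Definition S1 : set (C -> C) :=
  [set phi | exists a b : C, `|a| = 1 /\ phi = (fun z => a * z + b)].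

Definition Cw_phi (p q : R) (phi : C -> C) : set (fock p -> C -> C) :=
  [set wcomp psi phi | psi in calF phi p q].

Definition Cw0 (p q : R) : set (fock p -> C -> C) :=
  \bigcup_(phi in S0) @Cw_phi p q phi.

End Fock.

Arguments Cw {R} p q _.
Arguments Cw0 {R} p q _.
Arguments Cw_phi {R} p q phi _.

Section Paths.
Context {R : realType} {X : topologicalType}.

Definition path_joined (x y : X) : Prop :=
  exists gamma : R -> X,
    [/\ {within `[0, 1], continuous gamma}, gamma 0 = x & gamma 1 = y].

Definition path_connected : Prop := forall x y, path_joined x y.

Definition path_component (x : X) : set X := [set y | path_joined x y].

Definition path_components : set (set X) := range path_component.

End Paths.

Arguments path_connected R X : clear implicits.
Arguments path_components R X : clear implicits.

(* Main.v *)
Require Import Defs.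
From mathcomp Require Import all_boot all_order all_algebra.
From mathcomp Require Import complex ring lra.
From mathcomp Require Import all_classical all_reals all_analysis measurable_realfun.

Set Implicit Arguments.
Unset Strict Implicit.
Unset Printing Implicit Defensive.

Import Order.TTheory GRing.Theory Num.Theory.
Import numFieldNormedType.Exports.

Local Open Scope classical_set_scope.
Local Open Scope ring_scope.

(** Why the theorem is true.

    Let [W = wcomp psi phi] be bounded. Applied to the normalized reproducing
    kernel centred at [phi z], which is a unit vector of every Fock space, and
    evaluated at [z], the pointwise estimate of the target space gives
      [|psi z| exp (|phi z|^2 / 2) <= B exp (|z|^2 / 2)]
    ([wcomp_growth]). Such a growth forces [phi z = a z + b] ([growth_affine]),
    then, by Liouville's theorem, [|a| <= 1], and for [|a| = 1] it determines
    [psi] up to a constant factor ([growth_symbol]). In that rigid case [W] is a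
    multiple of an isometry composed with the inclusion of [F^p] in [F^q]
    ([aint_rigid_weight]); this inclusion is bounded if and only if [p <= q]
    ([fock_no_inclusion], [fock_inclusion]). Hence symbols with [|a| = 1] occur
    exactly when [p <= q].

    Paths. For a fixed [phi] two multipliers are joined by a segment, or by two
    segments when the first one meets 0 ([joined_same_symbol]). For [|a| < 1]
    the multiplier 1 is allowed, and the operators with symbols [t phi],
    [0 <= t <= 1], form a Lipschitz path ending at the evaluation at 0, because
    the Gaussian that bounds the derivative of a unit vector is absorbed by the
    contraction ([comp_contraction_lipschitz]). So all the operators with
    [|a| < 1] lie in one path component, which settles the case [q < p].

    Obstructions. For [|a| = 1] the operators with symbol [phi] form an open set:
    tested on the kernel centred at [phi z], an operator of this set has at [z]
    a value of constant normalized modulus, whereas any operator with another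
    symbol is far from this value at some point ([rigid_separated]). They form a
    closed set because kernels separate points ([wcomp_separated]). A path
    cannot leave a set which is open and closed ([joined_clopen]).

    The function theory behind these steps is derived from Goursat's theorem on
    rectangles: residues of simple poles, Taylor coefficients, Liouville's
    theorem, and an estimate of [|f z|^q] by an area integral of [|f|^q] for all
    [q > 0] ([submean_powR]). *)


Local Notation normc := Normc.normc.
Local Notation Re := complex.Re.
Local Notation Im := complex.Im.


(** * Continuity and differentiability in the complex plane *)

Section ComplexBasics.
Context {R : realType}.
Local Notation C := R[i].
Implicit Types (z w : C) (f g : C -> C).

Lemma normc_ge0 z : 0 <= normc z.
Proof.
by case: z => a b; exact: sqrtr_ge0.
Qed.

Lemma normc_eq0 z : (normc z == 0) = (z == 0).
Proof.
apply/eqP/eqP => [/Normc.eq0_normc //|->]; exact: Normc.normc0.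
Qed.

Lemma normc_gt0 z : (0 < normc z) = (z != 0).
Proof.
by rewrite lt_def normc_ge0 andbT normc_eq0.
Qed.

Lemma normcBC z w : normc (z - w) = normc (w - z).
Proof.
by rewrite -normcN opprB.
Qed.

Lemma sqr_normc z : normc z ^+ 2 = Re z ^+ 2 + Im z ^+ 2.
Proof.
by case: z => a b /=; rewrite sqr_sqrtr // addr_ge0 // sqr_ge0.
Qed.

Lemma Re_le_normc z : `|Re z| <= normc z.
Proof.
rewrite -(@ler_pXn2r _ 2) ?nnegrE ?normc_ge0 // sqr_normc real_normK ?num_real //.
by rewrite lerDl sqr_ge0.
Qed.

Lemma Im_le_normc z : `|Im z| <= normc z.
Proof.
rewrite -(@ler_pXn2r _ 2) ?nnegrE ?normc_ge0 // sqr_normc real_normK ?num_real //.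
by rewrite lerDr sqr_ge0.
Qed.

Lemma normc_le_ReIm z : normc z <= `|Re z| + `|Im z|.
Proof.
rewrite -(@ler_pXn2r _ 2) ?nnegrE ?normc_ge0 ?addr_ge0 //.
rewrite sqr_normc sqrrD !real_normK ?num_real // lerD2r lerDl.
by rewrite mulrn_wge0 // mulr_ge0.
Qed.

Lemma normcC (x : R) : normc (real_complex R x) = `|x|.
Proof.
by rewrite /= expr0n addr0 sqrtr_sqr.
Qed.

Lemma normc_i : normc (Complex 0 1 : C) = 1.
Proof.
by rewrite /= expr0n add0r expr1n sqrtr1.
Qed.

Lemma normcX z n : normc (z ^+ n) = normc z ^+ n.
Proof.
elim: n => [|n IH]; first by rewrite !expr0 Normc.normc1.
by rewrite !exprS Normc.normcM IH.
Qed.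

Lemma ler_normcB z w : normc (z - w) <= normc z + normc w.
Proof.
by rewrite -(normcN w); exact: le_normcD.
Qed.

Lemma ler_normc_dist z w : normc z - normc w <= normc (z - w).
Proof.
by rewrite lerBlDr -{1}(subrK w z); exact: le_normcD.
Qed.

(** Continuity in terms of the real modulus: the norm of a complex number seen
    as an element of a normed module over the complex field is itself complex. *)
Definition cts f z := forall e : R, 0 < e ->
  exists2 d : R, 0 < d & forall w, normc (w - z) < d -> normc (f w - f z) < e.

Lemma cts_cst (c : C) z : cts (fun=> c) z.
Proof.
by move=> e e0; exists 1 => // w _; rewrite subrr Normc.normc0.
Qed.

Lemma cts_id z : cts id z.
Proof.
by move=> e e0; exists e.
Qed.

Lemma ctsD f g z : cts f z -> cts g z -> cts (fun w => f w + g w) z.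
Proof.
move=> fz gz e e0; have e20 : 0 < e / 2 by rewrite divr_gt0.
have [r r0 fr] := fz _ e20; have [t t0 gt] := gz _ e20.
exists (Num.min r t); first by rewrite lt_min r0.
move=> w; rewrite lt_min => /andP[wr wt].
rewrite opprD addrACA (splitr e); apply: (le_lt_trans (le_normcD _ _)).
by rewrite ltrD ?fr ?gt.
Qed.

Lemma ctsM f g z : cts f z -> cts g z -> cts (fun w => f w * g w) z.
Proof.
move=> fz gz e e0.
set K := normc (f z) + normc (g z) + 1.
have K0 : 0 < K by rewrite ltr_wpDl // addr_ge0 // normc_ge0.
have h0 : 0 < Num.min 1 (e / 2 / K) by rewrite lt_min ltr01 /= !divr_gt0.
have [r r0 fr] := fz _ h0; have [t t0 gt] := gz _ h0.
exists (Num.min r t); first by rewrite lt_min r0.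
move=> w; rewrite lt_min => /andP[/fr wr /gt wt].
have -> : f w * g w - f z * g z = (f w - f z) * g w + f z * (g w - g z) by ring.
apply: (le_lt_trans (le_normcD _ _)); rewrite !Normc.normcM.
move: wr wt; rewrite !lt_min => /andP[_ f2] /andP[g1 g2].
have g3 : normc (g w) <= normc (g z) + 1.
  by rewrite addrC -lerBlDr (le_trans (ler_normc_dist _ _)) // ltW.
have A : normc (f w - f z) * normc (g w) <= e / 2 / K * (normc (g z) + 1).
  by rewrite ler_pM ?normc_ge0 // ltW.
have B : normc (f z) * normc (g w - g z) <= normc (f z) * (e / 2 / K).
  by rewrite ler_wpM2l ?normc_ge0 // ltW.
apply: (le_lt_trans (lerD A B)).
rewrite [X in _ + X]mulrC -mulrDr (_ : _ + _ + _ = K); last by rewrite /K; ring.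
by rewrite divfK ?gt_eqF // ltr_pdivrMr // ltr_pMr // ltr1n.
Qed.

Lemma ctsN f z : cts f z -> cts (fun w => - f w) z.
Proof.
move=> fz e e0; have [r r0 fr] := fz _ e0; exists r => // w /fr.
by rewrite -opprD normcN.
Qed.

Lemma ctsB f g z : cts f z -> cts g z -> cts (fun w => f w - g w) z.
Proof.
by move=> fz gz; apply: ctsD => //; exact: ctsN.
Qed.

Lemma ctsV f z : f z != 0 -> cts f z -> cts (fun w => (f w)^-1) z.
Proof.
move=> f0 fz e e0; have nf0 : 0 < normc (f z) by rewrite normc_gt0.
have h0 : 0 < Num.min (normc (f z) / 2) (e * normc (f z) ^+ 2 / 2).
  by rewrite lt_min !divr_gt0 // mulr_gt0 // exprn_gt0.
have [r r0 fr] := fz _ h0; exists r => // w /fr; rewrite lt_min => /andP[w1 w2].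
have fw : normc (f z) / 2 < normc (f w).
  have := ler_normc_dist (f z) (f w); rewrite normcBC => H.
  by have := le_lt_trans H w1; lra.
have nfw : 0 < normc (f w) by apply: lt_trans fw; rewrite divr_gt0.
have fw0 : f w != 0 by rewrite -normc_gt0.
have -> : (f w)^-1 - (f z)^-1 = (f z - f w) / (f w * f z) by field; rewrite fw0 f0.
rewrite Normc.normcM Normc.normcV Normc.normcM normcBC ltr_pdivrMr ?mulr_gt0 //.
apply: (lt_trans w2).
rewrite (_ : e * _ / 2 = e * (normc (f z) / 2 * normc (f z))); last by ring.
by rewrite ltr_pM2l // ltr_pM2r.
Qed.

Lemma cts_comp f g z : cts f z -> cts g (f z) -> cts (g \o f) z.
Proof.
move=> fz gz e e0; have [r r0 gr] := gz _ e0; have [t t0 ft] := fz _ r0.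
by exists t => // w /ft/gr.
Qed.

Lemma cts_near f g z (r : R) : 0 < r ->
  (forall w, normc (w - z) < r -> f w = g w) -> cts f z -> cts g z.
Proof.
move=> r0 fg fz e e0; have [d d0 fd] := fz _ e0.
exists (Num.min d r); first by rewrite lt_min d0.
move=> w; rewrite lt_min => /andP[wd wr].
rewrite -!fg ?subrr ?Normc.normc0 //; exact: fd.
Qed.

(** Caratheodory's form of complex differentiability; [g] is the slope
    function, so that [g z] is the derivative. *)
Definition has_cder f z (d : C) :=
  exists g, [/\ cts g z, g z = d & forall w, f w - f z = (w - z) * g w].

Lemma has_cderP f z d : has_cder f z d <-> forall e : R, 0 < e ->
  exists2 r : R, 0 < r &
    forall w, normc (w - z) < r -> normc (f w - f z - (w - z) * d) <= e * normc (w - z).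
Proof.
split=> [[g [gz gd fg]] e e0|H].
  have [r r0 gr] := gz _ e0; exists r => // w wr.
  by rewrite fg -mulrBr Normc.normcM mulrC ler_wpM2r ?normc_ge0 // -gd ltW // gr.
exists (fun w => if w == z then d else (f w - f z) / (w - z)); split.
- move=> e e0; have e20 : 0 < e / 2 by rewrite divr_gt0.
  have [r r0 fr] := H _ e20; exists r => // w wr; rewrite eqxx.
  have [_|wz] := eqVneq w z; first by rewrite subrr Normc.normc0.
  have wz0 : w - z != 0 by rewrite subr_eq0.
  have wz1 : 0 < normc (w - z) by rewrite normc_gt0.
  rewrite -(ltr_pM2r wz1) -Normc.normcM mulrBl divfK // [d * _]mulrC.
  by apply: (le_lt_trans (fr _ wr)); rewrite ltr_pM2r // ltr_pdivrMr // ltr_pMr // ltr1n.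
- by rewrite eqxx.
- move=> w; have [->|wz] := eqVneq w z; first by rewrite !subrr mul0r.
  by rewrite mulrC divfK // subr_eq0.
Qed.

Lemma entire_cder f : entire f -> forall z, exists d, has_cder f z d.
Proof.
move=> ef z; have /cvg_ex[/= d dz] := ef z; exists d; apply/has_cderP => e e0.
move/(@cvgrPdistC_lt C C^o) : dz => /(_ (real_complex R e)).
rewrite ltcR => /(_ e0)/(@nbhs_ballP C C^o)[[r r'] /=].
rewrite ltcE /= => /andP[/eqP -> r0] H; exists r => // w wr.
have [->|wz] := eqVneq w z; first by rewrite !subrr mul0r subrr Normc.normc0 mulr0.
have wz0 : w - z != 0 by rewrite subr_eq0.
have /H/(_ wz0) : ball (0 : C^o) (real_complex R r) (w - z).
  by rewrite /ball /= sub0r ltcR normcN.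
rewrite /= ltcR [(w - z)%:A]mulr1 subrK => /ltW; rewrite -[_ *: _]/(_ * _) => K.
have := ler_wpM2r (normc_ge0 (w - z)) K.
by rewrite -Normc.normcM mulrBl mulrAC mulVf // mul1r [d * _]mulrC.
Qed.

Lemma cder_entire f : (forall z, exists d, has_cder f z d) -> entire f.
Proof.
move=> H z; have [d /has_cderP dz] := H z; apply/cvg_ex; exists d.
apply/(@cvgrPdistC_lt C C^o) => -[e e']; rewrite ltcE /= => /andP[/eqP -> e0].
have e20 : 0 < e / 2 by rewrite divr_gt0.
have [r r0 Hr] := dz _ e20; apply/(@nbhs_ballP C C^o); exists (real_complex R r).
  by rewrite /= ltcR.
move=> h; rewrite /ball /= sub0r ltcR normcN => hr h0.
rewrite ltcR [h%:A]mulr1 -[_ *: _]/(_ * _).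
have := Hr (h + z); rewrite addrK => /(_ hr) K.
have h1 : 0 < normc h by rewrite normc_gt0.
rewrite -(ltr_pM2l h1) -Normc.normcM mulrBr mulrA mulfV // mul1r.
by apply: (le_lt_trans K); rewrite mulrC ltr_pM2l // ltr_pdivrMr // ltr_pMr // ltr1n.
Qed.

Lemma has_cder_cts f z d : has_cder f z d -> cts f z.
Proof.
move=> [g [gz _ fg]].
have -> : f = fun w => f z + (w - z) * g w by apply/funext => w; rewrite -fg addrC subrK.
apply: ctsD; first exact: cts_cst.
by apply: ctsM => //; apply: ctsB; [exact: cts_id|exact: cts_cst].
Qed.

Lemma has_cderV z : z != 0 -> has_cder (fun w => w^-1) z (- (z * z)^-1).
Proof.
move=> z0; apply/has_cderP => e e0.
have zp : 0 < normc z by rewrite normc_gt0.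
have [d d0 Hd] := ctsV z0 (cts_id z) (mulr_gt0 e0 zp).
exists (Num.min d (normc z)); first by rewrite lt_min d0.
move=> w; rewrite lt_min => /andP[wd wz].
have w0 : w != 0.
  by apply: contraTneq wz => ->; rewrite sub0r normcN ltxx.
have -> : w^-1 - z^-1 - (w - z) * - (z * z)^-1 = - ((w - z) / z * (w^-1 - z^-1)).
  by field; rewrite w0 z0.
rewrite normcN !Normc.normcM Normc.normcV -mulrA mulrC ler_wpM2r ?normc_ge0 //.
by rewrite mulrC ler_pdivrMr // ltW // Hd.
Qed.

Definition holo f z := exists d, has_cder f z d.

Lemma entireP f : entire f <-> forall z, holo f z.
Proof.
by split=> [/entire_cder//|/cder_entire].
Qed.

Lemma holo_cts f z : holo f z -> cts f z.
Proof.
by move=> [d /has_cder_cts].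
Qed.

Lemma holo_cst (c : C) z : holo (fun=> c) z.
Proof.
by exists 0, (fun=> 0); split=> // [|w]; [exact: cts_cst|rewrite subrr mulr0].
Qed.

Lemma holo_id z : holo id z.
Proof.
by exists 1, (fun=> 1); split=> // [|w]; [exact: cts_cst|rewrite mulr1].
Qed.

Lemma holoD f g z : holo f z -> holo g z -> holo (fun w => f w + g w) z.
Proof.
move=> [_ [F [Fz _ fF]]] [_ [G [Gz _ gG]]]; exists (F z + G z), (fun w => F w + G w).
by split=> // [|w]; [exact: ctsD|rewrite mulrDr -fF -gG opprD addrACA].
Qed.

Lemma holoM f g z : holo f z -> holo g z -> holo (fun w => f w * g w) z.
Proof.
move=> [_ [F [Fz _ fF]]] hg; have gc := holo_cts hg; case: hg => _ [G [Gz _ gG]].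
exists (F z * g z + f z * G z), (fun w => F w * g w + f z * G w); split=> // [|w].
  by apply: ctsD; apply: ctsM => //; exact: cts_cst.
by rewrite mulrDr mulrA -fF mulrCA -gG; ring.
Qed.

Lemma holoB f g z : holo f z -> holo g z -> holo (fun w => f w - g w) z.
Proof.
move=> hf hg; apply: holoD => //; under eq_fun do rewrite -mulN1r.
by apply: holoM => //; exact: holo_cst.
Qed.

Lemma holo_comp f g z : holo f z -> holo g (f z) -> holo (g \o f) z.
Proof.
move=> hf; have fc := holo_cts hf; case: hf => _ [F [Fz _ fF]] [_ [G [Gz _ gG]]].
exists (G (f z) * F z), (fun w => G (f w) * F w); split=> // [|w].
  by apply: ctsM => //; exact: (@cts_comp f G).
by rewrite /= gG fF -mulrA [F w * _]mulrC.
Qed.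

Lemma holoV f z : f z != 0 -> holo f z -> holo (fun w => (f w)^-1) z.
Proof.
by move=> f0 hf; apply: (holo_comp hf); eexists; exact: has_cderV.
Qed.

Lemma holoX f z n : holo f z -> holo (fun w => f w ^+ n) z.
Proof.
move=> fz; elim: n => [|n IH]; first exact: holo_cst.
rewrite (_ : (fun w => _) = fun w => f w * f w ^+ n); first exact: holoM.
by apply/funext => w; rewrite exprS.
Qed.

End ComplexBasics.

(** * The complex exponential *)

Section ComplexExponential.
Context {R : realType}.
Local Notation C := R[i].
Implicit Types (z w : C).

Definition cexp z : C :=
  Complex (expR (Re z) * cos (Im z)) (expR (Re z) * sin (Im z)).

Lemma cexpD z w : cexp (z + w) = cexp z * cexp w.
Proof.
case: z w => [a b] [c d]; rewrite /cexp /= expRD cosD sinD.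
by congr Complex; ring.
Qed.

Lemma cexp0 : cexp 0 = 1.
Proof.
by rewrite /cexp /= expR0 cos0 sin0 mulr1 mulr0.
Qed.

Lemma normc_cexp z : normc (cexp z) = expR (Re z).
Proof.
rewrite /= !exprMn -mulrDr cos2Dsin2 mulr1 sqrtr_sqr gtr0_norm //.
exact: expR_gt0.
Qed.

Lemma cexp_neq0 z : cexp z != 0.
Proof.
by rewrite -normc_gt0 normc_cexp expR_gt0.
Qed.

Lemma is_derive_linear_approx (f : R -> R) (d x : R) : is_derive x 1 f d ->
  forall e : R, 0 < e -> exists2 r : R, 0 < r &
    forall h, `|h| < r -> `|f (h + x) - f x - h * d| <= e * `|h|.
Proof.
move=> [df <-] e e0; move/cvg_ex : df => /= [l fl].
have -> : 'D_1 f x = l by exact: cvg_lim fl.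
move/cvgrPdist_le : fl => /(_ e e0)/nbhs_ballP[r /= r0 fr].
exists r => // h hr; have [->|h0] := eqVneq h 0.
  by rewrite add0r subrr mul0r subrr normr0 mulr0.
have /fr/(_ h0)/= : ball (0 : R) r h by rewrite /ball /= sub0r normrN.
rewrite [h%:A]mulr1 -[_ *: _]/(_ * _) => /(ler_wpM2r (normr_ge0 h)).
by rewrite -normrM mulrBl mulrAC mulVf // mul1r distrC [l * h]mulrC.
Qed.

(** The real expansions of [exp], [cos] and [sin] at 0 combine to first order,
    the products of two increments being negligible. *)
Lemma has_cder_cexp0 : has_cder cexp 0 1.
Proof.
apply/has_cderP => e e0.
set E := expR 1 : R; have E0 : 0 < E := expR_gt0 1.
(* The errors on the real and imaginary parts have the constants [E + 1] and
   [E + 2]. *)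
pose k := 2 * E + 3; have k0 : 0 < k by rewrite /k; lra.
have [t [t0 t1 te]] : exists t : R, [/\ 0 < t, t <= 1 & t * k <= e].
  exists (Num.min 1 (e / k)); rewrite lt_min ltr01 divr_gt0 //; split => //.
    by rewrite ge_min lexx.
  by rewrite -ler_pdivlMr // ge_min lexx orbT.
have [r1 r10 H1] := is_derive_linear_approx (is_derive_expR 0) t0.
have [r2 r20 H2] := is_derive_linear_approx (is_derive_cos 0) t0.
have [r3 r30 H3] := is_derive_linear_approx (is_derive_sin 0) t0.
exists (Num.min (Num.min r1 r2) (Num.min r3 t)); first by rewrite !lt_min r10 r20 r30 t0.
move=> w; rewrite subr0 !lt_min cexp0 mulr1 => /andP[/andP[w1 w2] /andP[w3 wt]].
set h := normc w.
have xh : `|Re w| <= h by exact: Re_le_normc.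
have yh : `|Im w| <= h by exact: Im_le_normc.
have h0 : 0 <= h by exact: normc_ge0.
have := H1 (Re w) (le_lt_trans xh w1); rewrite addr0 expR0 mulr1 => A.
have := H2 (Im w) (le_lt_trans yh w2); rewrite addr0 cos0 sin0 oppr0 mulr0 subr0 => B.
have := H3 (Im w) (le_lt_trans yh w3); rewrite addr0 cos0 sin0 subr0 mulr1 => D.
have {}A : `|expR (Re w) - 1 - Re w| <= t * h by apply: le_trans A _; rewrite ler_pM2l.
have {}B : `|cos (Im w) - 1| <= t * h by apply: le_trans B _; rewrite ler_pM2l.
have {}D : `|sin (Im w) - Im w| <= t * h by apply: le_trans D _; rewrite ler_pM2l.
have xE : expR (Re w) <= E.
  rewrite ler_expR; apply: le_trans (ler_norm _) _; apply: le_trans xh _.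
  by apply: le_trans t1; exact: ltW.
have X : `|expR (Re w) - 1| <= 2 * h.
  have -> : expR (Re w) - 1 = (expR (Re w) - 1 - Re w) + Re w by ring.
  apply: le_trans (ler_normD _ _) _.
  have := ler_wpM2r h0 t1; lra.
have P : `|expR (Re w) * (cos (Im w) - 1)| <= E * (t * h).
  by rewrite normrM (gtr0_norm (expR_gt0 _)) ler_pM // expR_ge0.
have Q : `|expR (Re w) * (sin (Im w) - Im w)| <= E * (t * h).
  by rewrite normrM (gtr0_norm (expR_gt0 _)) ler_pM // expR_ge0.
have S : `|(expR (Re w) - 1) * Im w| <= 2 * h * t.
  by rewrite normrM ler_pM // (le_trans yh) // ltW.
have RE : `|Re (cexp w - 1 - w)| <= (E + 1) * (t * h).
  case: w @h {w1 w2 w3} wt xh yh h0 A B D xE X P Q S => a b /= wt xh yh h0 A B D xE X P Q S.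
  rewrite (_ : _ - a = expR a * (cos b - 1) + (expR a - 1 - a)); last by ring.
  by apply: le_trans (ler_normD _ _) _; have := lerD P A; lra.
have IM : `|Im (cexp w - 1 - w)| <= (E + 2) * (t * h).
  case: w @h {w1 w2 w3 RE} wt xh yh h0 A B D xE X P Q S => a b /= wt xh yh h0 A B D xE X P Q S.
  rewrite (_ : _ - b = expR a * (sin b - b) + (expR a - 1) * b); last by ring.
  by apply: le_trans (ler_normD _ _) _; have := lerD Q S; lra.
apply: le_trans (normc_le_ReIm _) _; apply: le_trans (lerD RE IM) _.
rewrite -mulrDl (_ : E + 1 + (E + 2) = k); last by rewrite /k; ring.
by rewrite mulrA [k * t]mulrC ler_wpM2r.
Qed.

(** The functional equation moves the derivative at 0 to any point. *)
Lemma has_cder_cexp z : has_cder cexp z (cexp z).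
Proof.
have [g [gz g1 cg]] := has_cder_cexp0.
exists (fun w => cexp z * g (w - z)); split.
- apply: ctsM; first exact: cts_cst.
  apply: (@cts_comp _ (fun w => w - z) g); last by rewrite subrr.
  by apply: ctsB; [exact: cts_id|exact: cts_cst].
- by rewrite subrr g1 mulr1.
- move=> w; have := cg (w - z); rewrite cexp0 subr0 => H.
  by rewrite mulrCA -H mulrBr mulr1 -cexpD [z + _]addrC subrK.
Qed.

Lemma holo_cexp (f : C -> C) z : holo f z -> holo (cexp \o f) z.
Proof.
by move=> fz; apply: holo_comp => //; eexists; exact: has_cder_cexp.
Qed.

End ComplexExponential.

(** * Integrals along segments *)

Section PathIntegrals.
Context {R : realType}.
Local Notation C := R[i].
Local Notation mu := (@lebesgue_measure R).
Implicit Types (F G : R -> C) (a b c d t : R).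

Definition rcts F t := forall e : R, 0 < e ->
  exists2 r : R, 0 < r & forall s, `|s - t| < r -> normc (F s - F t) < e.

Definition pcts F a b := forall t, a <= t <= b -> rcts F t.

Definition cint a b F : C :=
  Complex (\int[mu]_(t in `[a, b]) Re (F t)) (\int[mu]_(t in `[a, b]) Im (F t)).

Lemma pcts_integrable (p : C -> R) F a b : (forall z w, `|p z - p w| <= normc (z - w)) ->
  pcts F a b -> mu.-integrable `[a, b] (EFin \o (p \o F)).
Proof.
move=> pl Fc; apply: (@continuous_compact_integrable _ (p \o F)).
  exact: segment_compact.
apply: continuous_in_subspaceT => t; rewrite inE /= in_itv /= => tab.
apply/cvgrPdistC_lt => e e0; have [r r0 Fr] := Fc _ tab _ e0.
apply/nbhs_ballP; exists r => //= s; rewrite /ball /= distrC => st.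
by apply: le_lt_trans (pl _ _) _; exact: Fr.
Qed.

Lemma pcts_integrable_Re F a b : pcts F a b -> mu.-integrable `[a, b] (EFin \o (fun t => Re (F t))).
Proof.
by apply: (@pcts_integrable (@complex.Re R)) => z w; apply: le_trans (Re_le_normc _); case: z w => [? ?] [? ?].
Qed.

Lemma pcts_integrable_Im F a b : pcts F a b -> mu.-integrable `[a, b] (EFin \o (fun t => Im (F t))).
Proof.
by apply: (@pcts_integrable (@complex.Im R)) => z w; apply: le_trans (Im_le_normc _); case: z w => [? ?] [? ?].
Qed.

Lemma pcts_integrable_normc F a b : pcts F a b -> mu.-integrable `[a, b] (EFin \o (fun t => normc (F t))).
Proof.
apply: (@pcts_integrable (@Normc.normc R)) => z w; rewrite ler_norml ler_normc_dist andbT.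
by rewrite lerNl opprB normcBC ler_normc_dist.
Qed.

Lemma eq_cint F G a b : (forall t, a <= t <= b -> F t = G t) -> cint a b F = cint a b G.
Proof.
by move=> FG; congr Complex; apply: eq_Rintegral => t; rewrite inE /= in_itv /= => /FG ->.
Qed.

Lemma cintD F G a b : pcts F a b -> pcts G a b ->
  cint a b (fun t => F t + G t) = cint a b F + cint a b G.
Proof.
move=> Fc Gc; congr Complex.
  rewrite -RintegralD ?pcts_integrable_Re //.
  by apply: eq_Rintegral => t _; case: (F t) (G t) => [? ?] [? ?].
rewrite -RintegralD ?pcts_integrable_Im //.
by apply: eq_Rintegral => t _; case: (F t) (G t) => [? ?] [? ?].
Qed.

Lemma cintZ (k : C) F a b : pcts F a b -> cint a b (fun t => k * F t) = k * cint a b F.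
Proof.
move=> Fc; have iR := pcts_integrable_Re Fc; have iI := pcts_integrable_Im Fc.
have sR (x : R) : mu.-integrable `[a, b] (EFin \o (fun t => x * Re (F t))).
  exact: (@integrableZl _ _ _ mu `[a, b] _ x (fun t => (Re (F t))%:E)).
have sI (x : R) : mu.-integrable `[a, b] (EFin \o (fun t => x * Im (F t))).
  exact: (@integrableZl _ _ _ mu `[a, b] _ x (fun t => (Im (F t))%:E)).
rewrite (_ : k * cint a b F = Complex
  (Re k * \int[mu]_(t in `[a, b]) Re (F t) - Im k * \int[mu]_(t in `[a, b]) Im (F t))
  (Re k * \int[mu]_(t in `[a, b]) Im (F t) + Im k * \int[mu]_(t in `[a, b]) Re (F t))); last by case: k.
congr Complex; rewrite -!RintegralZl // -?RintegralB -?RintegralD //; apply: eq_Rintegral => t _;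
  by case: k (F t) => [? ?] [? ?].
Qed.

Lemma rctsN F t : rcts F t -> rcts (fun s => - F s) t.
Proof.
by move=> Ft e e0; have [r r0 H] := Ft _ e0; exists r => // s /H; rewrite -opprD normcN.
Qed.

Lemma cintN F a b : pcts F a b -> cint a b (fun t => - F t) = - cint a b F.
Proof.
move=> Fc; rewrite -mulN1r -cintZ //; apply: eq_cint => t _; by rewrite mulN1r.
Qed.

Lemma cintB F G a b : pcts F a b -> pcts G a b ->
  cint a b (fun t => F t - G t) = cint a b F - cint a b G.
Proof.
move=> Fc Gc; rewrite (@cintD F (fun t => - G t)) ?cintN // => t tab; exact/rctsN/Gc.
Qed.

Lemma Rintegral_cst_itv a b (r : R) : a <= b -> \int[mu]_(t in `[a, b]) r = (b - a) * r.
Proof.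
move=> ab; rewrite Rintegral_cst // mulrC; congr (_ * _).
have := @lebesgue_measure_itv R `[a, b]; rewrite /= lte_fin => ->.
by move: ab; rewrite le_eqVlt => /predU1P[->|->] /=; rewrite ?ltxx ?subrr.
Qed.

Lemma cint_cst (k : C) a b : a <= b -> cint a b (fun=> k) = real_complex R (b - a) * k.
Proof.
move=> ab; rewrite /cint !Rintegral_cst_itv //.
by case: k => x y /=; rewrite -[RHS]/(Complex _ _) /= !mul0r subr0 addr0.
Qed.

Lemma cint_split m F a b : a <= m <= b -> pcts F a b ->
  cint a b F = cint a m F + cint m b F.
Proof.
move=> /andP[am mb] Fc.
have main (f : R -> R) : mu.-integrable `[a, b] (EFin \o f) ->
    \int[mu]_(t in `[a, b]) f t = \int[mu]_(t in `[a, m]) f t + \int[mu]_(t in `[m, b]) f t.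
  move=> fi; have := @Rintegral_itvB _ f (BLeft a) (BRight b) m fi.
  rewrite bnd_simp => /(_ am mb) H.
  rewrite -(@Rintegral_itv_obnd_cbnd _ m (BRight b)); first by rewrite -H addrC subrK.
  apply: integrableS fi => //= t /=; rewrite !in_itv /= => /andP[/ltW mt ->].
  by rewrite (le_trans am mt).
rewrite /cint (main _ (pcts_integrable_Re Fc)) (main _ (pcts_integrable_Im Fc)) //.
Qed.

(** The factor 2 comes from estimating the real and imaginary parts separately;
    only the order of magnitude matters below. *)
Lemma le_normc_cint F a b : pcts F a b ->
  normc (cint a b F) <= 2 * \int[mu]_(t in `[a, b]) normc (F t).
Proof.
move=> Fc; have iR := pcts_integrable_Re Fc; have iI := pcts_integrable_Im Fc.
have iN := pcts_integrable_normc Fc.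
apply: le_trans (normc_le_ReIm _) _ => /=.
rewrite mulr2n mulrDl mul1r; apply: lerD.
  apply: le_trans (le_normr_Rintegral _ iR) _ => //.
  apply: le_Rintegral => //; first exact: (@integrable_norm _ _ _ mu `[a, b] (fun t => Re (F t))).
  by move=> t _; exact: Re_le_normc.
apply: le_trans (le_normr_Rintegral _ iI) _ => //.
apply: le_Rintegral => //; first exact: (@integrable_norm _ _ _ mu `[a, b] (fun t => Im (F t))).
by move=> t _; exact: Im_le_normc.
Qed.

Lemma cint_bound F a b (M : R) : a <= b -> pcts F a b ->
  (forall t, a <= t <= b -> normc (F t) <= M) -> normc (cint a b F) <= 2 * (b - a) * M.
Proof.
move=> ab Fc FM; apply: le_trans (le_normc_cint Fc) _.
rewrite -mulrA ler_pM2l //.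
rewrite -(Rintegral_cst_itv M ab); apply: le_Rintegral => //.
- exact: pcts_integrable_normc.
- apply: (@continuous_compact_integrable _ (cst M)); first exact: segment_compact.
  by apply: continuous_subspaceT => t; exact: cvg_cst.
Qed.

Lemma cts_hline (f : C -> C) (y t : R) : cts f (Complex t y) -> rcts (fun x => f (Complex x y)) t.
Proof.
move=> ft e e0; have [r r0 fr] := ft _ e0; exists r => // s st; apply: fr.
by rewrite -[_ - _]/(Complex _ _) subrr complexr0 normcC.
Qed.

Lemma cts_vline (f : C -> C) (x t : R) : cts f (Complex x t) -> rcts (fun y => f (Complex x y)) t.
Proof.
move=> ft e e0; have [r r0 fr] := ft _ e0; exists r => // s st; apply: fr.
by rewrite -[_ - _]/(Complex _ _) subrr /= expr0n add0r sqrtr_sqr.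
Qed.

End PathIntegrals.

#[local] Arguments Normc.normc : simpl never.
#[local] Arguments cint : simpl never.

(** * Goursat's theorem on rectangles *)

Section Goursat.
Context {R : realType}.
Local Notation C := R[i].
Implicit Types (f g : C -> C) (a b c d : R) (z w : C).

(** The integral of [f dz] along the boundary of the rectangle with horizontal
    side [[a, b]] and vertical side [[c, d]], run counterclockwise. *)
Definition rint f a b c d : C :=
  cint a b (fun x => f (Complex x c)) - cint a b (fun x => f (Complex x d))
  + Complex 0 1 * (cint c d (fun y => f (Complex b y)) - cint c d (fun y => f (Complex a y))).

Definition boundary_cts f a b c d :=
  (forall x, a <= x <= b -> cts f (Complex x c) /\ cts f (Complex x d)) /\
  (forall y, c <= y <= d -> cts f (Complex a y) /\ cts f (Complex b y)).

Lemma bcts_pcts f a b c d : boundary_cts f a b c d ->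
  [/\ pcts (fun x => f (Complex x c)) a b, pcts (fun x => f (Complex x d)) a b,
      pcts (fun y => f (Complex b y)) c d & pcts (fun y => f (Complex a y)) c d].
Proof.
move=> [fh fv]; split=> t tab; [exact/cts_hline/(fh _ tab).1|exact/cts_hline/(fh _ tab).2
  |exact/cts_vline/(fv _ tab).2|exact/cts_vline/(fv _ tab).1].
Qed.

Lemma rintB f g a b c d : boundary_cts f a b c d -> boundary_cts g a b c d ->
  rint (fun z => f z - g z) a b c d = rint f a b c d - rint g a b c d.
Proof.
move=> /bcts_pcts[f1 f2 f3 f4] /bcts_pcts[g1 g2 g3 g4].
by rewrite /rint !cintB //; ring.
Qed.

Lemma rintD f g a b c d : boundary_cts f a b c d -> boundary_cts g a b c d ->
  rint (fun z => f z + g z) a b c d = rint f a b c d + rint g a b c d.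
Proof.
move=> /bcts_pcts[f1 f2 f3 f4] /bcts_pcts[g1 g2 g3 g4].
by rewrite /rint !cintD //; ring.
Qed.

Lemma rintZ (k : C) f a b c d : boundary_cts f a b c d ->
  rint (fun z => k * f z) a b c d = k * rint f a b c d.
Proof.
move=> /bcts_pcts[f1 f2 f3 f4].
by rewrite /rint !cintZ //; ring.
Qed.

Lemma eq_rint f g a b c d : (forall x, a <= x <= b -> f (Complex x c) = g (Complex x c) /\ f (Complex x d) = g (Complex x d)) ->
  (forall y, c <= y <= d -> f (Complex a y) = g (Complex a y) /\ f (Complex b y) = g (Complex b y)) ->
  rint f a b c d = rint g a b c d.
Proof.
move=> H V; rewrite /rint; congr (_ - _ + _ * (_ - _)); apply: eq_cint => t tab;
  [exact: (H _ tab).1|exact: (H _ tab).2|exact: (V _ tab).2|exact: (V _ tab).1].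
Qed.

Lemma rint_affine (p q : C) a b c d : a <= b -> c <= d ->
  rint (fun z => p + q * z) a b c d = 0.
Proof.
move=> ab cd.
have ca z : cts (fun z => p + q * z) z.
  by apply: ctsD; [exact: cts_cst|apply: ctsM; [exact: cts_cst|exact: cts_id]].
have ph y : pcts (fun x => p + q * Complex x y) a b by move=> t _; exact: (cts_hline (ca _)).
have pv x : pcts (fun y => p + q * Complex x y) c d by move=> t _; exact: (cts_vline (ca _)).
rewrite /rint -!cintB //.
rewrite (@eq_cint _ _ (fun=> q * Complex 0 (c - d))); last first.
  move=> t _; rewrite opprD addrACA subrr add0r -mulrBr; congr (_ * _).
  by rewrite -[LHS]/(Complex _ _) subrr.
rewrite (@eq_cint _ _ (fun=> q * Complex (b - a) 0) c d); last first.
  move=> t _; rewrite opprD addrACA subrr add0r -mulrBr; congr (_ * _).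
  by rewrite -[LHS]/(Complex _ _) subrr.
rewrite !cint_cst //; case: q {ca ph pv} => u v.
by rewrite -[LHS]/(Complex _ _); congr Complex; rewrite /=; ring.
Qed.

Lemma rint_bound f a b c d (M : R) : a <= b -> c <= d -> boundary_cts f a b c d ->
  (forall x, a <= x <= b -> normc (f (Complex x c)) <= M /\ normc (f (Complex x d)) <= M) ->
  (forall y, c <= y <= d -> normc (f (Complex a y)) <= M /\ normc (f (Complex b y)) <= M) ->
  normc (rint f a b c d) <= 4 * ((b - a) + (d - c)) * M.
Proof.
move=> ab cd /bcts_pcts[f1 f2 f3 f4] H V; rewrite /rint.
apply: le_trans (le_normcD _ _) _; rewrite Normc.normcM normc_i mul1r.
have B1 := cint_bound ab f1 (fun t tab => (H t tab).1).
have B2 := cint_bound ab f2 (fun t tab => (H t tab).2).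
have B3 := cint_bound cd f3 (fun t tab => (V t tab).2).
have B4 := cint_bound cd f4 (fun t tab => (V t tab).1).
have := ler_normcB (cint a b (fun x => f (Complex x c))) (cint a b (fun x => f (Complex x d))).
have := ler_normcB (cint c d (fun x => f (Complex b x))) (cint c d (fun x => f (Complex a x))).
lra.
Qed.

Lemma rint_splitx m f a b c d : a <= m <= b ->
  (forall x, a <= x <= b -> cts f (Complex x c) /\ cts f (Complex x d)) ->
  rint f a b c d = rint f a m c d + rint f m b c d.
Proof.
move=> amb H; rewrite /rint.
rewrite (cint_split amb (F := fun x => f (Complex x c))); last by move=> t /H[h _]; exact: cts_hline.
rewrite (cint_split amb (F := fun x => f (Complex x d))); last by move=> t /H[_ h]; exact: cts_hline.
ring.
Qed.

Lemma rint_splity m f a b c d : c <= m <= d ->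
  (forall y, c <= y <= d -> cts f (Complex a y) /\ cts f (Complex b y)) ->
  rint f a b c d = rint f a b c m + rint f a b m d.
Proof.
move=> cmd V; rewrite /rint.
rewrite (cint_split cmd (F := fun y => f (Complex b y))); last by move=> t /V[_ h]; exact: cts_vline.
rewrite (cint_split cmd (F := fun y => f (Complex a y))); last by move=> t /V[h _]; exact: cts_vline.
ring.
Qed.

Lemma nested_intervals (u l : nat -> R) : (forall n, 0 <= l n) ->
  (forall n, u n <= u n.+1) -> (forall n, u n.+1 + l n.+1 <= u n + l n) ->
  exists t, forall n, u n <= t <= u n + l n.
Proof.
move=> l0 ui ul.
have mono m k : u m <= u (m + k)%N /\ u (m + k)%N + l (m + k)%N <= u m + l m.
  elim: k => [|k [IH1 IH2]]; first by rewrite addn0.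
  by rewrite addnS; split; [exact: le_trans IH1 _|exact: le_trans (ul _) _].
have cross n m : u n <= u m + l m.
  have [nm|mn] := leqP n m.
    by have [+ _] := mono n (m - n)%N; rewrite subnKC // => /le_trans; apply; rewrite lerDl.
  have [_] := mono m (n - m)%N; rewrite subnKC; last exact: ltnW.
  by apply: le_trans; rewrite lerDl.
have hs : has_sup (range u).
  by split; [exists (u 0%N), 0%N|exists (u 0%N + l 0%N) => _ [n _ <-]].
exists (sup (range u)) => n; apply/andP; split.
  by apply: ub_le_sup; [exact: hs.2|exists n].
by apply: ge_sup; [exact: hs.1|move=> _ [m _ <-]].
Qed.

Lemma rint_quarter f (x y w h E : R) : 0 <= w -> 0 <= h ->
  (forall u v, x <= u <= x + w + w -> y <= v <= y + h + h -> cts f (Complex u v)) ->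
  4 * E <= normc (rint f x (x + w + w) y (y + h + h)) ->
  exists u v, [/\ u = x \/ u = x + w, v = y \/ v = y + h &
    E <= normc (rint f u (u + w) v (v + h))].
Proof.
move=> w0 h0 fc big; apply: contrapT => nq.
have small u v : u = x \/ u = x + w -> v = y \/ v = y + h ->
    normc (rint f u (u + w) v (v + h)) < E.
  by move=> hu hv; rewrite ltNge; apply/negP => huv; apply: nq; exists u, v.
have S1 := small x y (or_introl erefl) (or_introl erefl).
have S2 := small x _ (or_introl erefl) (or_intror erefl).
have S3 := small _ y (or_intror erefl) (or_introl erefl).
have S4 := small _ _ (or_intror erefl) (or_intror erefl).
have sx : x <= x + w <= x + w + w by rewrite !lerDl w0.
have sy : y <= y + h <= y + h + h by rewrite !lerDl h0.
have xw : x <= x + w + w by case/andP: sx => /le_trans; apply.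
have yh : y <= y + h + h by case/andP: sy => /le_trans; apply.
move: big; rewrite (rint_splitx sx); last first.
  by move=> t tt; split; apply: fc; rewrite ?tt ?lexx ?yh.
rewrite !(rint_splity sy).
- rewrite leNgt => /negP; apply.
  rewrite (_ : 4 * E = E + E + (E + E)); last by ring.
  by apply: le_lt_trans (le_normcD _ _) _; apply: ltrD; apply: le_lt_trans (le_normcD _ _) _; exact: ltrD.
- by move=> t tt; split; apply: fc; rewrite ?tt ?lexx ?xw ?sx.
- by move=> t tt; split; apply: fc; rewrite ?tt ?lexx ?xw ?sx.
Qed.

(** Subtracting the first order expansion, whose integral vanishes, leaves an
    integrand of size [eta] times the diameter on a contour of comparable length. *)
Lemma rint_near_affine f (x y w h : R) z0 (e : C) (eta : R) : 0 <= w -> 0 <= h -> 0 <= eta ->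
  x <= Re z0 <= x + w -> y <= Im z0 <= y + h ->
  (forall u v, x <= u <= x + w -> y <= v <= y + h -> cts f (Complex u v) /\
    let z := Complex u v in normc (f z - f z0 - (z - z0) * e) <= eta * normc (z - z0)) ->
  normc (rint f x (x + w) y (y + h)) <= 4 * eta * (w + h) ^+ 2.
Proof.
move=> w0 h0 eta0 zx zy H.
have near u v : x <= u <= x + w -> y <= v <= y + h -> normc (Complex u v - z0) <= w + h.
  move=> /andP[u1 u2] /andP[v1 v2]; apply: le_trans (normc_le_ReIm _) _.
  case: z0 zx zy {H} => a b /= /andP[a1 a2] /andP[b1 b2].
  by rewrite lerD // ler_norml; apply/andP; split; lra.
pose A z := (f z0 - z0 * e) + e * z.
have cA z : cts A z.
  by apply: ctsD; [exact: cts_cst|apply: ctsM; [exact: cts_cst|exact: cts_id]].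
have xw : x <= x + w by rewrite lerDl.
have yh : y <= y + h by rewrite lerDl.
have x1 : x <= x <= x + w by rewrite lexx.
have x2 : x <= x + w <= x + w by rewrite xw lexx.
have y1 : y <= y <= y + h by rewrite lexx.
have y2 : y <= y + h <= y + h by rewrite yh lexx.
have bf : boundary_cts f x (x + w) y (y + h) by split=> t tt; split; apply: (H _ _ _ _).1.
have bA : boundary_cts A x (x + w) y (y + h) by [].
have bfA : boundary_cts (fun z => f z - A z) x (x + w) y (y + h).
  by split=> t tt; split; apply: ctsB => //; apply: (H _ _ _ _).1.
have := rintB bf bA; rewrite rint_affine // subr0 => <-.
have small u v : x <= u <= x + w -> y <= v <= y + h -> normc (f (Complex u v) - A (Complex u v)) <= eta * (w + h).
  move=> hu hv; have nuv := near _ _ hu hv.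
  have [_ /=] := H _ _ hu hv; rewrite (_ : _ - _ - _ = f (Complex u v) - A (Complex u v)); last by rewrite /A; ring.
  by move=> /le_trans; apply; rewrite ler_wpM2l.
rewrite (_ : 4 * eta * _ = 4 * ((x + w - x) + (y + h - y)) * (eta * (w + h))); last by ring.
by apply: rint_bound => // t tt; split; exact: small.
Qed.

(** Goursat's bisection: were the integral nonzero, one of the four quarters
    would keep a quarter of it, and so on down to a point, near which the
    integrand differs from an affine function, whose integral vanishes, by an
    error that is small compared with the area. *)
Lemma goursat f a b c d : a <= b -> c <= d ->
  (forall x y, a <= x <= b -> c <= y <= d -> holo f (Complex x y)) ->
  rint f a b c d = 0.
Proof.
move=> ab cd hf; apply: contrapT => /eqP I0.
set E := normc (rint f a b c d); have E0 : 0 < E by rewrite normc_gt0.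
have hcf x y : a <= x <= b -> c <= y <= d -> cts f (Complex x y).
  by move=> xab ycd; exact/holo_cts/hf.
(* The sides after [n] bisections. *)
pose W n : R := (b - a) / 2 ^+ n; pose H n : R := (d - c) / 2 ^+ n.
have W0 n : 0 <= W n by rewrite divr_ge0 ?subr_ge0 // exprn_ge0.
have H0 n : 0 <= H n by rewrite divr_ge0 ?subr_ge0 // exprn_ge0.
have WS n : W n = W n.+1 + W n.+1 by rewrite /W exprS; field; rewrite expf_neq0.
have HS n : H n = H n.+1 + H n.+1 by rewrite /H exprS; field; rewrite expf_neq0.
pose bad n (p : R * R) := [/\ a <= p.1, p.1 + W n <= b, c <= p.2, p.2 + H n <= d &
  E / 4 ^+ n <= normc (rint f p.1 (p.1 + W n) p.2 (p.2 + H n))].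
pose sub n (p q : R * R) := [/\ p.1 <= q.1, q.1 + W n.+1 <= p.1 + W n, p.2 <= q.2 & q.2 + H n.+1 <= p.2 + H n].
have step : forall np : nat * (R * R), exists q, bad np.1 np.2 -> bad np.1.+1 q /\ sub np.1 np.2 q.
  move=> [n [x y]]; have [nb|] := pselect (bad n (x, y)); last by exists (x, y).
  case: (nb) => /= ax xb cy yd xy.
  have Wn := W0 n.+1; have Hn := H0 n.+1.
  have [u [v [hu hv uv]]] : exists u v, [/\ u = x \/ u = x + W n.+1, v = y \/ v = y + H n.+1 &
      E / 4 ^+ n.+1 <= normc (rint f u (u + W n.+1) v (v + H n.+1))].
    apply: rint_quarter => //; rewrite -!addrA -WS -HS.
      move=> u v /andP[u1 u2] /andP[v1 v2]; apply: hcf; apply/andP; split;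
      by [exact: le_trans u1|exact: le_trans u2 _|exact: le_trans v1|exact: le_trans v2 _].
    by apply: le_trans xy; rewrite exprS le_eqVlt; apply/orP; left; apply/eqP; field; rewrite expf_neq0.
  have WW := WS n; have HH := HS n.
  exists (u, v) => _; rewrite /bad /sub /=.
  clear - ax xb cy yd Wn Hn WW HH hu hv uv.
  by move: uv; case: hu => ->; case: hv => -> uv; split; split => //; clear uv; lra.
have [nxt nxtP] := choice step.
pose s := fix s n := if n is m.+1 then nxt (m, s m) else (a, c).
have sbad n : bad n (s n).
  elim: n => [|n IH]; last exact: (nxtP (n, s n) IH).1.
  rewrite /bad /W /H !expr0 !divr1 /=.
  by rewrite [a + _]addrC [c + _]addrC !subrK; split.
have ssub n : sub n (s n) (s n.+1) by exact: (nxtP (n, s n) (sbad n)).2.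
have [x0 xP] : exists t, forall n, (s n).1 <= t <= (s n).1 + W n.
  by apply: nested_intervals => // n; have [] := ssub n.
have [y0 yP] : exists t, forall n, (s n).2 <= t <= (s n).2 + H n.
  by apply: nested_intervals => // n; have [] := ssub n.
have x0ab : a <= x0 <= b.
  by have := xP 0%N; rewrite /W expr0 divr1 /= [a + _]addrC subrK.
have y0cd : c <= y0 <= d.
  by have := yP 0%N; rewrite /H expr0 divr1 /= [c + _]addrC subrK.
have [e /has_cderP he] := hf _ _ x0ab y0cd.
set z0 := Complex x0 y0 in he.
set L : R := (b - a) + (d - c); have L0 : 0 <= L by rewrite addr_ge0 ?subr_ge0.
have L1 : 0 < L ^+ 2 + 1 by rewrite ltr_wpDl // sqr_ge0.
pose eta := E / (8 * (L ^+ 2 + 1)).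
have eta0 : 0 < eta by rewrite divr_gt0 // mulr_gt0.
have [r r0 Hr] := he _ eta0.
have [n Ln] : exists n, L / 2 ^+ n < r.
  have [n Ln] : exists n : nat, L / r < n%:R.
    by exists (Num.bound (L / r)); rewrite archi_boundP // divr_ge0 // ltW.
  exists n; rewrite ltr_pdivrMr ?exprn_gt0 // mulrC -ltr_pdivrMr //.
  by apply: (lt_le_trans Ln); rewrite -natrX ler_nat ltnW //; exact: ltn_expl.
have WH : W n + H n = L / 2 ^+ n by rewrite -mulrDl.
have [ax xb cy yd big] := sbad n.
have xn := xP n; have yn := yP n.
have := @rint_near_affine f (s n).1 (s n).2 (W n) (H n) z0 e eta (W0 n) (H0 n) (ltW eta0) xn yn.
case: (andP xn) => x1 x2; case: (andP yn) => y1 y2.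
have K u v : (s n).1 <= u <= (s n).1 + W n -> (s n).2 <= v <= (s n).2 + H n ->
    cts f (Complex u v) /\ normc (f (Complex u v) - f z0 - (Complex u v - z0) * e) <= eta * normc (Complex u v - z0).
  move=> /andP[u1 u2] /andP[v1 v2]; split.
    by apply: hcf; apply/andP; split; [exact: le_trans u1|exact: le_trans u2 _|exact: le_trans v1|exact: le_trans v2 _].
  apply: Hr; apply: le_lt_trans Ln; rewrite -WH.
  apply: le_trans (normc_le_ReIm _) _; rewrite /z0 /=.
  by rewrite lerD // ler_norml; apply/andP; split; clear - x1 x2 y1 y2 u1 u2 v1 v2; lra.
move=> /(_ K) small; have := le_trans big small.
rewrite WH leNgt => /negP; apply.
have n40 : (4 : R) ^+ n = 2 ^+ n * 2 ^+ n by rewrite -exprMn; congr (_ ^+ _); ring.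
rewrite n40 ltr_pdivlMr ?mulr_gt0 ?exprn_gt0 //.
have -> : 4 * eta * (L / 2 ^+ n) ^+ 2 * (2 ^+ n * 2 ^+ n) = 4 * L ^+ 2 * eta.
  by field; rewrite expf_neq0.
rewrite /eta mulrA ltr_pdivrMr; last by rewrite mulr_gt0.
rewrite mulrC ltr_pM2l //; clear; have := sqr_ge0 L; lra.
Qed.

End Goursat.

(** * The residue of a simple pole *)

Section Residue.
Context {R : realType}.
Local Notation C := R[i].
Local Notation mu := (@lebesgue_measure R).
Implicit Types (f g : C -> C) (a b c d x y : R) (z w : C).

Lemma holo_off_bcts f x0 y0 a b c d : (forall z, z != Complex x0 y0 -> holo f z) ->
  a < x0 < b -> c < y0 < d -> boundary_cts f a b c d.
Proof.
move=> hf /andP[ax xb] /andP[cy yd].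
by split=> t tt; split; apply/holo_cts/hf; rewrite eq_complex /= ?(lt_eqF ax) ?(gt_eqF xb) ?(lt_eqF cy) ?(gt_eqF yd) ?andbF.
Qed.

(** The rectangle minus the square around the singularity is cut into four
    rectangles on which Goursat's theorem applies. *)
Lemma rint_annulus f x0 y0 a b c d (e : R) : (forall z, z != Complex x0 y0 -> holo f z) ->
  0 < e -> a <= x0 - e -> x0 + e <= b -> c <= y0 - e -> y0 + e <= d ->
  rint f a b c d = rint f (x0 - e) (x0 + e) (y0 - e) (y0 + e).
Proof.
move=> hf e0 ax xb cy yd.
have [l r] : x0 - e < x0 /\ x0 < x0 + e by rewrite ltrBlDr ltrDl.
have [l' r'] : y0 - e < y0 /\ y0 < y0 + e by rewrite ltrBlDr ltrDl.
have hl x y : x < x0 -> holo f (Complex x y).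
  by move=> h; apply: hf; rewrite eq_complex /= (lt_eqF h).
have hr x y : x0 < x -> holo f (Complex x y).
  by move=> h; apply: hf; rewrite eq_complex /= (gt_eqF h).
have hd x y : y < y0 -> holo f (Complex x y).
  by move=> h; apply: hf; rewrite eq_complex /= (lt_eqF h) andbF.
have hu x y : y0 < y -> holo f (Complex x y).
  by move=> h; apply: hf; rewrite eq_complex /= (gt_eqF h) andbF.
have cy0 := le_lt_trans cy l'; have y0d := lt_le_trans r' yd.
have ax0 := le_lt_trans ax l; have x0b := lt_le_trans r xb.
have lr : x0 - e <= x0 + e by apply: ltW; exact: lt_trans r.
have lr' : y0 - e <= y0 + e by apply: ltW; exact: lt_trans r'.
rewrite (@rint_splitx _ (x0 - e)); last 2 first.
- by rewrite ax (le_trans lr xb).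
- by move=> x _; split; apply: holo_cts; [exact: hd|exact: hu].
rewrite goursat ?add0r //; last 2 first.
- by rewrite (le_trans cy) // (le_trans lr').
- by move=> x y /andP[_ h] _; apply: hl; exact: le_lt_trans h l.
rewrite (@rint_splitx _ (x0 + e)); last 2 first.
- by rewrite xb lr.
- by move=> x _; split; apply: holo_cts; [exact: hd|exact: hu].
rewrite [X in _ + X]goursat ?addr0 //; last 2 first.
- by rewrite (le_trans cy) // (le_trans lr').
- by move=> x y /andP[h _] _; apply: hr; exact: lt_le_trans h.
rewrite (@rint_splity _ (y0 - e)); last 2 first.
- by rewrite cy (le_trans lr' yd).
- by move=> y _; split; apply: holo_cts; [exact: hl|exact: hr].
rewrite goursat ?add0r //; last first.
  by move=> x y _ /andP[_ h]; apply: hd; exact: le_lt_trans h l'.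
rewrite (@rint_splity _ (y0 + e)); last 2 first.
- by rewrite yd lr'.
- by move=> y _; split; apply: holo_cts; [exact: hl|exact: hr].
rewrite [X in _ + X]goursat ?addr0 //.
by move=> x y _ /andP[h _]; apply: hu; exact: lt_le_trans h.
Qed.

(** An antiderivative is [2 atan ((t - x0) / e)], and [atan 1 = pi / 4]. *)
Lemma Rintegral_poisson x0 (e : R) : 0 < e ->
  \int[mu]_(t in `[x0 - e, x0 + e]) (2 * e / ((t - x0) ^+ 2 + e ^+ 2)) = pi.
Proof.
move=> e0; pose F (t : R) := 2 * atan ((t - x0) / e).
have den (t : R) : 0 < (t - x0) ^+ 2 + e ^+ 2 by rewrite ltr_wpDl ?sqr_ge0 ?exprn_gt0.
have dF (t : R) : is_derive t (1 : R) F (2 * e / ((t - x0) ^+ 2 + e ^+ 2)).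
  have e1 : is_derive t (1 : R) (fun t : R => (t - x0) / e) (e^-1).
    apply: is_derive_eq; rewrite /= ?subr0 ?scaler0 ?add0r ?addr0. exact: mulr1.
  have e2 := @is_derive1_comp R atan (fun t : R => (t - x0) / e) t _ _ (is_derive1_atan _) e1.
  have e3 : is_derive t (1 : R) F (2 *: ((1 + ((t - x0) / e) ^+ 2)^-1 * e^-1)) by apply: is_deriveZ.
  apply: is_derive_eq e3 _; rewrite -[_ *: _]/(_ * _).
  have := den t; rewrite expr_div_n => /lt0r_neq0 D.
  set u := (t - x0) ^+ 2 in D *; have en0 : e != 0 by rewrite gt_eqF.
  have -> : 1 + u / e ^+ 2 = (u + e ^+ 2) / e ^+ 2 by field.
  rewrite invf_div; move: D; set v := u + _ => D; by field; rewrite D en0.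
have cF (t : R) : {for t, continuous F}.
  by apply: differentiable_continuous; apply/derivable1_diffP; case: (dF t).
have ab : x0 - e < x0 + e by rewrite ltrD2l gtrN.
rewrite /Rintegral (@continuous_FTC2 _ _ F) //.
- have -> : F (x0 + e) = 2 * atan 1 by rewrite /F addrAC subrr add0r divff // gt_eqF.
  have -> : F (x0 - e) = 2 * - atan 1.
    by rewrite /F addrAC subrr add0r mulNr divff ?gt_eqF // atanN.
  by rewrite /= atan1; field.
- apply: continuous_subspaceT => t; apply: cvgM; first exact: cvg_cst.
  apply: cvgV; first by rewrite gt_eqF.
  apply: cvgD; last exact: cvg_cst.
  by apply: (@continuous_comp R R R (fun t => t - x0) (fun u => u ^+ 2)); [apply: cvgB; [exact: cvg_id|exact: cvg_cst]|exact: exprn_continuous].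
- split; [by move=> t _; case: (dF t)|exact/cvg_at_right_filter/cF|exact/cvg_at_left_filter/cF].
- by move=> t _; rewrite derive1E; case: (dF t).
Qed.

Lemma inv_Complex (p q : R) : (Complex p q)^-1 = Complex (p / (p ^+ 2 + q ^+ 2)) (- q / (p ^+ 2 + q ^+ 2)).
Proof.
by rewrite mulNr.
Qed.

Lemma holo_recip w z : z != w -> holo (fun z => (z - w)^-1) z.
Proof.
move=> zz; apply: holoV; first by rewrite subr_eq0.
by apply: holoB; [exact: holo_id|exact: holo_cst].
Qed.

(** On opposite sides of the square the integrands add up to a Poisson kernel,
    so that each pair of sides contributes [pi]. *)
Lemma rint_recip x0 y0 (e : R) : 0 < e ->
  rint (fun z => (z - Complex x0 y0)^-1) (x0 - e) (x0 + e) (y0 - e) (y0 + e) = Complex 0 (2 * pi).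
Proof.
move=> e0.
have hf := @holo_recip (Complex x0 y0).
have inx u : u - e < u < u + e by rewrite ltrBlDr ltrDl e0.
have /bcts_pcts[f1 f2 f3 f4] := holo_off_bcts hf (inx x0) (inx y0).
rewrite /rint -!cintB //.
rewrite (@eq_cint _ _ (fun t => Complex 0 (2 * e / ((t - x0) ^+ 2 + e ^+ 2)))); last first.
  move=> t _; rewrite -![_ - Complex x0 y0]/(Complex _ _) !inv_Complex addrAC subrr add0r.
  rewrite (addrAC y0) subrr add0r sqrrN -[LHS]/(Complex _ _) subrr; congr Complex.
  by rewrite -mulrBl; congr (_ / _); ring.
rewrite (@eq_cint _ _ (fun t => Complex (2 * e / ((t - y0) ^+ 2 + e ^+ 2)) 0) (y0 - e)); last first.
  move=> t _; rewrite -![_ - Complex x0 y0]/(Complex _ _) !inv_Complex addrAC subrr add0r.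
  rewrite (addrAC x0) subrr add0r sqrrN -[LHS]/(Complex _ _) subrr addrC; congr Complex.
  by rewrite [e ^+ 2 + _]addrC; ring.
have ee u : u - e <= u + e by rewrite lerD2l ge0_cp // ltW.
have -> : cint (x0 - e) (x0 + e) (fun t => Complex 0 (2 * e / ((t - x0) ^+ 2 + e ^+ 2))) = Complex 0 pi.
  by congr Complex; [rewrite /= Rintegral_cst_itv // mulr0|exact: Rintegral_poisson].
have -> : cint (y0 - e) (y0 + e) (fun t => Complex (2 * e / ((t - y0) ^+ 2 + e ^+ 2)) 0) = Complex pi 0.
  by congr Complex; [exact: Rintegral_poisson|rewrite /= Rintegral_cst_itv // mulr0].
rewrite -[LHS]/(Complex _ _) /=; congr Complex; ring.
Qed.

(** Subtracting [L / (z - z0)] and shrinking the square: the remaining integrand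
    is [o(1 / e)] on a contour of length [8 e]. *)
Lemma residue f x0 y0 L a b c d : (forall z, z != Complex x0 y0 -> holo f z) ->
  (forall e : R, 0 < e -> exists2 r : R, 0 < r & forall z, z != Complex x0 y0 ->
     normc (z - Complex x0 y0) < r -> normc ((z - Complex x0 y0) * f z - L) <= e) ->
  a < x0 < b -> c < y0 < d ->
  rint f a b c d = Complex 0 (2 * pi) * L.
Proof.
move=> hf hL abx cdy; set z0 := Complex x0 y0.
pose h z := L * (z - z0)^-1.
have hh z : z != z0 -> holo h z.
  by move=> zz; apply: holoM; [exact: holo_cst|exact: holo_recip].
have hr := @holo_recip z0.
have hg z : z != z0 -> holo (fun z => f z - h z) z by move=> zz; apply: holoB; [exact: hf|exact: hh].
have ffar : exists2 e1 : R, 0 < e1 & forall e, 0 < e -> e <= e1 ->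
   [/\ a <= x0 - e, x0 + e <= b, c <= y0 - e & y0 + e <= d].
  case/andP: abx => ax xb; case/andP: cdy => cy yd.
  exists (Num.min (Num.min (x0 - a) (b - x0)) (Num.min (y0 - c) (d - y0))).
    by rewrite !lt_min !subr_gt0 ax xb cy yd.
  by move=> e e0; rewrite !le_min => /andP[/andP[? ?] /andP[? ?]]; split; lra.
have [e1 e10 He1] := ffar.
have rr : rint (fun z => (z - z0)^-1) a b c d = Complex 0 (2 * pi).
  have [h1 h2 h3 h4] := He1 _ e10 (lexx _).
  by rewrite (rint_annulus hr e10) // rint_recip.
rewrite -rr mulrC -rintZ; last exact: (holo_off_bcts hr).
apply/eqP; rewrite -subr_eq0 -rintB; [|exact: (holo_off_bcts hf)|exact: (holo_off_bcts hh)].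
rewrite -normc_eq0; apply/eqP/le_anti; rewrite normc_ge0 andbT.
apply/ler_addgt0Pl => eta eta0; rewrite addr0.
have eta16 : 0 < eta / 16 by rewrite divr_gt0.
have [r r0 Hr] := hL _ eta16.
pose e := Num.min e1 (r / 4).
have e0 : 0 < e by rewrite lt_min e10 divr_gt0.
have ee1 : e <= e1 by rewrite ge_min lexx.
have er : e * 4 <= r by rewrite -ler_pdivlMr // ge_min lexx orbT.
have [h1 h2 h3 h4] := He1 _ e0 ee1.
rewrite (rint_annulus hg e0) //.
have inx u : u - e < u < u + e by rewrite ltrBlDr ltrDl e0.
have main z : z != z0 -> e <= normc (z - z0) -> normc (z - z0) < r -> normc (f z - h z) <= eta / 16 / e.
  move=> zz ez zr; have zz0 : z - z0 != 0 by rewrite subr_eq0.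
  have -> : f z - h z = ((z - z0) * f z - L) / (z - z0) by rewrite /h; field.
  rewrite Normc.normcM Normc.normcV ler_pM ?normc_ge0 ?invr_ge0 ?normc_ge0 //; first exact: Hr.
  by rewrite lef_pV2 ?posrE // (lt_le_trans e0).
have bd (p q : R) : e <= Num.max `|p| `|q| -> `|p| <= e -> `|q| <= e ->
    normc (f (Complex (x0 + p) (y0 + q)) - h (Complex (x0 + p) (y0 + q))) <= eta / 16 / e.
  move=> epq pe qe; have E : Complex (x0 + p) (y0 + q) - z0 = Complex p q.
    by rewrite -[LHS]/(Complex _ _) addrAC subrr add0r (addrAC y0) subrr add0r.
  have eN : e <= normc (Complex p q).
    by move: epq; rewrite le_max => /orP[] /le_trans; apply; [exact: (Re_le_normc (Complex p q))|exact: (Im_le_normc (Complex p q))].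
  apply: main; rewrite ?E //; last first.
    apply: le_lt_trans (normc_le_ReIm _) _; apply: le_lt_trans (lerD pe qe) _; lra.
  by rewrite -subr_eq0 E -normc_gt0 (lt_le_trans e0).
have ne : `|e| = e by rewrite gtr0_norm.
have nne : `|- e| = e by rewrite normrN.
have side t u : u - e <= t <= u + e -> `|t - u| <= e.
  by move=> /andP[t1 t2]; rewrite ler_norml; apply/andP; split; lra.
have -> : eta = 4 * ((x0 + e - (x0 - e)) + (y0 + e - (y0 - e))) * (eta / 16 / e).
  by field; rewrite gt_eqF.
apply: rint_bound.
- by case/andP: (inx x0) => p1 p2; exact/ltW/(lt_trans p1).
- by case/andP: (inx y0) => p1 p2; exact/ltW/(lt_trans p1).
- exact: (holo_off_bcts hg).
- move=> t /side tt; have -> : t = x0 + (t - x0) by rewrite addrC subrK.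
  by split; apply: bd; rewrite ?le_max ?ne ?nne ?lexx ?orbT.
- move=> t /side tt; have -> : t = y0 + (t - y0) by rewrite addrC subrK.
  by split; apply: bd; rewrite ?le_max ?ne ?nne ?lexx ?orbT.
Qed.

End Residue.

(** * Taylor coefficients of entire functions *)

Section Taylor.
Context {R : realType}.
Local Notation C := R[i].
Implicit Types (f g : C -> C) (z w : C).

Definition twopii : C := Complex 0 (2 * pi).

Lemma normc_twopii : normc twopii = 2 * pi.
Proof.
by rewrite /twopii /Normc.normc expr0n add0r sqrtr_sqr gtr0_norm // mulr_gt0 ?pi_gt0.
Qed.

Lemma twopii_neq0 : twopii != 0.
Proof.
by rewrite -normc_gt0 normc_twopii mulr_gt0 ?pi_gt0.
Qed.

Lemma cts_continuous2 f : (forall z, cts f z) ->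
  continuous (fun p : R * R => normc (f (Complex p.1 p.2))).
Proof.
move=> fc [x y]; apply/cvgrPdistC_lt => e e0 /=.
have [r r0 fr] := fc (Complex x y) e e0.
have r20 : 0 < r / 2 by rewrite divr_gt0.
exists (ball (x : R) (r / 2), ball (y : R) (r / 2)) => /=.
  by split; exact: nbhsx_ballx.
move=> [u v] [/= xu yv].
have H : normc (f (Complex u v) - f (Complex x y)) < e.
  apply: fr; apply: le_lt_trans (normc_le_ReIm _) _.
  by rewrite (splitr r) ltrD // distrC.
apply: le_lt_trans H; rewrite ler_norml ler_normc_dist andbT.
by rewrite lerNl opprB normcBC ler_normc_dist.
Qed.

Lemma cts_bounded_rect f (a b c d : R) : (forall z, cts f z) ->
  exists2 M : R, 0 < M & forall x y, a <= x <= b -> c <= y <= d -> normc (f (Complex x y)) <= M.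
Proof.
move=> fc; pose K := `[a, b]%classic `*` `[c, d]%classic : set (R * R).
have cK : compact K by apply: compact_setX; exact: segment_compact.
pose h (p : R * R) := normc (f (Complex p.1 p.2)).
have : compact (h @` K).
  by apply: continuous_compact cK; apply: continuous_subspaceT; exact: cts_continuous2.
move=> /compact_bounded/ex_strict_bound_gt0[M M0 HM]; exists M => // x y xab ycd.
have /HM/ltW : (h @` K) (h (x, y)) by exists (x, y) => //; split; rewrite /= in_itv.
by rewrite /h /= ger0_norm ?normc_ge0.
Qed.

Lemma cts_bounded_disc f (s : R) : (forall z, cts f z) ->
  exists2 M : R, 0 < M & forall z, normc z <= s -> normc (f z) <= M.
Proof.
move=> /(@cts_bounded_rect f (- s) s (- s) s)[M M0 H]; exists M => // -[x y] zs.
by apply: H; rewrite -ler_norml (le_trans _ zs) //; [exact: (Re_le_normc (Complex x y))|exact: (Im_le_normc (Complex x y))].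
Qed.

Lemma square_boundary (s t u : R) : 0 < s -> - s <= t <= s -> `|u| = s ->
  [/\ s <= normc (Complex t u) <= 2 * s & s <= normc (Complex u t) <= 2 * s].
Proof.
move=> s0; rewrite -ler_norml => ts us.
have H1 := normc_le_ReIm (Complex t u); have H2 := normc_le_ReIm (Complex u t).
have H3 := Im_le_normc (Complex t u); have H4 := Re_le_normc (Complex u t).
move: H1 H2 H3 H4 => /=; rewrite us => H1 H2 H3 H4; split; apply/andP; split=> //; lra.
Qed.

Lemma rint_square_bound f (s M : R) : 0 < s -> (forall z, s <= normc z <= 2 * s -> cts f z) ->
  (forall z, s <= normc z <= 2 * s -> normc (f z) <= M) ->
  normc (rint f (- s) s (- s) s) <= 16 * s * M.
Proof.
move=> s0 fc fM; have ss : - s <= s by rewrite ge0_cp // ltW.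
have ns : `|s| = s by rewrite gtr0_norm.
have nns : `|- s| = s by rewrite normrN.
have -> : 16 * s * M = 4 * ((s - - s) + (s - - s)) * M by ring.
apply: rint_bound => //.
- by split=> t ts; split; apply: fc; case: (square_boundary s0 ts ns) (square_boundary s0 ts nns) => [? ?] [].
- by move=> t ts; split; apply: fM; case: (square_boundary s0 ts ns) (square_boundary s0 ts nns) => [? ?] [].
- by move=> t ts; split; apply: fM; case: (square_boundary s0 ts ns) (square_boundary s0 ts nns) => [? ?] [].
Qed.

(** The punctured limit, which gives a meaning to values at a removable
    singularity. *)
Definition lim0 f (L : C) := forall e : R, 0 < e -> exists2 r : R, 0 < r &
  forall z, z != 0 -> normc z < r -> normc (f z - L) <= e.

Lemma residue0 f L (s : R) : (forall z, z != 0 -> holo f z) -> lim0 (fun z => z * f z) L ->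
  0 < s -> rint f (- s) s (- s) s = twopii * L.
Proof.
move=> hf fL s0; have inx : - s < 0 < s by rewrite oppr_lt0 s0.
apply: (@residue _ f 0 0) => // e e0; have [r r0 H] := fL _ e0.
exists r => // z zn zr; have E : z - Complex 0 0 = z := subr0 z.
by rewrite E in zr *; exact: H.
Qed.

(** A maximum principle across a removable singularity, with a constant that
    is immaterial below; it follows from the residue of [f z / z]. *)
Lemma lim0_le_boundary f L (s M : R) : (forall z, z != 0 -> holo f z) -> lim0 f L ->
  0 < s -> (forall z, s <= normc z <= 2 * s -> normc (f z) <= M) -> normc L <= 4 * M.
Proof.
move=> hf fL s0 fM; have n0 z : s <= normc z -> z != 0.
  by move=> sz; rewrite -normc_gt0 (lt_le_trans s0).
have hz z : z != 0 -> holo (fun z => f z / z) z.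
  by move=> zn; apply: holoM; [exact: hf|apply: holoV => //; exact: holo_id].
have := @residue0 (fun z => f z / z) L s hz _ s0.
have H : lim0 (fun z => z * (f z / z)) L.
  move=> e e0; have [r r0 H] := fL _ e0; exists r => // z zn zr.
  by rewrite mulrC divfK //; exact: H.
move=> /(_ H) E.
have B : normc (rint (fun z => f z / z) (- s) s (- s) s) <= 16 * s * (M / s).
  apply: rint_square_bound => // z /[dup] zs /andP[sz _].
    by apply: holo_cts; apply: hz; exact: n0.
  rewrite Normc.normcM Normc.normcV ler_pM ?normc_ge0 ?invr_ge0 ?normc_ge0 ?fM //.
  by rewrite lef_pV2 ?posrE // (lt_le_trans s0).
move: B; rewrite E Normc.normcM normc_twopii (_ : 16 * s * (M / s) = 16 * M); last first.
  by field; rewrite gt_eqF.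
have p2 := @pi_ge2 R; have := normc_ge0 L => L0 B.
have : 2 * 2 * normc L <= 2 * pi * normc L by rewrite ler_wpM2r // ler_pM2l.
lra.
Qed.

(** Twice pi i times the [n]-th Taylor coefficient at the origin. *)
Definition tcoef f n := rint (fun z => f z / z ^+ n.+1) (-1) 1 (-1) 1.

Lemma holo_divX f n z : entire f -> z != 0 -> holo (fun z => f z / z ^+ n) z.
Proof.
move=> /entireP ef zn; apply: holoM; first exact: ef.
by apply: holoV; [rewrite expf_neq0|apply: holoX; exact: holo_id].
Qed.

Lemma tcoef_lim f n L : entire f -> lim0 (fun z => f z / z ^+ n) L -> tcoef f n = twopii * L.
Proof.
move=> ef fL; apply: residue0 => //; first by move=> z zn; exact: holo_divX.
move=> e e0; have [r r0 H] := fL _ e0; exists r => // z zn zr.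
rewrite (_ : z * _ = f z / z ^+ n); first exact: H.
by rewrite exprS; field; rewrite zn expf_neq0.
Qed.

(** By Goursat's theorem the square may have any size. *)
Lemma tcoefE f n (s : R) : entire f -> 0 < s ->
  tcoef f n = rint (fun z => f z / z ^+ n.+1) (- s) s (- s) s.
Proof.
move=> ef s0; pose e : R := Num.min 1 s.
have e0 : 0 < e by rewrite lt_min ltr01.
have e1 : e <= 1 by rewrite ge_min lexx.
have es : e <= s by rewrite ge_min lexx orbT.
have hz z : z != Complex 0 0 -> holo (fun z => f z / z ^+ n.+1) z by exact: holo_divX.
have K (t : R) : e <= t -> rint (fun z => f z / z ^+ n.+1) (- t) t (- t) t =
    rint (fun z => f z / z ^+ n.+1) (0 - e) (0 + e) (0 - e) (0 + e).
  by move=> et; apply: (rint_annulus hz e0); clear - et; lra.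
by rewrite (K s es) -(K 1 e1).
Qed.

Lemma tcoef_bound f n (s M : R) : entire f -> 0 < s ->
  (forall z, s <= normc z <= 2 * s -> normc (f z) <= M) ->
  normc (tcoef f n) <= 16 * (M / s ^+ n).
Proof.
move=> ef s0 fM; rewrite (tcoefE n ef s0).
rewrite (_ : 16 * _ = 16 * s * (M / s ^+ n.+1)); last first.
  by rewrite exprS; field; rewrite expf_neq0 gt_eqF.
apply: rint_square_bound => // z /[dup] zs /andP[sz _].
  by apply: holo_cts; apply: holo_divX => //; rewrite -normc_gt0 (lt_le_trans s0).
rewrite Normc.normcM Normc.normcV ler_pM ?normc_ge0 ?invr_ge0 ?normc_ge0 ?fM //.
rewrite normcX lef_pV2 ?posrE ?exprn_gt0 ?(lt_le_trans s0) //.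
by apply: lerXn2r => //; rewrite nnegrE ?normc_ge0 // ltW.
Qed.

Definition taylor_rem f (s : R) z N := rint (fun w => f w / (w ^+ N * (w - z))) (- s) s (- s) s.

(** Cauchy's formula, where [1 / (w - z)] is expanded as a finite geometric
    series in [z / w]. *)
Lemma taylor_expansion f (s : R) z N : entire f -> normc z < s ->
  twopii * f z = \sum_(k < N) tcoef f k * z ^+ k + z ^+ N * taylor_rem f s z N.
Proof.
move=> ef zs; have s0 : 0 < s by exact: le_lt_trans (normc_ge0 z) zs.
have in1 : - s < Re z < s by rewrite -ltr_norml (le_lt_trans (Re_le_normc _)).
have in2 : - s < Im z < s by rewrite -ltr_norml (le_lt_trans (Im_le_normc _)).
have ef' := (entireP f).1 ef.
have hq n w : w != 0 -> w != z -> holo (fun w => f w / (w ^+ n * (w - z))) w.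
  move=> wn wz; apply: holoM; first exact: ef'.
  apply: holoV; first by rewrite mulf_neq0 ?expf_neq0 // subr_eq0.
  by apply: holoM; [apply: holoX; exact: holo_id|apply: holoB; [exact: holo_id|exact: holo_cst]].
have bn0 t u : - s <= t <= s -> (u = s \/ u = - s) ->
   [/\ Complex t u != 0, Complex u t != 0, Complex t u != z & Complex u t != z].
  move=> ts us; have nu : `|u| = s by case: us => ->; rewrite ?normrN gtr0_norm.
  have [/andP[b1 _] /andP[b2 _]] := square_boundary s0 ts nu.
  split; rewrite -?normc_gt0 ?(lt_le_trans s0) //; apply/eqP => E.
    by move: zs; rewrite -E => /(le_lt_trans b1); rewrite ltxx.
  by move: zs; rewrite -E => /(le_lt_trans b2); rewrite ltxx.
elim: N => [|N IH].
  rewrite big_ord0 add0r expr0 mul1r /taylor_rem.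
  case: z zs in1 in2 hq bn0 => x y zs in1 in2 hq bn0.
  symmetry; apply: (residue (x0 := x) (y0 := y)) => // w.
    move=> wz; apply: holoM; first exact: ef'.
    apply: holoV; first by rewrite expr0 mul1r subr_eq0.
    by apply: holoM; [exact: holo_cst|apply: holoB; [exact: holo_id|exact: holo_cst]].
  move=> w0; have [r r0 H] := holo_cts (ef' (Complex x y)) w0.
  exists r => // v vn vr; rewrite expr0 mul1r mulrC divfK ?subr_eq0 //.
  by rewrite ltW // H.
rewrite IH big_ord_recr /= -addrA; congr (_ + _).
have bq n : boundary_cts (fun w => f w / (w ^+ n * (w - z))) (- s) s (- s) s.
  by split=> t ts; split; apply: holo_cts; apply: hq; case: (bn0 t s ts (or_introl erefl)) (bn0 t (- s) ts (or_intror erefl)) => [? ? ? ?] [].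
have bp : boundary_cts (fun w => f w / w ^+ N.+1) (- s) s (- s) s.
  by split=> t ts; split; apply: holo_cts; apply: holo_divX => //; case: (bn0 t s ts (or_introl erefl)) (bn0 t (- s) ts (or_intror erefl)) => [? ? ? ?] [].
rewrite exprSr -mulrA [tcoef f N * _]mulrC -mulrDr; congr (_ * _).
rewrite (tcoefE N ef s0) /taylor_rem -rintZ // -rintD //; last first.
  have [b1 b2] := bq N.+1.
  by split=> t ts; split; apply: ctsM; (try exact: cts_cst); [case: (b1 t ts)|case: (b1 t ts)|case: (b2 t ts)|case: (b2 t ts)].
have E w : w != 0 -> w != z -> f w / (w ^+ N * (w - z)) = f w / w ^+ N.+1 + z * (f w / (w ^+ N.+1 * (w - z))).
  move=> wn; rewrite -subr_eq0 => wz; have wN : w ^+ N != 0 by rewrite expf_neq0.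
  by rewrite exprS; field; rewrite wn wz wN.
by apply: eq_rint => t ts; split; apply: E; case: (bn0 t s ts (or_introl erefl)) (bn0 t (- s) ts (or_intror erefl)) => [? ? ? ?] [].
Qed.

Lemma tcoef_0 f : entire f -> tcoef f 0 = twopii * f 0.
Proof.
move=> ef; have n0 : normc (0 : C) < 1 by rewrite Normc.normc0.
by rewrite (taylor_expansion 1 ef n0) big_ord1 expr0 mulr1 expr1 mul0r addr0.
Qed.

Lemma taylor_rem_bound f (s M : R) z N : entire f -> 0 < s -> 2 * normc z <= s ->
  (forall w, s <= normc w <= 2 * s -> normc (f w) <= M) ->
  normc (taylor_rem f s z N) <= 32 * (M / s ^+ N).
Proof.
move=> /entireP ef s0 zs fM.
rewrite (_ : 32 * _ = 16 * s * (M * (s ^+ N * (s / 2))^-1)); last first.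
  by field; rewrite expf_neq0 gt_eqF.
have sep w : s <= normc w -> s / 2 <= normc (w - z).
  by move=> sw; have := ler_normc_dist w z; lra.
have s20 : 0 < s / 2 by rewrite divr_gt0.
have sN0 : 0 < s ^+ N by rewrite exprn_gt0.
apply: rint_square_bound => // w /[dup] ws /andP[sw _].
  apply: holo_cts; apply: holoM; first exact: ef.
  apply: holoV; last by apply: holoM; [apply: holoX; exact: holo_id|apply: holoB; [exact: holo_id|exact: holo_cst]].
  apply: mulf_neq0; first by apply: expf_neq0; rewrite -normc_gt0 (lt_le_trans s0).
  by rewrite -normc_gt0 (lt_le_trans s20) // sep.
rewrite Normc.normcM Normc.normcV ler_pM ?normc_ge0 ?invr_ge0 ?normc_ge0 ?fM //.
have X : s ^+ N <= normc (w ^+ N).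
  by rewrite normcX; apply: lerXn2r => //; rewrite nnegrE ?normc_ge0 // ltW.
have Y := sep _ sw.
have P1 := lt_le_trans sN0 X; have P2 := lt_le_trans s20 Y.
rewrite Normc.normcM lef_pV2 ?posrE ?mulr_gt0 //.
by rewrite ler_pM // ltW.
Qed.

Lemma entire_cts f : entire f -> forall z, cts f z.
Proof.
by move=> /entireP ef z; exact: holo_cts.
Qed.

(** On a square of size [s >= 2 |z|] the remainder of order [N] is of size
    [2^-N]. *)
Lemma tcoef0_eq0 f : entire f -> (forall n, tcoef f n = 0) -> forall z, f z = 0.
Proof.
move=> ef f0 z; apply/eqP; rewrite -normc_eq0; apply/eqP/le_anti; rewrite normc_ge0 andbT.
pose s := 2 * normc z + 1.
have s0 : 0 < s by rewrite /s; have := normc_ge0 z; lra.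
have [M M0 fM] := cts_bounded_disc (2 * s) (entire_cts ef).
have fM' w : s <= normc w <= 2 * s -> normc (f w) <= M by move=> /andP[_ h]; exact: fM.
have zs : 2 * normc z <= s by rewrite /s lerDl.
have zs' : normc z < s by rewrite /s; have := normc_ge0 z; lra.
have key N : normc (f z) * 2 ^+ N <= 32 * M.
  have := taylor_expansion N ef zs'; rewrite big1 ?add0r; last by move=> k _; rewrite f0 mul0r.
  move=> /(congr1 (@Normc.normc R)); rewrite !Normc.normcM normc_twopii normcX => E.
  have B := taylor_rem_bound N ef s0 zs fM'.
  have p2 := @pi_ge2 R.
  have fz0 := normc_ge0 (f z).
  have A : normc (f z) <= normc z ^+ N * (32 * (M / s ^+ N)).
    apply: (@le_trans _ _ (2 * pi * normc (f z))).
      by rewrite ler_peMl //; lra.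
    by rewrite E ler_wpM2l // exprn_ge0 // normc_ge0.
  apply: le_trans (ler_wpM2r _ A) _; first by rewrite exprn_ge0.
  have -> : normc z ^+ N * (32 * (M / s ^+ N)) * 2 ^+ N = 32 * M * ((2 * normc z / s) ^+ N).
    by rewrite !exprMn exprVn; ring.
  have q0 : 0 <= 2 * normc z / s by rewrite divr_ge0 // ?mulr_ge0 ?normc_ge0 // ltW.
  have q1 : 2 * normc z / s <= 1 by rewrite ler_pdivrMr // mul1r.
  by rewrite ler_piMr ?exprn_ile1 // mulr_ge0 // ltW.
have [//|fzp] := lerP (normc (f z)) 0.
have [N HN] : exists n : nat, 32 * M / normc (f z) < n%:R.
  by exists (Num.bound (32 * M / normc (f z))); rewrite archi_boundP // divr_ge0 // ltW // mulr_gt0.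
have := key N; rewrite leNgt => /negP; case.
rewrite -ltr_pdivrMl // mulrC; apply: lt_le_trans HN _.
by rewrite -natrX ler_nat ltnW // ltn_expl.
Qed.

(** The expansion to order [m + 1] reduces to its last term and a remainder
    divisible by [z^(m + 1)]. *)
Lemma tcoef_order f m : entire f -> (forall k, (k < m)%N -> tcoef f k = 0) ->
  lim0 (fun z => f z / z ^+ m) (tcoef f m / twopii).
Proof.
move=> ef f0 e e0.
have [M M0 fM] := cts_bounded_disc 2 (entire_cts ef).
have fM' w : 1 <= normc w <= 2 * 1 -> normc (f w) <= M by rewrite mulr1 => /andP[_ h]; exact: fM.
exists (Num.min (1 / 2) (e / (32 * M))).
  by rewrite lt_min !divr_gt0 // mulr_gt0.
move=> z zn; rewrite lt_min => /andP[z1 z2].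
have z3 : normc z < 1 by lra.
have z4 : 2 * normc z <= 1 by lra.
have := taylor_expansion m.+1 ef z3; rewrite big_ord_recr /= big1 ?add0r; last first.
  by move=> k _; rewrite f0 // mul0r.
have B := taylor_rem_bound m.+1 ef ltr01 z4 fM'.
set Q := taylor_rem _ _ _ _ in B * => E.
have t0 := twopii_neq0.
have -> : f z / z ^+ m - tcoef f m / twopii = z * Q / twopii.
  have -> : f z = twopii * f z / twopii by rewrite mulrC mulKf.
  by rewrite E exprS; field; rewrite t0 expf_neq0.
rewrite !Normc.normcM Normc.normcV normc_twopii.
have p2 := @pi_ge2 R.
rewrite ler_pdivrMr; last by lra.
move: B; rewrite expr1n divr1 => B.
apply: (@le_trans _ _ e); last by rewrite ler_peMr ?ltW //; lra.
move: z2; rewrite ltr_pdivlMr ?mulr_gt0 // => z2.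
apply: le_trans (ltW z2); rewrite ler_wpM2l ?normc_ge0 //.
Qed.

(** The order of vanishing at the origin of a nonzero entire function. *)
Lemma entire_order f : entire f -> f <> (fun=> 0) ->
  exists k L, L != 0 /\ lim0 (fun z => f z / z ^+ k) L.
Proof.
move=> ef fn; have [n fn0] : exists n, tcoef f n != 0.
  apply: contrapT => H; apply: fn; apply/funext; apply: tcoef0_eq0 => // n.
  by apply/eqP; apply: contrapT => /negP nn; apply: H; exists n.
have ex : exists n, tcoef f n != 0 by exists n.
case: (ex_minnP ex) => k kn kmin; exists k, (tcoef f k / twopii); split.
  by rewrite mulf_neq0 // invr_eq0 twopii_neq0.
apply: tcoef_order => // j jk; apply/eqP; apply: contraTT jk => /kmin.
by rewrite -leqNgt.
Qed.

Lemma entire_cst (k : C) : entire (fun=> k).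
Proof.
by apply/entireP => z; exact: holo_cst.
Qed.

Lemma entireB f g : entire f -> entire g -> entire (fun z => f z - g z).
Proof.
by move=> /entireP ef /entireP eg; apply/entireP => z; exact: holoB.
Qed.

(** Cauchy's estimates on squares of size tending to infinity kill all the
    Taylor coefficients of [f - f 0]. *)
Lemma liouville f (M : R) : entire f -> (forall z, normc (f z) <= M) -> forall z, f z = f 0.
Proof.
move=> ef fM z; have eg := entireB ef (@entire_cst (f 0)).
suff : f z - f 0 = 0 by move/eqP; rewrite subr_eq0 => /eqP.
apply: (tcoef0_eq0 eg) => -[|n].
  by rewrite tcoef_0 // subrr mulr0.
apply/eqP; rewrite -normc_eq0; apply/eqP/le_anti; rewrite normc_ge0 andbT.
have M0 : 0 <= M by exact: le_trans (normc_ge0 _) (fM 0).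
have gM w : normc (f w - f 0) <= 2 * M.
  by apply: le_trans (ler_normcB _ _) _; have := fM w; have := fM 0; lra.
apply/ler_addgt0Pl => e e0; rewrite addr0.
pose s := 1 + 32 * M / e; have s1 : 1 <= s by rewrite lerDl divr_ge0 ?mulr_ge0 // ltW.
have s0 : 0 < s by rewrite (lt_le_trans ltr01).
apply: le_trans (@tcoef_bound _ n.+1 s (2 * M) eg s0 _) _; first by move=> w _; exact: gM.
rewrite mulrA ler_pdivrMr ?exprn_gt0 //.
apply: (@le_trans _ _ (e * s)); last by rewrite ler_pM2l // exprS ler_peMr ?exprn_ege1 // ltW.
have -> : e * s = e + 32 * M by rewrite /s; field; rewrite gt_eqF.
lra.
Qed.

End Taylor.

(** * Borel sets of the plane, translations of the line *)

Section PlaneMeasure.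
Context {R : realType}.
Local Notation mu := (@lebesgue_measure R).

(** An open set is the union of the rational boxes that it contains; this
    connects continuity on the plane with the product sigma-algebra, in which
    the area measure lives. *)
Lemma open_plane_measurable (O : set (R * R)) : open O -> measurable O.
Proof.
move=> oO; pose box (a b : rat) (n : nat) : set (R * R) :=
  ball (ratr a : R) (n.+1%:R^-1) `*` ball (ratr b : R) (n.+1%:R^-1).
have -> : O = \bigcup_a \bigcup_b \bigcup_n (if `[< box a b n `<=` O >] then box a b n else set0).
  apply/seteqP; split=> [[x y] Oxy|p [a _ [b _ [n _]]]]; last by case: asboolP => // sO /sO.
  have := open_nbhs_nbhs (conj oO Oxy) => -[[U V] /= [/nbhs_ballP[r /= r0 rU] /nbhs_ballP[s /= s0 sV]] UVO].
  pose t := Num.min r s; have t0 : 0 < t by rewrite lt_min r0 s0.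
  have [n Hn] : exists n : nat, n.+1%:R^-1 + n.+1%:R^-1 < t.
    exists (Num.bound (2 / t)); set k := Num.bound _.
    have : 2 / t < k.+1%:R.
      by apply: (@lt_trans _ _ k%:R); [rewrite archi_boundP // divr_ge0 // ltW|rewrite ltr_nat].
    rewrite ltr_pdivrMr // => H.
    by rewrite -mulr2n -[_ *+ 2]mulr_natl ltr_pdivrMr // mulrC.
  have n0 : 0 < n.+1%:R^-1 :> R by rewrite invr_gt0.
  have dense (u : R) : exists a : rat, `|ratr a - u| < n.+1%:R^-1.
    have : u - n.+1%:R^-1 < u + n.+1%:R^-1 by rewrite ltrD2l gtrN.
    move=> /rat_in_itvoo[a]; rewrite in_itv /= => /andP[a1 a2]; exists a.
    by rewrite ltr_distl a1.
  have [a ax] := dense x; have [b bx] := dense y.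
  exists a => //; exists b => //; exists n => //.
  case: asboolP => [_|[]]; first by split; rewrite /= /ball /= ?ax ?bx.
  move=> [u v] [/= ua vb]; apply: UVO; split=> /=; [apply: rU|apply: sV];
    apply: (@lt_le_trans _ _ t); rewrite ?ge_min ?lexx ?orbT //; apply: lt_trans Hn;
    rewrite distrC.
    rewrite (_ : u - x = (ratr a - x) - (ratr a - u)); last by ring.
    by apply: le_lt_trans (ler_normB _ _) _; rewrite ltrD.
  rewrite (_ : v - y = (ratr b - y) - (ratr b - v)); last by ring.
  by apply: le_lt_trans (ler_normB _ _) _; rewrite ltrD.
apply: bigcupT_measurable_rat => a; apply: bigcupT_measurable_rat => b.
apply: bigcupT_measurable => n; case: ifP => _ //.
by apply: measurableX; exact: measurable_ball.
Qed.

Lemma continuous_plane_measurable (h : R * R -> R) : continuous h ->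
  measurable_fun [set: R * R] h.
Proof.
move=> ch; apply: (@measurability _ _ _ _ _ h (@RGenOInfty.G R)) => [|_ [_ [x ->] <-]].
  exact: RGenOInfty.measurableE.
rewrite setTI; apply: open_plane_measurable.
by apply: open_comp; [move=> p _; exact: ch|exact: interval_open].
Qed.

Lemma lebesgue_measure_shift (c : R) (A : set R) : measurable A ->
  pushforward mu ((fun x => x + c) : R -> measurableTypeR R) A = mu A.
Proof.
have mf : measurable_fun [set: R] (fun x : R => x + c) by exact: measurable_funD.
move=> mA; apply/esym/lebesgue_measure_unique => //= _ [[a b]] _ <-.
rewrite /pushforward (_ : _ @^-1` _ = `]a - c, b - c]%classic); last first.
  by apply/seteqP; split=> x /=; rewrite !in_itv /= ltrBlDr lerBrDr.
rewrite !lebesgue_measure_itv /= !lte_fin ltrD2r; congr (if _ then _ else _).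
by rewrite -!EFinB; congr EFin; ring.
Qed.

Lemma ge0_integral_shift (c : R) (f : R -> \bar R) : measurable_fun [set: R] f ->
  (forall r, (0 <= f r)%E) -> (\int[mu]_x f (x + c)%R = \int[mu]_x f x)%E.
Proof.
move=> mf f0.
pose phi : measurableTypeR R -> measurableTypeR R := fun x : R => x + c.
have mphi : measurable_fun [set: measurableTypeR R] phi.
  have mR : measurable_fun [set: R] (fun x : R => x + c) by exact: measurable_funD.
  exact: mR.
have -> : (\int[mu]_x f (x + c)%R = \int[mu]_(x in phi @^-1` setT) (f \o phi) x)%E by [].
rewrite -(@ge0_integral_pushforward _ _ _ _ _ _ mphi) //=.
by apply: eq_measure_integral => //= A mA _; exact: lebesgue_measure_shift.
Qed.

End PlaneMeasure.

(** * The area integral and its invariance under rigid motions *)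

Section AreaIntegral.
Context {R : realType}.
Local Notation C := R[i].
Local Notation mu := (@lebesgue_measure R).
Implicit Types (U V : C -> R).

Definition aint U : \bar R :=
  (\int[lebesgue_measure \x lebesgue_measure]_(z in [set: R * R]) (U (Complex z.1 z.2))%:E)%E.

Definition cmeas U := measurable_fun [set: R * R] (fun z => U (Complex z.1 z.2)).

Lemma cmeas_comp U (g : R * R -> R * R) : cmeas U -> measurable_fun [set: R * R] g ->
  measurable_fun [set: R * R] (fun z => U (Complex (g z).1 (g z).2)).
Proof.
by move=> mU mg; exact: (measurableT_comp mU mg).
Qed.

Lemma cmeas_cts (f : C -> C) : (forall z, cts f z) -> cmeas (fun z => normc (f z)).
Proof.
by move=> fc; apply: continuous_plane_measurable; exact: cts_continuous2.
Qed.

Lemma cmeasM U V : cmeas U -> cmeas V -> cmeas (fun z => U z * V z).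
Proof.
by move=> mU mV; exact: measurable_funM.
Qed.

Lemma cmeasD U V : cmeas U -> cmeas V -> cmeas (fun z => U z + V z).
Proof.
by move=> mU mV; exact: measurable_funD.
Qed.

Lemma cmeas_cst (k : R) : cmeas (fun=> k).
Proof.
exact: measurable_cst.
Qed.

Lemma cmeas_powR U (p : R) : cmeas U -> cmeas (fun z => U z `^ p).
Proof.
by move=> mU; exact: (measurableT_comp (measurable_powR p) mU).
Qed.

Lemma cmeas_expR U : cmeas U -> cmeas (fun z => expR (U z)).
Proof.
by move=> mU; exact: (measurableT_comp (@measurable_expR R) mU).
Qed.

Lemma cmeas_Re : cmeas (@complex.Re R).
Proof.
exact: measurable_fst.
Qed.

Lemma cmeas_Im : cmeas (@complex.Im R).
Proof.
exact: measurable_snd.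
Qed.

Lemma cmeas_EFin U : cmeas U -> measurable_fun [set: R * R] (fun z => (U (Complex z.1 z.2))%:E).
Proof.
by move=> mU; exact/measurable_EFinP.
Qed.

Lemma aint_ge0 U : (forall z, 0 <= U z) -> (0 <= aint U)%E.
Proof.
by move=> U0; apply: integral_ge0 => z _; rewrite lee_fin.
Qed.

Lemma le_aint U V : cmeas U -> cmeas V -> (forall z, 0 <= U z) -> (forall z, U z <= V z) ->
  (aint U <= aint V)%E.
Proof.
move=> mU mV U0 UV; apply: ge0_le_integral => //.
- by move=> z _; rewrite lee_fin.
- exact: cmeas_EFin.
- exact: cmeas_EFin.
- by move=> z _; rewrite lee_fin.
Qed.

Lemma aintZ U (k : R) : cmeas U -> (forall z, 0 <= U z) -> 0 <= k ->
  aint (fun z => k * U z) = (k%:E * aint U)%E.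
Proof.
move=> mU U0 k0; rewrite /aint -ge0_integralZl_EFin //.
- by move=> z _; rewrite lee_fin.
- exact: cmeas_EFin.
Qed.

Lemma aintD U V : cmeas U -> cmeas V -> (forall z, 0 <= U z) -> (forall z, 0 <= V z) ->
  aint (fun z => U z + V z) = (aint U + aint V)%E.
Proof.
move=> mU mV U0 V0; rewrite /aint -ge0_integralD //.
- by move=> z _; rewrite lee_fin.
- exact: cmeas_EFin.
- by move=> z _; rewrite lee_fin.
- exact: cmeas_EFin.
Qed.

Lemma aint_iter1 U : cmeas U -> (forall z, 0 <= U z) ->
  aint U = (\int[mu]_x \int[mu]_y (U (Complex x y))%:E)%E.
Proof.
move=> mU U0; rewrite /aint fubini_tonelli1 //.
- exact: cmeas_EFin.
- by move=> z; rewrite lee_fin.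
Qed.

Lemma aint_iter2 U : cmeas U -> (forall z, 0 <= U z) ->
  aint U = (\int[mu]_y \int[mu]_x (U (Complex x y))%:E)%E.
Proof.
move=> mU U0; rewrite /aint fubini_tonelli2 //.
- exact: cmeas_EFin.
- by move=> z; rewrite lee_fin.
Qed.

Lemma cmeas_hsection U y : cmeas U -> measurable_fun [set: R] (fun x => U (Complex x y)).
Proof.
move=> mU; have mp : measurable_fun [set: R] (fun x : R => (x, y)) by exact: measurable_pair2.
exact: (measurableT_comp mU mp).
Qed.

Lemma cmeas_vsection U x : cmeas U -> measurable_fun [set: R] (fun y => U (Complex x y)).
Proof.
move=> mU; have mp : measurable_fun [set: R] (fun y : R => (x, y)) by exact: measurable_pair1.
exact: (measurableT_comp mU mp).
Qed.

Lemma cmeas_shear1 U (s : R -> R) : measurable_fun [set: R] s -> cmeas U ->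
  cmeas (fun z => U (Complex (Re z + s (Im z)) (Im z))).
Proof.
move=> ms mU; apply: (@cmeas_comp U (fun z => (z.1 + s z.2, z.2))) => //.
apply: measurable_fun_pair => /=; last exact: measurable_snd.
by apply: measurable_funD; [exact: measurable_fst|exact: measurableT_comp ms measurable_snd].
Qed.

Lemma cmeas_shear2 U (s : R -> R) : measurable_fun [set: R] s -> cmeas U ->
  cmeas (fun z => U (Complex (Re z) (Im z + s (Re z)))).
Proof.
move=> ms mU; apply: (@cmeas_comp U (fun z => (z.1, z.2 + s z.1))) => //.
apply: measurable_fun_pair => /=; first exact: measurable_fst.
by apply: measurable_funD; [exact: measurable_snd|exact: measurableT_comp ms measurable_fst].
Qed.

Lemma aint_shear1 U (s : R -> R) : measurable_fun [set: R] s -> cmeas U -> (forall z, 0 <= U z) ->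
  aint (fun z => U (Complex (Re z + s (Im z)) (Im z))) = aint U.
Proof.
move=> ms mU U0; have mS := cmeas_shear1 ms mU; rewrite (aint_iter2 mS) // (aint_iter2 mU) //.
apply: eq_integral => y _ /=.
rewrite (@ge0_integral_shift _ (s y) (fun x => (U (Complex x y))%:E)) //.
- by apply/measurable_EFinP; exact: cmeas_hsection.
- by move=> x; rewrite lee_fin.
Qed.

Lemma aint_shear2 U (s : R -> R) : measurable_fun [set: R] s -> cmeas U -> (forall z, 0 <= U z) ->
  aint (fun z => U (Complex (Re z) (Im z + s (Re z)))) = aint U.
Proof.
move=> ms mU U0; have mS := cmeas_shear2 ms mU; rewrite (aint_iter1 mS) // (aint_iter1 mU) //.
apply: eq_integral => x _ /=.
rewrite (@ge0_integral_shift _ (s x) (fun y => (U (Complex x y))%:E)) //.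
- by apply/measurable_EFinP; exact: cmeas_vsection.
- by move=> y; rewrite lee_fin.
Qed.

(** Any rotation other than the half turn is a product of three shears. *)
Lemma aint_rotation_shear U (p q : R) : cmeas U -> (forall z, 0 <= U z) ->
  p ^+ 2 + q ^+ 2 = 1 -> p != -1 ->
  cmeas (fun z => U (Complex p q * z)) /\ aint (fun z => U (Complex p q * z)) = aint U.
Proof.
move=> mU U0 pq p1; have p10 : 1 + p != 0 by rewrite addrC addr_eq0.
(* [- t] is the tangent of the half angle. *)
pose t := - (q / (1 + p)).
have m1 (k : R) : measurable_fun [set: R] (fun y => k * y) by exact: measurable_funM.
pose U3 z := U (Complex (Re z + t * Im z) (Im z)).
pose U2 z := U3 (Complex (Re z) (Im z + q * Re z)).
pose U1 z := U2 (Complex (Re z + t * Im z) (Im z)).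
have mU3 : cmeas U3 by exact: (cmeas_shear1 (m1 t)).
have mU2 : cmeas U2 by exact: (cmeas_shear2 (m1 q)).
have mU1 : cmeas U1 by exact: (cmeas_shear1 (m1 t)).
have E : (fun z => U (Complex p q * z)) = U1.
  apply/funext => -[x y]; rewrite /U1 /U2 /U3 /=; congr (U _).
  have qq : q ^+ 2 = (1 + p) * (1 - p) by rewrite -[LHS](addKr (p ^+ 2)) pq; ring.
  have tq : t * q = p - 1.
    by rewrite /t mulNr mulrAC -expr2 qq mulrAC divff // mul1r opprB.
  have tp : t * (1 + p) = - q by rewrite /t mulNr divfK.
  rewrite -[LHS]/(Complex _ _); congr Complex.
    rewrite [RHS](_ : _ = x + t * q * x + (t * (1 + p) + t * (t * q - (p - 1))) * y); last by ring.
    by rewrite tp tq; ring.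
  rewrite [RHS](_ : _ = q * x + (1 + t * q) * y); last by ring.
  by rewrite tq; ring.
rewrite E; split=> //.
have U30 z : 0 <= U3 z by exact: U0.
have U20 z : 0 <= U2 z by exact: U0.
exact: etrans (aint_shear1 (m1 t) mU2 U20) (etrans (aint_shear2 (m1 q) mU3 U30) (aint_shear1 (m1 t) mU U0)).
Qed.

Lemma aint_rigid U (a b : C) : cmeas U -> (forall z, 0 <= U z) -> normc a = 1 ->
  cmeas (fun z => U (a * z + b)) /\ aint (fun z => U (a * z + b)) = aint U.
Proof.
move=> mU U0 a1.
have addE (z w : C) : z + w = Complex (Re z + Re w) (Im z + Im w) by case: z w => [? ?] [].
pose V z := U (z + b).
have [mV ->] : cmeas V /\ aint U = aint V.
  pose V1 z := U (Complex (Re z + Re b) (Im z)).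
  have mV1 : cmeas V1 by exact: (@cmeas_shear1 U (fun=> Re b)).
  have EV : V = fun z => V1 (Complex (Re z) (Im z + Im b)).
    by apply/funext => -[x y]; rewrite /V /V1 addE.
  rewrite EV; split; first exact: (@cmeas_shear2 V1 (fun=> Im b)).
  have V10 z : 0 <= V1 z by exact: U0.
  have mc (k : R) : measurable_fun [set: R] (fun=> k) by exact: measurable_cst.
  by rewrite (aint_shear2 (mc (Im b)) mV1 V10) (aint_shear1 (mc (Re b)) mU U0).
have V0 z : 0 <= V z by exact: U0.
have pq : Re a ^+ 2 + Im a ^+ 2 = 1 by rewrite -sqr_normc a1 expr1n.
case: a a1 pq => p q a1 /= pq.
(* The half turn is the square of the quarter turn. *)
have [p1|p1] := eqVneq p (-1); last by have := aint_rotation_shear mV V0 pq p1.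
have q0 : q = 0 by apply/eqP; rewrite -sqrf_eq0; apply/eqP; move: pq; rewrite p1; lra.
have i1 : (0 : R) ^+ 2 + 1 ^+ 2 = 1 by rewrite expr0n expr1n add0r.
have i2 : (0 : R) != -1 by rewrite eq_sym oppr_eq0 oner_eq0.
have [mW eW] := aint_rotation_shear mV V0 i1 i2.
have W0 z : 0 <= V (Complex 0 1 * z) by exact: U0.
have [mX eX] := aint_rotation_shear mW W0 i1 i2.
have E : (fun z => U (Complex p q * z + b)) = (fun z => V (Complex 0 1 * (Complex 0 1 * z))).
  apply/funext => -[x y]; rewrite /V; congr (U (_ + b)).
  by rewrite p1 q0 -[LHS]/(Complex _ _); congr Complex; rewrite /=; ring.
by rewrite E; split=> //; rewrite eX.
Qed.

End AreaIntegral.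

(** * Area means of holomorphic functions *)

Section SubMeanValue.
Context {R : realType}.
Local Notation C := R[i].
Local Notation mu := (@lebesgue_measure R).
Implicit Types (U V : C -> R) (f : C -> C).

(** Otherwise the integral over [[c, d]] would already exceed [A]. *)
Lemma exists_le_average (Phi : R -> \bar R) (c d A B : R) : c < d ->
  measurable_fun [set: R] Phi -> (forall y, (0 <= Phi y)%E) ->
  (\int[mu]_y Phi y <= A%:E)%E -> A < B * (d - c) ->
  exists y, c <= y <= d /\ (Phi y <= B%:E)%E.
Proof.
move=> cd mP P0 PA AB; apply: contrapT => no.
have big y : c <= y <= d -> (B%:E <= Phi y)%E.
  by move=> ycd; rewrite leNgt; apply/negP => yB; apply: no; exists y; split=> //; exact: ltW.
have B0 : 0 <= B.
  have A0 : 0 <= A by rewrite -lee_fin; apply: le_trans PA; exact: integral_ge0.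
  have : 0 < B * (d - c) by exact: le_lt_trans AB.
  by rewrite pmulr_lgt0 ?subr_gt0 // => /ltW.
suff : ((B * (d - c))%:E <= A%:E)%E by rewrite lee_fin leNgt AB.
apply: le_trans PA.
apply: (@le_trans _ _ (\int[mu]_(y in `[c, d]) Phi y)%E); last first.
  by apply: ge0_subset_integral.
apply: (@le_trans _ _ (\int[mu]_(y in `[c, d]) B%:E)%E).
  rewrite integral_cst //= lebesgue_measure_itv /= lte_fin cd -EFinB -EFinM //.
apply: ge0_le_integral => //.
- exact: measurable_funTS.
Qed.

Lemma normc_cint_le_integral (F : R -> C) (a b k B : R) (g : R -> R) : pcts F a b ->
  measurable_fun [set: R] g -> (forall t, 0 <= g t) -> 0 <= k ->
  (forall t, a <= t <= b -> normc (F t) <= k * g t) ->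
  (\int[mu]_t (g t)%:E <= B%:E)%E -> normc (cint a b F) <= 2 * (k * B).
Proof.
move=> Fc mg g0 k0 Fg gB; apply: le_trans (le_normc_cint Fc) _; rewrite ler_pM2l //.
have iN := pcts_integrable_normc Fc.
rewrite -lee_fin /Rintegral fineK; last exact: integrable_fin_num.
apply: (@le_trans _ _ (\int[mu]_(t in `[a, b]) (k%:E * (g t)%:E))%E).
  apply: ge0_le_integral => //.
  - by move=> t _; rewrite lee_fin normc_ge0.
  - exact: measurable_int iN.
  - by apply: measurable_funTS; apply: measurable_funeM; exact/measurable_EFinP.
apply: (@le_trans _ _ (\int[mu]_t (k%:E * (g t)%:E))%E).
  apply: ge0_subset_integral => //.
    by apply: measurable_funeM; exact/measurable_EFinP.
  by move=> t _; rewrite -EFinM lee_fin mulr_ge0.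
rewrite ge0_integralZl_EFin //.
- by rewrite EFinM lee_wpmul2l // lee_fin.
- by move=> t _; rewrite lee_fin.
- exact/measurable_EFinP.
Qed.

Lemma measurable_hsections U : cmeas U -> (forall z, 0 <= U z) ->
  measurable_fun [set: R] (fun y => \int[mu]_x (U (Complex x y))%:E)%E.
Proof.
move=> mU U0.
have U0' (z : R * R) : (0 <= (U (Complex z.1 z.2))%:E)%E by rewrite lee_fin.
exact: (@measurable_fun_fubini_tonelli_G _ _ (measurableTypeR R) (measurableTypeR R) R _ _ (cmeas_EFin mU) U0').
Qed.

Lemma measurable_vsections U : cmeas U -> (forall z, 0 <= U z) ->
  measurable_fun [set: R] (fun x => \int[mu]_y (U (Complex x y))%:E)%E.
Proof.
move=> mU U0.
have U0' (z : R * R) : (0 <= (U (Complex z.1 z.2))%:E)%E by rewrite lee_fin.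
exact: (@measurable_fun_fubini_tonelli_F _ _ (measurableTypeR R) (measurableTypeR R) R _ _ (cmeas_EFin mU) U0').
Qed.

(** Cauchy's formula on a rectangle whose sides avoid the lines on which [U]
    has a large integral. *)
Lemma submean f x0 y0 (r A : R) U : entire f -> 0 < r -> cmeas U -> (forall z, 0 <= U z) ->
  (forall x y, `|x - x0| <= r -> `|y - y0| <= r -> normc (f (Complex x y)) <= U (Complex x y)) ->
  (aint U <= A%:E)%E -> normc (f (Complex x0 y0)) <= 8 / r ^+ 2 * A.
Proof.
move=> ef r0 mU U0 fU UA.
apply/ler_addgt0Pl => e e0.
pose eta := e * r ^+ 2 / 8; have eta0 : 0 < eta by rewrite divr_gt0 // mulr_gt0 // exprn_gt0.
pose B := (A + eta) * 2 / r.
have AB : A < B * (r / 2) by rewrite /B (_ : _ * _ = A + eta) ?ltrDl //; field; rewrite gt_eqF.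
(* Each side is chosen in a strip of width [r / 2] on which the distance to the
   centre line is between [r / 2] and [r]. *)
have sel Phi (c d : R) : d - c = r / 2 -> measurable_fun [set: R] Phi -> (forall y, (0 <= Phi y)%E) ->
    (\int[mu]_y Phi y <= A%:E)%E -> exists y, c <= y <= d /\ (Phi y <= B%:E)%E.
  move=> dc mP P0 PA; apply: exists_le_average mP P0 PA _; last by rewrite dc.
  by rewrite -subr_gt0 dc divr_gt0.
have hU : (\int[mu]_y \int[mu]_x (U (Complex x y))%:E <= A%:E)%E by rewrite -aint_iter2.
have vU : (\int[mu]_x \int[mu]_y (U (Complex x y))%:E <= A%:E)%E by rewrite -aint_iter1.
have h0 y : (0 <= \int[mu]_x (U (Complex x y))%:E)%E by apply: integral_ge0 => x _; rewrite lee_fin.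
have v0 x : (0 <= \int[mu]_y (U (Complex x y))%:E)%E by apply: integral_ge0 => y _; rewrite lee_fin.
have mh := measurable_hsections mU U0; have mv := measurable_vsections mU U0.
have [c [/andP[c1 c2] cB]] : exists c, y0 - r <= c <= y0 - r / 2 /\ (\int[mu]_x (U (Complex x c))%:E <= B%:E)%E.
  by apply: (sel _ _ _ _ mh h0 hU); field.
have [d [/andP[d1 d2] dB]] : exists d, y0 + r / 2 <= d <= y0 + r /\ (\int[mu]_x (U (Complex x d))%:E <= B%:E)%E.
  by apply: (sel _ _ _ _ mh h0 hU); field.
have [a [/andP[a1 a2] aB]] : exists a, x0 - r <= a <= x0 - r / 2 /\ (\int[mu]_y (U (Complex a y))%:E <= B%:E)%E.
  by apply: (sel _ _ _ _ mv v0 vU); field.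
have [b [/andP[b1 b2] bB]] : exists b, x0 + r / 2 <= b <= x0 + r /\ (\int[mu]_y (U (Complex b y))%:E <= B%:E)%E.
  by apply: (sel _ _ _ _ mv v0 vU); field.
have r20 : 0 < r / 2 by rewrite divr_gt0.
pose z0 := Complex x0 y0; pose g z := f z / (z - z0).
have hg z : z != z0 -> holo g z.
  by move=> zz; apply: holoM; [exact: (entireP f).1|exact: holo_recip].
have abx : a < x0 < b by clear - a1 a2 b1 b2 r20; apply/andP; split; lra.
have cdy : c < y0 < d by clear - c1 c2 d1 d2 r20; apply/andP; split; lra.
have E : rint g a b c d = twopii * f z0.
  apply: (residue hg) => // t t0; have [s s0 Hs] := entire_cts ef z0 t0.
  exists s => // z zz zs; rewrite /g mulrC divfK ?subr_eq0 //.
  by rewrite ltW // Hs.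
have /bcts_pcts[p1 p2 p3 p4] := holo_off_bcts hg abx cdy.
have k0 : 0 <= 2 / r by rewrite divr_ge0 // ltW.
have gU x y : `|x - x0| <= r -> `|y - y0| <= r -> r / 2 <= normc (Complex x y - z0) ->
    normc (g (Complex x y)) <= 2 / r * U (Complex x y).
  move=> hx hy hz; rewrite /g Normc.normcM mulrC ler_pM ?normc_ge0 ?fU //.
  rewrite Normc.normcV -[2 / r]invrK lef_pV2 ?posrE ?(lt_le_trans r20) //.
    by rewrite invf_div.
  by rewrite invf_div.
have farh x y : r / 2 <= `|y - y0| -> r / 2 <= normc (Complex x y - z0).
  by move=> /le_trans; apply; exact: (Im_le_normc (Complex x y - z0)).
have farv x y : r / 2 <= `|x - x0| -> r / 2 <= normc (Complex x y - z0).
  by move=> /le_trans; apply; exact: (Re_le_normc (Complex x y - z0)).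
have c3 : `|c - y0| <= r /\ r / 2 <= `|c - y0|.
  by clear - c1 c2 r20 r0; split; [rewrite ler_norml; apply/andP; split; lra|rewrite ler0_norm; lra].
have d3 : `|d - y0| <= r /\ r / 2 <= `|d - y0|.
  by clear - d1 d2 r20 r0; split; [rewrite ler_norml; apply/andP; split; lra|rewrite ger0_norm; lra].
have a3 : `|a - x0| <= r /\ r / 2 <= `|a - x0|.
  by clear - a1 a2 r20 r0; split; [rewrite ler_norml; apply/andP; split; lra|rewrite ler0_norm; lra].
have b3 : `|b - x0| <= r /\ r / 2 <= `|b - x0|.
  by clear - b1 b2 r20 r0; split; [rewrite ler_norml; apply/andP; split; lra|rewrite ger0_norm; lra].
have inx t : a <= t <= b -> `|t - x0| <= r.
  by clear - a1 b2; move=> /andP[t1 t2]; rewrite ler_norml; apply/andP; split; lra.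
have iny t : c <= t <= d -> `|t - y0| <= r.
  by clear - c1 d2; move=> /andP[t1 t2]; rewrite ler_norml; apply/andP; split; lra.
have B1 : normc (cint a b (fun x => g (Complex x c))) <= 2 * (2 / r * B).
  apply: (normc_cint_le_integral p1 (cmeas_hsection c mU) _ k0 _ cB) => // t /inx tx.
  by apply: gU => //; [exact: c3.1|exact/farh/c3.2].
have B2 : normc (cint a b (fun x => g (Complex x d))) <= 2 * (2 / r * B).
  apply: (normc_cint_le_integral p2 (cmeas_hsection d mU) _ k0 _ dB) => // t /inx tx.
  by apply: gU => //; [exact: d3.1|exact/farh/d3.2].
have B3 : normc (cint c d (fun y => g (Complex b y))) <= 2 * (2 / r * B).
  apply: (normc_cint_le_integral p3 (cmeas_vsection b mU) _ k0 _ bB) => // t /iny tx.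
  by apply: gU => //; [exact: b3.1|exact/farv/b3.2].
have B4 : normc (cint c d (fun y => g (Complex a y))) <= 2 * (2 / r * B).
  apply: (normc_cint_le_integral p4 (cmeas_vsection a mU) _ k0 _ aB) => // t /iny tx.
  by apply: gU => //; [exact: a3.1|exact/farv/a3.2].
have tot : normc (rint g a b c d) <= 8 * (2 / r * B).
  rewrite /rint; apply: le_trans (le_normcD _ _) _.
  rewrite Normc.normcM normc_i mul1r.
  apply: le_trans (lerD (ler_normcB _ _) (ler_normcB _ _)) _.
  clear - B1 B2 B3 B4; move: (2 / r * B) B1 B2 B3 B4 => K; lra.
move: tot; rewrite E Normc.normcM normc_twopii.
have -> : 8 * (2 / r * B) = 4 * (e + 8 / r ^+ 2 * A).
  by rewrite /B /eta; field; rewrite gt_eqF.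
have p2' := @pi_ge2 R; have fz0 := normc_ge0 (f z0) => H.
have : 2 * 2 * normc (f z0) <= 2 * pi * normc (f z0) by rewrite ler_wpM2r // ler_pM2l.
move: H; clear; move: (2 * pi * _) (8 / _ * _) => K1 K2; rewrite -/z0; lra.
Qed.

End SubMeanValue.

(** * Pointwise estimates in Fock spaces *)

Section PointwiseEstimates.
Context {R : realType}.
Local Notation C := R[i].
Implicit Types (U V : C -> R) (f : C -> C).

(** The interpolation [t <= T^(1 - q) t^q], in which [T] will be an upper bound
    of a function and [t^q] the integrable quantity. *)
Lemma le_powR_scaled (t T q : R) : 0 <= t -> t <= T -> 0 < T -> q <= 1 ->
  t <= T * ((t / T) `^ q).
Proof.
move=> t0 tT T0 q1; rewrite -ler_pdivrMl // mulrC.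
move: t0; rewrite le_eqVlt => /predU1P[<-|t0]; first by rewrite mul0r powR_ge0.
by apply: ger1_powR => //; rewrite divr_gt0 //= ler_pdivrMr // mul1r.
Qed.

(** Hardy and Littlewood's trick: [|f|] weighted by a power of the distance to
    the boundary almost attains its supremum at some point, and around that
    point [|f|] is controlled by [|f|^q] times the supremum to the power
    [1 - q]. *)
Lemma submean_small_exponent f x0 y0 (q A : R) V : entire f -> 0 < q -> q <= 1 ->
  cmeas V -> (forall z, 0 <= V z) ->
  (forall x y, `|x - x0| <= 1 -> `|y - y0| <= 1 -> normc (f (Complex x y)) `^ q <= V (Complex x y)) ->
  (aint V <= A%:E)%E -> normc (f (Complex x0 y0)) `^ q <= 16 * 2 `^ (2 / q) * A.
Proof.
move=> ef q0 q1 mV V0 fV VA; set m := 2 / q.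
have qn0 : q != 0 by rewrite gt_eqF.
have m0 : 0 < m by rewrite divr_gt0.
have A0 : 0 <= A by rewrite -lee_fin; exact: le_trans (aint_ge0 V0) VA.
(* [dl] is the distance to the boundary of the square in the sup norm; the
   exponent [m = 2 / q] makes the [q]-th power of its weight an area. *)
pose dl x y := 1 - Num.max `|x - x0| `|y - y0|.
pose h x y := dl x y `^ m * normc (f (Complex x y)).
have dl1 x y : dl x y <= 1 by rewrite gerBl le_max normr_ge0.
have dl0 x y : `|x - x0| <= 1 -> `|y - y0| <= 1 -> 0 <= dl x y.
  by move=> h1 h2; rewrite subr_ge0 ge_max h1 h2.
have [M M0 HM] := cts_bounded_rect (x0 - 1) (x0 + 1) (y0 - 1) (y0 + 1) (entire_cts ef).
pose S := [set t | exists x y, [/\ `|x - x0| <= 1, `|y - y0| <= 1 & t = h x y]].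
have S0 : S (normc (f (Complex x0 y0))).
  exists x0, y0; rewrite !subrr normr0 ler01; split => //.
  by rewrite /h /dl !subrr normr0 maxxx subr0 powR1 mul1r.
have ubS : has_ubound S.
  exists M => _ [x [y [hx hy ->]]]; rewrite /h.
  apply: (@le_trans _ _ (1 * normc (f (Complex x y)))).
    rewrite ler_wpM2r ?normc_ge0 //; apply: (@le_trans _ _ (1 `^ m)); last by rewrite powR1.
    by apply: ge0_ler_powR; rewrite ?nnegrE ?dl1 ?ler01 ?(ltW m0) //; exact: dl0.
  by rewrite mul1r; apply: HM; rewrite -ler_distl.
set B := sup S; have fB : normc (f (Complex x0 y0)) <= B by exact: ub_le_sup.
have [->|fn0] := eqVneq (normc (f (Complex x0 y0))) 0.
  by rewrite powR0 // !mulr_ge0 // powR_ge0.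
have B0 : 0 < B by apply: lt_le_trans fB; rewrite lt_def fn0 normc_ge0.
have [_ [x [y [hx hy ->]]] Bh] : exists2 t, S t & B / 2 < t.
  by apply: sup_gt; [exists (normc (f (Complex x0 y0)))|rewrite ltr_pdivrMr // ltr_pMr // ltr1n].
have d0 : 0 < dl x y.
  rewrite lt_def dl0 // andbT; apply: contraTneq Bh => E.
  by rewrite /h E powR0 ?gt_eqF // mul0r -leNgt divr_ge0 // ltW.
set r := dl x y / 2; have r0 : 0 < r by rewrite divr_gt0.
set s := r `^ m; have s0 : 0 < s by rewrite powR_gt0.
set T := B / s; have T0 : 0 < T by rewrite divr_gt0.
set k := (s / B) `^ q.
have k0 : 0 <= k by rewrite powR_ge0.
have kB : k * B `^ q = r ^+ 2.
  rewrite -powRM ?divr_ge0 ?ltW // divfK ?gt_eqF // /s -powRrM /m divfK //.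
  by rewrite -[2]/(2%:R) powR_mulrn // ltW.
have near u v : `|u - x| <= r -> `|v - y| <= r ->
    [/\ `|u - x0| <= 1, `|v - y0| <= 1 & r <= dl u v].
  move=> ux vy.
  have e1 : `|x - x0| <= 1 - dl x y by rewrite /dl (_ : 1 - (1 - _) = Num.max `|x - x0| `|y - y0|) ?le_max ?lexx //; ring.
  have e2 : `|y - y0| <= 1 - dl x y by rewrite /dl (_ : 1 - (1 - _) = Num.max `|x - x0| `|y - y0|) ?le_max ?lexx ?orbT //; ring.
  have u1 : `|u - x0| <= 1 - r.
    rewrite (_ : u - x0 = (u - x) + (x - x0)); last by ring.
    apply: le_trans (ler_normD _ _) _; move: ux e1; rewrite /r; clear; lra.
  have v1 : `|v - y0| <= 1 - r.
    rewrite (_ : v - y0 = (v - y) + (y - y0)); last by ring.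
    apply: le_trans (ler_normD _ _) _; move: vy e2; rewrite /r; clear; lra.
  split; [by apply: le_trans u1 _; rewrite gerBl ltW|by apply: le_trans v1 _; rewrite gerBl ltW|].
  by rewrite /dl lerBrDr -lerBrDl ge_max u1 v1.
pose U z := T * k * V z.
have mU : cmeas U by apply: cmeasM => //; exact: cmeas_cst.
have Tk0 : 0 <= T * k by rewrite mulr_ge0 // ltW.
have U0 z : 0 <= U z by exact: mulr_ge0.
have UA : (aint U <= (T * k * A)%:E)%E.
  by rewrite aintZ // [(_ * A)%:E]EFinM lee_wpmul2l // lee_fin.
have fU u v : `|u - x| <= r -> `|v - y| <= r -> normc (f (Complex u v)) <= U (Complex u v).
  move=> ux vy; have [u1 v1 rd] := near _ _ ux vy.
  have hB : h u v <= B by apply: ub_le_sup => //; exists u, v.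
  have fT : normc (f (Complex u v)) <= T.
    rewrite /T ler_pdivlMr // mulrC; apply: le_trans hB; rewrite ler_wpM2r ?normc_ge0 //.
    by apply: ge0_ler_powR; rewrite ?nnegrE ?(ltW m0) ?(ltW r0) // dl0.
  apply: le_trans (le_powR_scaled (normc_ge0 _) fT T0 q1) _.
  rewrite /U -mulrA ler_pM2l // /T invf_div powRM ?normc_ge0 ?(divr_ge0 (ltW s0) (ltW B0)) // mulrC.
  by rewrite ler_wpM2l // fV.
have main := submean ef r0 mU U0 fU UA.
have Bq0 : 0 < B `^ q by rewrite powR_gt0.
have dm : dl x y `^ m = 2 `^ m * s.
  by rewrite /s -powRM ?(ltW r0) // /r mulrC divfK.
have key : B `^ q <= 16 * 2 `^ m * A.
  have h1 : normc (f (Complex x y)) * B `^ q <= 8 * T * A.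
    apply: le_trans (ler_wpM2r (ltW Bq0) main) _.
    rewrite (_ : _ * B `^ q = 8 / r ^+ 2 * (T * A) * (k * B `^ q)); last by ring.
    rewrite kB (_ : _ * r ^+ 2 = 8 * T * A) //; field; rewrite gt_eqF //.
  have h2 : B / 2 * B `^ q <= 2 `^ m * s * (8 * T * A).
    apply: (@le_trans _ _ (h x y * B `^ q)); first by apply: ler_wpM2r; exact: ltW.
    by rewrite /h dm -[X in X <= _]mulrA ler_wpM2l // mulr_ge0 ?powR_ge0 // ltW.
  rewrite -(@ler_pM2l _ (B / 2)) ?divr_gt0 //; apply: le_trans h2 _.
  by rewrite /T le_eqVlt; apply/orP; left; apply/eqP; field; rewrite gt_eqF.
apply: le_trans key; apply: ge0_ler_powR => //; rewrite ?nnegrE ?normc_ge0 ?(ltW q0) ?(ltW B0) //.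
Qed.

Lemma entireX f n : entire f -> entire (fun z => f z ^+ n).
Proof.
by move=> /entireP ef; apply/entireP => z; exact: holoX.
Qed.

Lemma entireM f g : entire f -> entire g -> entire (fun z => f z * g z).
Proof.
by move=> /entireP ef /entireP eg; apply/entireP => z; exact: holoM.
Qed.

Lemma entireD f g : entire f -> entire g -> entire (fun z => f z + g z).
Proof.
by move=> /entireP ef /entireP eg; apply/entireP => z; exact: holoD.
Qed.

Lemma entire_id : entire (fun z : C => z).
Proof.
by apply/entireP => z; exact: holo_id.
Qed.

Lemma entire_affine (a b : C) : entire (fun z => a * z + b).
Proof.
by apply/entireP => z; apply: holoD; [apply: holoM; [exact: holo_cst|exact: holo_id]|exact: holo_cst].
Qed.

Lemma entire_cexp f : entire f -> entire (fun z => cexp (f z)).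
Proof.
by move=> /entireP ef; apply/entireP => z; exact: (holo_comp (ef z) (ex_intro _ _ (has_cder_cexp _))).
Qed.

Lemma entire_comp f g : entire f -> entire g -> entire (fun z => g (f z)).
Proof.
by move=> /entireP ef /entireP eg; apply/entireP => z; exact: (holo_comp (ef z) (eg _)).
Qed.

(** Large exponents reduce to small ones by raising [f] to an integer power. *)
Lemma submean_powR (q : R) : 0 < q -> exists2 K : R, 0 < K & forall f x0 y0 (A : R) V,
  entire f -> cmeas V -> (forall z, 0 <= V z) ->
  (forall x y, `|x - x0| <= 1 -> `|y - y0| <= 1 -> normc (f (Complex x y)) `^ q <= V (Complex x y)) ->
  (aint V <= A%:E)%E -> normc (f (Complex x0 y0)) `^ q <= K * A.
Proof.
move=> q0; pose n := (Num.bound q).+1.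
have qn : q <= n%:R.
  by apply/ltW; apply: (@lt_trans _ _ (Num.bound q)%:R); [rewrite archi_boundP // ltW|rewrite ltr_nat].
have n0 : 0 < n%:R :> R by rewrite ltr0n.
pose q' := q / n%:R; have q'0 : 0 < q' by rewrite divr_gt0.
have q'1 : q' <= 1 by rewrite ler_pdivrMr // mul1r.
exists (16 * 2 `^ (2 / q')); first by rewrite mulr_gt0 // powR_gt0.
move=> f x0 y0 A V ef mV V0 fV VA.
have E z : normc (f z ^+ n) `^ q' = normc (f z) `^ q.
  by rewrite normcX -powR_mulrn ?normc_ge0 // -powRrM /q' mulrC divfK // gt_eqF.
have := @submean_small_exponent _ x0 y0 q' A V (@entireX f n ef) q'0 q'1 mV V0.
by rewrite E; apply=> // x y hx hy; rewrite E; exact: fV.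
Qed.

Definition fock_weight (p : R) f z := normc (f z) `^ p * expR (- (p * normc z ^+ 2 / 2)).

Lemma fock_weight_ge0 p f z : 0 <= fock_weight p f z.
Proof.
by rewrite mulr_ge0 ?powR_ge0 ?expR_ge0.
Qed.

Lemma cmeas_normc2 : cmeas (fun z : C => normc z ^+ 2).
Proof.
have m := cmeas_cts (@cts_id R); exact: (cmeasM m m).
Qed.

Lemma cmeas_fock_weight p f : (forall z, cts f z) -> cmeas (fock_weight p f).
Proof.
move=> fc; apply: cmeasM; first by apply: cmeas_powR; exact: cmeas_cts.
apply: cmeas_expR; rewrite (_ : (fun z => _) = fun z : C => (- (p / 2)) * normc z ^+ 2).
  by apply: cmeasM; [exact: cmeas_cst|exact: cmeas_normc2].
by apply/funext => z; ring.
Qed.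

Lemma Re_conj_mul (z w : C) : Re (conjc z * w) = Re z * Re w + Im z * Im w.
Proof.
by case: z w => [a b] [c d] /=; rewrite mulNr opprK.
Qed.

(** The point evaluations are bounded with the natural weight; translating the
    centre to the origin costs the factor [exp (- conj z0 (z - z0))]. *)
Lemma fock_pointwise (p : R) : 0 < p -> exists2 K : R, 0 < K & forall f (A : R) z0,
  entire f -> (aint (fock_weight p f) <= A%:E)%E -> fock_weight p f z0 <= K * A.
Proof.
move=> p0; have [K K0 HK] := submean_powR p0.
exists (K * expR p); first by rewrite mulr_gt0 // expR_gt0.
move=> f A z0 ef fA.
have A0 : 0 <= A by rewrite -lee_fin; apply: le_trans fA; apply: aint_ge0 => z; exact: fock_weight_ge0.
pose g z := f z * cexp (- conjc z0 * (z - z0)).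
have el : entire (fun z => - conjc z0 * (z - z0)).
  rewrite (_ : (fun z => _) = fun z => - conjc z0 * z + conjc z0 * z0); first exact: entire_affine.
  by apply/funext => z; ring.
have eg : entire g by exact: (entireM ef (entire_cexp el)).
pose E := expR p * expR (p * normc z0 ^+ 2 / 2).
have E0 : 0 <= E by rewrite mulr_ge0 ?expR_ge0.
pose V z := E * fock_weight p f z.
have mV : cmeas V.
  by apply: cmeasM; [exact: cmeas_cst|apply: cmeas_fock_weight; exact: entire_cts].
have V0 z : 0 <= V z by rewrite mulr_ge0 // fock_weight_ge0.
have gV x y : `|x - Re z0| <= 1 -> `|y - Im z0| <= 1 -> normc (g (Complex x y)) `^ p <= V (Complex x y).
  move=> hx hy; set z := Complex x y.
  rewrite /V /fock_weight /g Normc.normcM powRM ?normc_ge0 // normc_cexp -expRM.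
  rewrite mulrCA; apply: ler_wpM2l; first exact: powR_ge0.
  rewrite /E -!expRD ler_expR mulNr.
  have -> : Re (- (conjc z0 * (z - z0))) = - (Re z0 * (x - Re z0) + Im z0 * (y - Im z0)).
    by rewrite /z; case: (z0) => [a b] /=; ring.
  rewrite !sqr_normc (_ : Re z = x) // (_ : Im z = y) //.
  have h2 (t : R) : `|t| <= 1 -> t ^+ 2 <= 1.
    by move=> ht; rewrite -real_normK ?num_real // exprn_ile1.
  have a1 := ler_wpM2l (ltW p0) (h2 _ hx); have a2 := ler_wpM2l (ltW p0) (h2 _ hy).
  move: a1 a2; clear; move: (Re z0) (Im z0) => a b; nra.
have VA : (aint V <= (E * A)%:E)%E.
  rewrite aintZ //; last 2 first.
  - by apply: cmeas_fock_weight; exact: entire_cts.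
  - exact: fock_weight_ge0.
  by rewrite [(E * A)%:E]EFinM lee_wpmul2l // lee_fin.
have := HK g (Re z0) (Im z0) _ V eg mV V0 gV VA.
have -> : Complex (Re z0) (Im z0) = z0 by case: (z0).
rewrite /g subrr mulr0 cexp0 mulr1 => H.
rewrite /fock_weight; have W0 := expR_gt0 (- (p * normc z0 ^+ 2 / 2)).
apply: le_trans (ler_wpM2r (ltW W0) H) _.
have -> : K * (E * A) * expR (- (p * normc z0 ^+ 2 / 2)) = K * expR p * A * (expR (p * normc z0 ^+ 2 / 2) * expR (- (p * normc z0 ^+ 2 / 2))).
  by rewrite /E; ring.
by rewrite -expRD subrr expR0 mulr1.
Qed.

End PointwiseEstimates.

(** * Gaussian integrals and Gaussian majorants *)

Section Gaussians.
Context {R : realType}.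
Local Notation C := R[i].
Local Notation mu := (@lebesgue_measure R).
Implicit Types (f g : C -> C).

Lemma integral_gaussian (c m : R) : 0 < c ->
  (\int[mu]_x (expR (- (c * (x - m) ^+ 2 / 2)))%:E = (Num.sqrt (2 * pi / c))%:E)%E.
Proof.
move=> c0; pose s := (Num.sqrt c)^-1.
have s0 : s != 0 by rewrite invr_eq0 sqrtr_eq0 -ltNge.
have s2 : s ^+ 2 = c^-1 by rewrite exprVn sqr_sqrtr // ltW.
have p0 := normal_peak_gt0 s0.
have := @integral_normal_pdf R m s; rewrite normal_pdfE //.
under eq_integral do rewrite EFinM.
rewrite ge0_integralZl_EFin //; last 3 first.
- by move=> x _; rewrite lee_fin normal_fun_ge0.
- by apply/measurable_EFinP; exact: measurable_normal_fun.
- exact: ltW.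
have -> : normal_peak s = (Num.sqrt (2 * pi / c))^-1.
  by rewrite /normal_peak s2; congr ((Num.sqrt _)^-1); rewrite -mulr_natl; ring.
have -> : (fun x => (normal_fun m s x)%:E) = (fun x => (expR (- (c * (x - m) ^+ 2 / 2)))%:E).
  apply/funext => x; rewrite /normal_fun s2 -mulr_natl; congr (expR _)%:E.
  by field; rewrite gt_eqF.
set I := (\int[mu]_x _)%E; set k := Num.sqrt _.
have k0 : 0 < k by rewrite sqrtr_gt0 !mulr_gt0 ?invr_gt0 ?pi_gt0.
move=> H; have : (k%:E * (k^-1%:E * I) = k%:E)%E by rewrite H mule1.
by rewrite muleA -EFinM divff ?gt_eqF // mul1e.
Qed.

Lemma aint_gaussian (c d m n : R) : 0 < c -> 0 < d ->
  aint (fun z => expR (- (c * (Re z - m) ^+ 2 / 2) - d * (Im z - n) ^+ 2 / 2)) =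
  (Num.sqrt (2 * pi / c) * Num.sqrt (2 * pi / d))%:E.
Proof.
move=> c0 d0.
have ms (k l : R) (U : C -> R) : cmeas U -> cmeas (fun z => - (k * (U z - l) ^+ 2 / 2)).
  move=> mU; rewrite (_ : (fun z => _) = fun z => (- (k / 2)) * ((U z - l) * (U z - l))).
    by apply: cmeasM; [exact: cmeas_cst|apply: cmeasM; (apply: cmeasD => //; exact: cmeas_cst)].
  by apply/funext => z; ring.
have mE : cmeas (fun z : C => expR (- (c * (Re z - m) ^+ 2 / 2) - d * (Im z - n) ^+ 2 / 2)).
  by apply: cmeas_expR; apply: cmeasD; apply: ms; [exact: cmeas_Re|exact: cmeas_Im].
rewrite aint_iter1 //.
have mg (k l : R) : measurable_fun [set: R] (fun x => (expR (- (k * (x - l) ^+ 2 / 2)))%:E).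
  by apply/measurable_EFinP; exact: (cmeas_hsection 0 (cmeas_expR (ms k l _ cmeas_Re))).
transitivity (\int[mu]_x ((Num.sqrt (2 * pi / d))%:E * (expR (- (c * (x - m) ^+ 2 / 2)))%:E))%E.
  apply: eq_integral => x _ /=.
  under eq_integral do rewrite expRD EFinM.
  rewrite ge0_integralZl_EFin ?expR_ge0 //; last exact: mg.
  by rewrite integral_gaussian // muleC.
rewrite ge0_integralZl_EFin ?sqrtr_ge0 //; last exact: mg.
by rewrite integral_gaussian // -EFinM mulrC.
Qed.

Lemma aint_gaussian_radial (c : R) : 0 < c ->
  aint (fun z => expR (- (c * normc z ^+ 2 / 2))) = (2 * pi / c)%:E.
Proof.
move=> c0; have := aint_gaussian 0 0 c0 c0.
rewrite -expr2 sqr_sqrtr; last by rewrite divr_ge0 ?mulr_ge0 ?pi_ge0 // ltW.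
move=> <-; congr aint; apply/funext => z; congr expR; rewrite sqr_normc !subr0; ring.
Qed.

Lemma fock_weight_le (q : R) g z (T : R) : 0 < q -> 0 <= T -> normc (g z) <= T ->
  fock_weight q g z <= T `^ q * expR (- (q * normc z ^+ 2 / 2)).
Proof.
move=> q0 T0 gT; rewrite ler_wpM2r ?expR_ge0 //.
by apply: ge0_ler_powR; rewrite ?nnegrE ?normc_ge0 // ltW.
Qed.

Lemma aint_fock_weight_gaussian_le (q gamma K T : R) g : 0 < q -> gamma < 1 -> 0 <= T ->
  (forall z, cts g z) ->
  (forall z, normc (g z) <= T * expR (gamma * normc z ^+ 2 / 2 + K)) ->
  (aint (fock_weight q g) <= (T `^ q * (expR (q * K) * (2 * pi / (q * (1 - gamma)))))%:E)%E.
Proof.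
move=> q0 g1 T0 gc gT.
have c0 : 0 < q * (1 - gamma) by rewrite mulr_gt0 // subr_gt0.
have k0 : 0 <= T `^ q * expR (q * K) by rewrite mulr_ge0 ?powR_ge0 ?expR_ge0.
have mG : cmeas (fun z : C => expR (- (q * (1 - gamma) * normc z ^+ 2 / 2))).
  apply: cmeas_expR; rewrite (_ : (fun z => _) = fun z : C => (- (q * (1 - gamma) / 2)) * normc z ^+ 2).
    by apply: cmeasM; [exact: cmeas_cst|exact: cmeas_normc2].
  by apply/funext => z; ring.
rewrite mulrA EFinM -aint_gaussian_radial // -aintZ //.
apply: le_aint; [exact: cmeas_fock_weight|by apply: cmeasM => //; exact: cmeas_cst|by move=> z; exact: fock_weight_ge0|].
move=> z; apply: le_trans (fock_weight_le q0 _ (gT z)) _; first by rewrite mulr_ge0 ?expR_ge0.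
rewrite powRM ?expR_ge0 // -expRM -!mulrA ler_wpM2l ?powR_ge0 // -!expRD ler_expR.
by rewrite le_eqVlt; apply/orP; left; apply/eqP; field.
Qed.

(** Distant points are handled by the growth bound itself, near points by the
    first order remainder of the expansion of [f] at [v], which only involves
    [f] at points of modulus at most [rho + 2]. *)
Lemma fock_lipschitz f (M rho : R) u v : entire f -> 0 <= M ->
  (forall z, normc (f z) <= M * expR (normc z ^+ 2 / 2)) -> normc u <= rho -> normc v <= rho ->
  normc (f u - f v) <= 8 * M * normc (u - v) * expR ((rho + 2) ^+ 2 / 2).
Proof.
move=> ef M0 fM ur vr; set E := expR _; have E0 : 0 <= E by exact: expR_ge0.
have rho0 : 0 <= rho by exact: le_trans (normc_ge0 u) ur.
have fE z : normc z <= rho + 2 -> normc (f z) <= M * E.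
  move=> zr; apply: le_trans (fM z) _; rewrite ler_wpM2l // ler_expR ler_pM2r //.
  by apply: lerXn2r => //; rewrite nnegrE ?normc_ge0 // addr_ge0.
have ME0 : 0 <= M * E by rewrite mulr_ge0.
have fu : normc (f u) <= M * E by apply: fE; rewrite (le_trans ur) // lerDl.
have fv : normc (f v) <= M * E by apply: fE; rewrite (le_trans vr) // lerDl.
rewrite (_ : 8 * M * normc (u - v) * E = M * E * (8 * normc (u - v))); last by ring.
have [far|near] := lerP (1 / 2) (normc (u - v)).
  apply: le_trans (ler_normcB _ _) _; apply: le_trans (lerD fu fv) _.
  rewrite -[X in X + _]mulr1 -[X in _ + X]mulr1 -mulrDr ler_wpM2l //.
  by move: far; clear; lra.
pose g z := f (z + v).
have eg : entire g.
  apply/entireP => z; apply: (@holo_comp _ (fun z => z + v) f).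
    by apply: holoD; [exact: holo_id|exact: holo_cst].
  exact: (entireP f).1.
have gM w : 1 <= normc w <= 2 * 1 -> normc (g w) <= M * E.
  rewrite mulr1 => /andP[_ w2]; apply: fE; apply: le_trans (le_normcD _ _) _.
  by rewrite addrC lerD.
have d1 : normc (u - v) < 1 by move: near; clear; lra.
have d2 : 2 * normc (u - v) <= 1 by move: near; clear; lra.
have := taylor_rem_bound 1 eg ltr01 d2 gM; have := taylor_expansion 1 eg d1.
rewrite big_ord1 expr0 mulr1 expr1 expr1n divr1 tcoef_0 // /g subrK add0r.
set Q := taylor_rem _ _ _ _ => H QB.
have : twopii * (f u - f v) = (u - v) * Q by rewrite mulrBr H addrC addKr.
move=> /(congr1 (@Normc.normc R)); rewrite !Normc.normcM normc_twopii => {}H.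
have p2 := @pi_ge2 R; have := ler_wpM2l (normc_ge0 (u - v)) QB; rewrite -H.
have : 2 * 2 * normc (f u - f v) <= 2 * pi * normc (f u - f v).
  by rewrite ler_wpM2r ?normc_ge0 // ler_pM2l.
by clear; lra.
Qed.

(** The cross term is split by completing a square, which costs an arbitrarily
    small multiple of [r^2]. *)
Lemma affine_square_le (alpha beta : R) : 0 <= alpha -> alpha < 1 -> 0 <= beta ->
  exists K : R, forall r, 0 <= r -> (alpha * r + beta) ^+ 2 <= (1 + alpha ^+ 2) / 2 * r ^+ 2 + K.
Proof.
move=> a0 a1 b0; pose e := (1 - alpha ^+ 2) / 2.
have e0 : 0 < e by rewrite divr_gt0 // subr_gt0 -[ltRHS](expr1n _ 2) ltrXn2r // nnegrE.
have -> : (1 + alpha ^+ 2) / 2 = alpha ^+ 2 + e by rewrite /e; field.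
move: e e0 => e e0; exists (beta ^+ 2 + alpha ^+ 2 * beta ^+ 2 / e) => r r0.
rewrite -subr_ge0 (_ : _ - _ = (e * r - alpha * beta) ^+ 2 / e).
  by rewrite divr_ge0 ?sqr_ge0 // ltW.
by field; rewrite gt_eqF.
Qed.

End Gaussians.

(** * The operator norm through integrals *)

Section OperatorNorm.
Context {R : realType}.
Local Notation C := R[i].
Implicit Types (f g : C -> C) (p q : R).

Lemma fock_normE p f : fock_norm p f = (((p / (2 * pi))%:E * aint (fock_weight p f)) `^ p^-1)%E.
Proof.
by [].
Qed.

Lemma poweR_root_le (x : \bar R) (c q N : R) : (0 <= x)%E -> 0 < c -> 0 < q -> 0 <= N ->
  ((c%:E * x) `^ q^-1 <= N%:E)%E = (x <= (N `^ q / c)%:E)%E.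
Proof.
move=> x0 c0 q0 N0; have qi0 : 0 < q^-1 by rewrite invr_gt0.
have qn0 : q != 0 by rewrite gt_eqF.
case: x x0 => [x|_|//]; last first.
  by rewrite gt0_muley ?lte_fin // poweRyr ?gt_eqF // !leye_eq.
rewrite lee_fin => x0; rewrite -EFinM poweR_EFin !lee_fin ler_pdivlMr // [x * c]mulrC.
have cx0 : 0 <= c * x by rewrite mulr_ge0 // ltW.
apply/idP/idP => H.
  have := @ge0_ler_powR R q (ltW q0) ((c * x) `^ q^-1) N.
  rewrite !nnegrE powR_ge0 => /(_ isT N0 H).
  by rewrite -powRrM mulVf // powRr1.
have := @ge0_ler_powR R q^-1 (ltW qi0) (c * x) (N `^ q).
rewrite !nnegrE powR_ge0 => /(_ cx0 isT H).
by rewrite -powRrM mulfV // powRr1.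
Qed.

Lemma fock_coef_gt0 p : 0 < p -> 0 < p / (2 * pi).
Proof.
by move=> p0; rewrite divr_gt0 // mulr_gt0 // pi_gt0.
Qed.

Lemma fock_weight_aint_ge0 p f : (0 <= aint (fock_weight p f))%E.
Proof.
by apply: aint_ge0 => z; exact: fock_weight_ge0.
Qed.

Lemma fock_norm_le p f (N : R) : 0 < p -> 0 <= N ->
  (fock_norm p f <= N%:E)%E = (aint (fock_weight p f) <= (N `^ p / (p / (2 * pi)))%:E)%E.
Proof.
by move=> p0 N0; rewrite fock_normE poweR_root_le // ?fock_weight_aint_ge0 ?fock_coef_gt0.
Qed.

Lemma fock_norm_le1 p f : 0 < p ->
  (fock_norm p f <= 1)%E = (aint (fock_weight p f) <= (2 * pi / p)%:E)%E.
Proof.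
by move=> p0; rewrite fock_norm_le // powR1 mul1r invf_div.
Qed.

Lemma fockP p f : 0 < p -> fock p f <-> entire f /\ exists M : R, (aint (fock_weight p f) <= M%:E)%E.
Proof.
move=> p0; have c0 := fock_coef_gt0 p0; split=> -[ef H]; split=> //.
  have : (fock_norm p f <= (fine (fock_norm p f))%:E)%E.
    by rewrite fineK // ge0_fin_numE // fock_normE poweR_ge0.
  rewrite fock_norm_le // => [K|]; first by eexists; exact: K.
  by rewrite fine_ge0 // fock_normE poweR_ge0.
case: H => M HM; rewrite fock_normE; apply: poweR_lty.
by apply: (le_lt_trans (lee_wpmul2l _ HM)); rewrite ?lee_fin ?(ltW c0) // -EFinM ltry.
Qed.

Section Operators.
Context {p : R}.
Implicit Types (S T : fock p -> C -> C).

(** A bound on [||T||^q] up to the normalizing constant. Stated on integrals it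
    needs neither roots nor extended reals, and it treats [q < 1] and [q >= 1]
    alike. *)
Definition op_le q T (M : R) := forall f : fock p,
  (aint (fock_weight p (\val f)) <= (2 * pi / p)%:E)%E -> (aint (fock_weight q (T f)) <= M%:E)%E.

Lemma op_norm_le q T (N : R) : 0 < p -> 0 < q -> 0 <= N ->
  (op_norm q T <= N%:E)%E <-> op_le q T (N `^ q / (q / (2 * pi))).
Proof.
move=> p0 q0 N0; split=> [TN f f1|TN].
  rewrite -fock_norm_le //; apply: le_trans TN; apply: ereal_sup_ubound.
  by exists f => //=; rewrite fock_norm_le1.
apply: ge_ereal_sup => _ [f /= f1 <-]; rewrite fock_norm_le //; apply: TN.
by rewrite -fock_norm_le1.
Qed.

Lemma fock0 q : 0 < q -> fock q (fun=> 0 : C).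
Proof.
move=> q0; apply/fockP => //; split; first exact: (@entire_cst R 0).
exists 0; rewrite (_ : fock_weight q (fun=> 0) = fun z : C => 0 * 1).
  by rewrite aintZ ?mul0e //; exact: cmeas_cst.
by apply/funext => z; rewrite /fock_weight Normc.normc0 powR0 ?gt_eqF // !mul0r.
Qed.

Lemma op_norm_ge0 q T : 0 < p -> (0 <= op_norm q T)%E.
Proof.
move=> p0; pose z : fock p := SigSub (mem_set (fock0 p0)).
apply: (@le_trans _ _ (fock_norm q (T z))); first by rewrite fock_normE poweR_ge0.
apply: ereal_sup_ubound; exists z => //=.
rewrite fock_norm_le1 // (_ : fock_weight p (\val z) = fun z : C => 0 * 1).
  rewrite aintZ ?mul0e //; last exact: cmeas_cst.
  by rewrite lee_fin divr_ge0 ?mulr_ge0 ?pi_ge0 // ltW.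
by apply/funext => w; rewrite /fock_weight Normc.normc0 powR0 ?gt_eqF // !mul0r.
Qed.

Lemma op_norm_lty q T : 0 < p -> 0 < q ->
  (op_norm q T < +oo)%E <-> exists2 M : R, 0 <= M & op_le q T M.
Proof.
move=> p0 q0; have c0 := fock_coef_gt0 q0; split=> [T1|[M M0 TM]].
  have T0 := @op_norm_ge0 q T p0.
  have N0 : 0 <= fine (op_norm q T) by rewrite fine_ge0.
  exists (fine (op_norm q T) `^ q / (q / (2 * pi))).
    by rewrite divr_ge0 ?powR_ge0 // ltW.
  by apply/op_norm_le => //; rewrite fineK // ge0_fin_numE.
pose N := (M * (q / (2 * pi))) `^ q^-1.
apply: (@le_lt_trans _ _ N%:E); last exact: ltry.
apply/op_norm_le => //; first exact: powR_ge0.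
rewrite /N -powRrM mulVf ?gt_eqF // powRr1 ?mulrK ?unitfE ?gt_eqF //.
by rewrite mulr_ge0 // ltW.
Qed.

Lemma op_le_mono q T (M N : R) : M <= N -> op_le q T M -> op_le q T N.
Proof.
by move=> MN TM f f1; apply: le_trans (TM f f1) _; rewrite lee_fin.
Qed.

Lemma min1_gt0 q : 0 < q -> 0 < Num.min 1 q.
Proof.
by move=> q0; rewrite lt_min ltr01.
Qed.

Lemma op_dist_lt_op_le q (delta : R) : 0 < p -> 0 < q -> 0 < delta -> exists2 e : R, 0 < e &
  forall S T, (op_dist q S T < e%:E)%E -> op_le q (fun (u : fock p) z => S u z - T u z) delta.
Proof.
move=> p0 q0 d0; have c0 := fock_coef_gt0 q0.
pose N := (delta * (q / (2 * pi))) `^ q^-1.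
have N0 : 0 < N by rewrite powR_gt0 // mulr_gt0.
have -> : delta = N `^ q / (q / (2 * pi)).
  rewrite /N -powRrM mulVf ?gt_eqF // powRr1 ?mulfK ?gt_eqF //.
  by rewrite mulr_ge0 // ltW.
exists (N `^ Num.min 1 q); first by rewrite powR_gt0.
move=> S T ST; apply/op_norm_le => //; first exact: ltW.
rewrite leNgt; apply/negP => NT; move: ST; apply/negP; rewrite -leNgt /op_dist.
rewrite -poweR_EFin; apply: gt0_ler_poweR; rewrite ?ltW ?min1_gt0 ?in_itv //= ?leey ?lee_fin ?andbT ?(ltW N0) //.
exact: op_norm_ge0.
Qed.

Lemma op_le_op_dist_lt q (e : R) : 0 < p -> 0 < q -> 0 < e -> exists2 delta : R, 0 < delta &
  forall S T, op_le q (fun (u : fock p) z => S u z - T u z) delta -> (op_dist q S T < e%:E)%E.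
Proof.
move=> p0 q0 e0; have c0 := fock_coef_gt0 q0; have m0 := min1_gt0 q0.
pose N := (e / 2) `^ (Num.min 1 q)^-1.
have e20 : 0 < e / 2 by rewrite divr_gt0.
have N0 : 0 < N by rewrite powR_gt0.
exists (N `^ q / (q / (2 * pi))); first by rewrite divr_gt0 // powR_gt0.
move=> S T /(@op_norm_le _ _ _ p0 q0 (ltW N0)) ST.
apply: (@le_lt_trans _ _ (N%:E `^ (Num.min 1 q)%R)%E).
  apply: gt0_ler_poweR => //; first exact: ltW.
  - by rewrite in_itv /= leey andbT op_norm_ge0.
  - by rewrite in_itv /= leey andbT lee_fin ltW.
have e2e : e / 2 < e by rewrite ltr_pdivrMr // ltr_pMr // ltr1n.
by rewrite poweR_EFin lte_fin /N -powRrM mulVf ?gt_eqF // powRr1 // ltW.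
Qed.

End Operators.

End OperatorNorm.

(* [entire f] unfolds to a product, whose variables would otherwise be
   counted among the implicit arguments. *)
#[local] Arguments entireM {R f g} _ _.
#[local] Arguments entireD {R f g} _ _.
#[local] Arguments entireB {R f g} _ _.
#[local] Arguments entireX {R f} n _.
#[local] Arguments entire_cst {R} k.
#[local] Arguments entire_affine {R} a b.
#[local] Arguments entire_comp {R f g} _ _.
#[local] Arguments entire_cexp {R f} _.
#[local] Arguments entire_id {R}.
#[local] Arguments entire_cts {R f} _ z.
#[local] Arguments cts_comp {R f g z} _ _.
#[local] Arguments ctsM {R f g z} _ _.
#[local] Arguments ctsD {R f g z} _ _.

(** * Kernels and the growth of the symbols *)

Section Kernels.
Context {R : realType}.
Local Notation C := R[i].
Implicit Types (f g psi phi : C -> C) (p q : R).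

(** The normalized reproducing kernels; all of them are unit vectors of every
    Fock space. *)
Definition kern (w z : C) : C := cexp (conjc w * z - Complex (normc w ^+ 2 / 2) 0).

Lemma normc_kern w z : normc (kern w z) = expR (Re w * Re z + Im w * Im z - normc w ^+ 2 / 2).
Proof.
rewrite normc_cexp; congr expR.
by rewrite -Re_conj_mul; case: (conjc w * z).
Qed.

Lemma entire_kern w : entire (kern w).
Proof.
exact: (entire_cexp (entire_affine (conjc w) (- Complex (normc w ^+ 2 / 2) 0))).
Qed.

Lemma fock_weight_kern p w z : fock_weight p (kern w) z =
  expR (- (p * (Re z - Re w) ^+ 2 / 2) - p * (Im z - Im w) ^+ 2 / 2).
Proof.
rewrite /fock_weight normc_kern -expRM -expRD; congr expR.
by rewrite !sqr_normc; field.
Qed.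

Lemma aint_fock_weight_kern p w : 0 < p -> aint (fock_weight p (kern w)) = (2 * pi / p)%:E.
Proof.
move=> p0; have := aint_gaussian (Re w) (Im w) p0 p0.
rewrite -expr2 sqr_sqrtr; last by rewrite divr_ge0 ?mulr_ge0 ?pi_ge0 // ltW.
by move=> <-; congr aint; apply/funext => z; exact: fock_weight_kern.
Qed.

Lemma fock_kern p w : 0 < p -> fock p (kern w).
Proof.
move=> p0; apply/fockP => //; split; first exact: entire_kern.
by exists (2 * pi / p); rewrite aint_fock_weight_kern.
Qed.

Definition fkern p (p0 : 0 < p) w : fock p := SigSub (mem_set (fock_kern w p0)).

Lemma fkern_unit p (p0 : 0 < p) w :
  (aint (fock_weight p (\val (fkern p0 w))) <= (2 * pi / p)%:E)%E.
Proof.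
by rewrite aint_fock_weight_kern.
Qed.

Lemma fock_pointwise_root q : 0 < q -> exists2 K : R, 0 < K & forall f (A : R) z,
  entire f -> (aint (fock_weight q f) <= A%:E)%E ->
  normc (f z) <= (K * A) `^ q^-1 * expR (normc z ^+ 2 / 2).
Proof.
move=> q0; have [K K0 HK] := fock_pointwise q0; exists K => // f A z ef fA.
have KA0 : 0 <= K * A by rewrite (le_trans (fock_weight_ge0 q f z)) // HK.
have qn0 : q != 0 by rewrite gt_eqF.
have E0 := expR_gt0 (normc z ^+ 2 / 2).
have := HK f A z ef fA; rewrite /fock_weight.
have -> : expR (- (q * normc z ^+ 2 / 2)) = (expR (normc z ^+ 2 / 2))^-1 `^ q.
  by rewrite -expRN -expRM; congr expR; ring.
rewrite -powRM ?normc_ge0 ?invr_ge0 ?expR_ge0 // => H.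
have t0 : 0 <= normc (f z) / expR (normc z ^+ 2 / 2) by rewrite divr_ge0 ?normc_ge0 // ltW.
rewrite -ler_pdivrMr //.
have qi0 : 0 <= q^-1 by rewrite invr_ge0 ltW.
have := @ge0_ler_powR R q^-1 qi0 _ _ _ _ H.
by rewrite -powRrM mulfV // powRr1 // => -> //; rewrite nnegrE ?powR_ge0.
Qed.

Lemma wcomp_kern_bound q : 0 < q -> exists2 K : R, 0 < K & forall p (p0 : 0 < p) (M : R)
  (T : fock p -> C -> C) w z, (forall u, entire (T u)) -> op_le q T M ->
  normc (T (fkern p0 w) z) <= (K * M) `^ q^-1 * expR (normc z ^+ 2 / 2).
Proof.
move=> q0; have [K K0 HK] := fock_pointwise_root q0; exists K => // p p0 M T w z eT TM.
by apply: HK => //; apply: TM; exact: fkern_unit.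
Qed.

Lemma val_entire p (u : fock p) : entire (\val u).
Proof.
by have [] := set_valP u.
Qed.

Lemma entire_wcomp p psi phi (u : fock p) : entire psi -> entire phi -> entire (wcomp psi phi u).
Proof.
move=> epsi ephi; have e := entireM epsi (entire_comp ephi (@val_entire p u)); exact: e.
Qed.

(** The kernel centred at [phi z] is tested at the point [z]. *)
Lemma wcomp_growth p q psi phi (M : R) : 0 < p -> 0 < q -> entire psi -> entire phi ->
  op_le q (wcomp psi phi : fock p -> C -> C) M -> exists2 B : R, 0 <= B & forall z,
  normc (psi z) * expR (normc (phi z) ^+ 2 / 2) <= B * expR (normc z ^+ 2 / 2).
Proof.
move=> p0 q0 epsi ephi TM; have [K K0 HK] := wcomp_kern_bound q0.
exists ((K * M) `^ q^-1) => [|z]; first exact: powR_ge0.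
have := HK p p0 M _ (phi z) z (fun u => @entire_wcomp p psi phi u epsi ephi) TM.
rewrite /wcomp Normc.normcM /= normc_kern -!expr2 -sqr_normc.
by rewrite (_ : normc (phi z) ^+ 2 - _ = normc (phi z) ^+ 2 / 2) //; field.
Qed.

Lemma sqr_normcD (z w : C) : normc (z + w) ^+ 2 = normc z ^+ 2 + 2 * Re (conjc z * w) + normc w ^+ 2.
Proof.
by rewrite Re_conj_mul !sqr_normc; case: z w => [a b] [c d] /=; ring.
Qed.

Lemma lim0_cts f L : lim0 f L <-> cts (fun z => if z == 0 then L else f z) 0.
Proof.
split=> [fL e e0|fc e e0].
  have e20 : 0 < e / 2 by rewrite divr_gt0.
  have [r r0 H] := fL _ e20; exists r => // w; rewrite subr0 eqxx => wr.
  have [_|w0] := eqVneq w 0; first by rewrite subrr Normc.normc0.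
  by apply: le_lt_trans (H w w0 wr) _; rewrite ltr_pdivrMr // ltr_pMr // ltr1n.
have [r r0 H] := fc _ e0; exists r => // z z0 zr; have := H z.
by rewrite subr0 eqxx (negbTE z0) => /(_ zr)/ltW.
Qed.

Lemma lim0M f g L M : lim0 f L -> lim0 g M -> lim0 (fun z => f z * g z) (L * M).
Proof.
move=> /lim0_cts fL /lim0_cts gM; apply/lim0_cts.
have := ctsM fL gM; apply: (@cts_near _ _ _ _ 1) => // w _; by case: ifP.
Qed.

Lemma lim0_comp f g L : lim0 f L -> cts g L -> lim0 (fun z => g (f z)) (g L).
Proof.
move=> /lim0_cts fL gL; apply/lim0_cts.
have gL' : cts g (if (0 : C) == 0 then L else f 0) by rewrite eqxx.
have := @cts_comp _ _ _ _ fL gL'; apply: (@cts_near _ _ _ _ 1) => // w _ /=; by case: ifP.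
Qed.

Lemma lim0_cst (L : C) : lim0 (fun=> L) L.
Proof.
by move=> e e0; exists 1 => // z _ _; rewrite subrr Normc.normc0 ltW.
Qed.

Lemma gaussian_unbounded (c k B m : R) : 0 < c -> 0 < k ->
  ~ forall x, m <= x -> c * expR (k * x ^+ 2) <= B.
Proof.
move=> c0 k0 H; have ck : 0 < c * k by rewrite mulr_gt0.
have [X XE] : exists X, X = 1 + `|m| + `|B| / (c * k) by eexists.
have t0 : 0 <= `|B| / (c * k) by rewrite divr_ge0 // ltW.
have X1 : 1 <= X by rewrite XE -addrA lerDl addr_ge0.
have mX : m <= X by rewrite XE; have := ler_norm m; move: t0; clear; lra.
have BX : `|B| <= c * k * X.
  by rewrite mulrC -ler_pdivrMr // XE lerDr addr_ge0.
have := H X mX; rewrite leNgt => /negP; apply.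
apply: le_lt_trans (ler_norm B) _; apply: le_lt_trans BX _; rewrite -mulrA ltr_pM2l //.
apply: lt_le_trans (expR_ge1Dx _); apply: (@le_lt_trans _ _ (k * X ^+ 2)); last by rewrite ltrDr.
by rewrite ler_pM2l // expr2 ler_peMl // (le_trans _ X1).
Qed.

(** For large [s] the cubic exponent exceeds [(k + 1) s^2]. *)
Lemma gaussian_beats (l c B k : R) : 0 < l -> 0 < c ->
  (forall s, 1 <= s -> l * expR (c * s ^+ 3) <= B * expR (k * s ^+ 2)) -> False.
Proof.
move=> l0 c0 H; apply: (@gaussian_unbounded l 1 B (1 + `|k + 1| / c) l0 ltr01) => s sm.
have t0 : 0 <= `|k + 1| / c by rewrite divr_ge0 // ltW.
have s1 : 1 <= s by apply: le_trans sm; rewrite lerDl.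
have cs : k + 1 <= c * s.
  apply: le_trans (ler_norm _) _; rewrite mulrC -ler_pdivrMr //.
  by apply: le_trans sm; rewrite lerDr.
have E0 := expR_gt0 (k * s ^+ 2); rewrite -(ler_pM2r E0); apply: le_trans (H s s1).
rewrite -mulrA -expRD ler_pM2l // ler_expR -mulrDl addrC.
rewrite (_ : c * s ^+ 3 = c * s * s ^+ 2); last by ring.
by apply: ler_wpM2r => //; exact: sqr_ge0.
Qed.

(** If the Taylor coefficient of [phi] of some degree [m >= 2] were nonzero,
    then [psi exp (lambda z^-m (phi - affine part))], with [|lambda| = s^(m+1)],
    would grow only like [exp (C s^2)] on the annulus [s <= |z| <= 2 s], while it
    carries at the removable singularity 0 a factor [exp (c s^(m+1))]; for large
    [s] this violates the maximum principle. Beforehand the constant term of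
    [phi] is absorbed in [psi], and the zero of [psi] at 0 is divided out. *)
Lemma growth_affine psi phi (B : R) : entire psi -> entire phi -> psi <> (fun=> 0) ->
  (forall z, normc (psi z) * expR (normc (phi z) ^+ 2 / 2) <= B * expR (normc z ^+ 2 / 2)) ->
  exists a b, phi = fun z => a * z + b.
Proof.
move=> epsi ephi psi0 HB.
pose phi0 := phi 0; have [c1 dphi] := (entireP phi).1 ephi 0.
pose D z := phi z - (c1 * z + phi0).
have eD : entire D by exact: (entireB ephi (entire_affine c1 phi0)).
pose ps z := psi z * cexp (conjc phi0 * (phi z - phi0)).
have eps : entire ps.
  have e1 : entire (fun z => phi z - phi0) by exact: (entireB ephi (entire_cst phi0)).
  exact: (entireM epsi (entire_cexp (entireM (entire_cst (conjc phi0)) e1))).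
have psn0 : ps <> (fun=> 0).
  move=> E; apply: psi0; apply/funext => z.
  have : ps z = 0 by rewrite E.
  by move/eqP; rewrite mulf_eq0 (negbTE (cexp_neq0 _)) orbF => /eqP.
have B0 : 0 <= B.
  have := HB 0; rewrite Normc.normc0 expr0n mul0r expR0 mulr1; apply: le_trans.
  by rewrite mulr_ge0 ?normc_ge0 ?expR_ge0.
have Hps z : normc (ps z) * expR (normc (phi z - phi0) ^+ 2 / 2) <= B * expR (normc z ^+ 2 / 2).
  apply: le_trans (HB z); rewrite /ps Normc.normcM normc_cexp -mulrA ler_wpM2l ?normc_ge0 //.
  have key (u v : C) : Re (conjc v * u) + normc u ^+ 2 / 2 <= normc (v + u) ^+ 2 / 2.
    by rewrite sqr_normcD; have := sqr_ge0 (normc v); clear; lra.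
  by rewrite -expRD ler_expR; have := key (phi z - phi0) phi0; rewrite subrKC.
suff D0 : forall n, tcoef D n = 0.
  have := tcoef0_eq0 eD D0 => Dz; exists c1, phi0; apply/funext => z.
  by apply/eqP; rewrite -subr_eq0; apply/eqP; exact: Dz.
have [k [L [L0 kL]]] := entire_order eps psn0.
elim/ltn_ind => -[_|[_|m IH]].
- by rewrite tcoef_0 // /D mulr0 add0r subrr mulr0.
- rewrite (@tcoef_lim _ D 1 0 eD) ?mulr0 // => e e0.
  have [r r0 H] := (has_cderP phi 0 c1).1 dphi e e0; exists r => // w w0 wr.
  have := H w; rewrite !subr0 => /(_ wr) h.
  have nw : 0 < normc w by rewrite normc_gt0.
  rewrite expr1 Normc.normcM Normc.normcV ler_pdivrMr //; apply: le_trans h.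
  by rewrite /D opprD addrA addrAC [c1 * _]mulrC.
pose cm := tcoef D m.+2 / twopii.
have Dm : lim0 (fun z => D z / z ^+ m.+2) cm by exact: (tcoef_order eD IH).
have [c0|cn0] := eqVneq cm 0.
  have : cm * twopii = 0 by rewrite c0 mul0r.
  by rewrite /cm divfK // twopii_neq0.
exfalso; have ncm : 0 < normc cm by rewrite normc_gt0.
have nL : 0 < normc L by rewrite normc_gt0.
apply: (@gaussian_beats (normc L) (normc cm) (4 * B) (5 / 2 + normc c1) nL ncm) => s s1.
have s0 : 0 < s by exact: lt_le_trans s1.
(* The phase of [lam] makes [lam * cm] positive. *)
pose lam := conjc cm * Complex (s ^+ m.+3 / normc cm) 0.
have nconj (z : C) : normc (conjc z) = normc z by case: z => a b; rewrite /Normc.normc /= sqrrN.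
have nlam : normc lam = s ^+ m.+3.
  rewrite Normc.normcM nconj normcC ger0_norm ?divr_ge0 ?normc_ge0 ?exprn_ge0 ?(ltW s0) //.
  by rewrite mulrC divfK // gt_eqF.
have lamc : Re (lam * cm) = normc cm * s ^+ m.+3.
  have -> : Re (lam * cm) = normc cm ^+ 2 * (s ^+ m.+3 / normc cm).
    by rewrite sqr_normc /lam; case: (cm) => u v /=; ring.
  by rewrite expr2 -mulrA [s ^+ _ / _]mulrC mulVKf // gt_eqF.
pose G z := ps z / z ^+ k * cexp (lam * (D z / z ^+ m.+2)).
have hG z : z != 0 -> holo G z.
  move=> zn; apply: holoM; first exact: holo_divX.
  apply: (@holo_cexp _ (fun z => lam * (D z / z ^+ m.+2))).
  by apply: holoM; [exact: holo_cst|exact: holo_divX].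
have GL : lim0 G (L * cexp (lam * cm)).
  apply: lim0M => //; apply: (@lim0_comp _ cexp).
    by apply: lim0M => //; exact: lim0_cst.
  exact: (has_cder_cts (has_cder_cexp _)).
have bound z : s <= normc z <= 2 * s -> normc (G z) <= B * expR ((5 / 2 + normc c1) * s ^+ 2).
  move=> /andP[z1 z2]; have nz : 0 < normc z by exact: lt_le_trans z1.
  have nz1 : 1 <= normc z by exact: le_trans z1.
  set X := normc (phi z - phi0).
  have X0 : 0 <= X by exact: normc_ge0.
  have zm : s ^+ m.+2 <= normc z ^+ m.+2 by apply: lerXn2r; rewrite ?nnegrE ?normc_ge0 // ltW.
  have zm' : s ^+ m.+1 <= normc z ^+ m.+1 by apply: lerXn2r; rewrite ?nnegrE ?normc_ge0 // ltW.
  have sm0 n : 0 < s ^+ n by rewrite exprn_gt0.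
  have ex : Re (lam * (D z / z ^+ m.+2)) <= X ^+ 2 / 2 + s ^+ 2 / 2 + normc c1 * s ^+ 2.
    apply: le_trans (ler_norm _) _; apply: le_trans (Re_le_normc _) _.
    rewrite Normc.normcM nlam Normc.normcM Normc.normcV normcX.
    have dz : normc (D z) <= X + normc c1 * normc z.
      by rewrite /D opprD addrA addrAC; apply: le_trans (ler_normcB _ _) _; rewrite Normc.normcM.
    apply: (@le_trans _ _ (s ^+ m.+3 * ((X + normc c1 * normc z) / normc z ^+ m.+2))).
      by rewrite ler_pM2l // ler_pM2r // invr_gt0 exprn_gt0.
    rewrite mulrDl mulrDr; apply: lerD.
      apply: (@le_trans _ _ (s * X)); last by have := sqr_ge0 (X - s); clear; nra.
      rewrite mulrCA [s * X]mulrC ler_wpM2l // ler_pdivrMr ?exprn_gt0 //.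
      by rewrite [s ^+ m.+3]exprS ler_pM2l.
    have r0 : 0 < normc z ^+ m.+1 by rewrite exprn_gt0.
    have -> : s ^+ m.+3 = s ^+ 2 * s ^+ m.+1 by rewrite -exprD.
    have -> : normc z ^+ m.+2 = normc z * normc z ^+ m.+1 by rewrite exprS.
    have -> : s ^+ 2 * s ^+ m.+1 * (normc c1 * normc z / (normc z * normc z ^+ m.+1)) =
        normc c1 * s ^+ 2 * (s ^+ m.+1 / normc z ^+ m.+1) by field; rewrite !gt_eqF.
    apply: ler_piMr; first by rewrite mulr_ge0 ?normc_ge0 ?sqr_ge0.
    by rewrite ler_pdivrMr // mul1r.
  rewrite /G Normc.normcM normc_cexp Normc.normcM Normc.normcV normcX.
  have zk : (normc z ^+ k)^-1 <= 1 by rewrite invf_le1 ?exprn_gt0 // exprn_ege1.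
  apply: (@le_trans _ _ (normc (ps z) * 1 * expR (X ^+ 2 / 2 + s ^+ 2 / 2 + normc c1 * s ^+ 2))).
    apply: ler_pM; rewrite ?mulr_ge0 ?normc_ge0 ?invr_ge0 ?exprn_ge0 ?expR_ge0 ?normc_ge0 //.
      by rewrite ler_wpM2l ?normc_ge0.
    by rewrite ler_expR.
  rewrite mulr1 -addrA expRD mulrA.
  apply: le_trans (ler_wpM2r (expR_ge0 _) (Hps z)) _.
  rewrite -mulrA ler_wpM2l // -expRD ler_expR.
  have : normc z ^+ 2 <= (2 * s) ^+ 2 by apply: lerXn2r; rewrite ?nnegrE ?normc_ge0 ?mulr_ge0 // ltW.
  by rewrite exprMn; clear; lra.
have := lim0_le_boundary hG GL s0 bound.
rewrite Normc.normcM normc_cexp lamc mulrA => H; apply: le_trans H.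
rewrite ler_pM2l // ler_expR; apply: ler_wpM2l; first exact: ltW.
by rewrite -[m.+3]/(3 + m)%N exprD ler_peMr ?exprn_ege1 // exprn_ge0 // ltW.
Qed.

End Kernels.

(** * Affine symbols *)

Section AffineSymbols.
Context {R : realType}.
Local Notation C := R[i].
Implicit Types (f g psi phi : C -> C) (p q : R).

Lemma mul_conj_normc (z : C) : conjc z * z = Complex (normc z ^+ 2) 0.
Proof.
by rewrite sqr_normc; case: z => a b; apply/eqP; rewrite eq_complex /=; apply/andP; split; apply/eqP; ring.
Qed.

(** The multiplier, unique up to a constant, that makes [z |-> a z + b] with
    [|a| = 1] an admissible symbol. *)
Definition rigid_psi (a b : C) (z : C) : C := cexp (- (conjc b * a * z)).

Lemma entire_rigid_psi a b : entire (rigid_psi a b).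
Proof.
have e := entire_affine (- (conjc b * a)) 0; have := entire_cexp e; rewrite /rigid_psi.
by under eq_fun do rewrite addr0 mulNr.
Qed.

(** Multiplying [psi] by the exponential that cancels the cross term of
    [|a z + b|^2] turns the growth bound into a bound by a multiple of
    [exp ((1 - |a|^2) |z|^2 / 2)], to which Liouville's theorem applies. *)
Lemma growth_symbol psi (a b : C) (B : R) : entire psi -> psi <> (fun=> 0) ->
  (forall z, normc (psi z) * expR (normc (a * z + b) ^+ 2 / 2) <= B * expR (normc z ^+ 2 / 2)) ->
  normc a < 1 \/ normc a = 1 /\ psi = (fun z => psi 0 * rigid_psi a b z).
Proof.
move=> epsi psi0 HB; have [a1|a1] := ltP (normc a) 1; [by left|right].
pose h z := psi z * cexp (conjc b * a * z).
have eh : entire h.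
  have e := entire_affine (conjc b * a) 0.
  have := entireM epsi (entire_cexp e); rewrite /h.
  by under eq_fun do rewrite addr0.
have hB z : normc (h z) * expR (normc a ^+ 2 * normc z ^+ 2 / 2) <= B * expR (normc z ^+ 2 / 2).
  apply: le_trans (HB z); rewrite /h Normc.normcM normc_cexp -mulrA ler_wpM2l ?normc_ge0 //.
  rewrite -expRD ler_expR [a * z + b]addrC sqr_normcD Normc.normcM exprMn mulrA.
  by have := sqr_ge0 (normc b); clear; lra.
have B0 : 0 <= B.
  have := HB 0; rewrite Normc.normc0 expr0n mul0r expR0 mulr1; apply: le_trans.
  by rewrite mulr_ge0 ?normc_ge0 ?expR_ge0.
have hB' z : normc (h z) <= B.
  have := hB z; have : expR (normc z ^+ 2 / 2) <= expR (normc a ^+ 2 * normc z ^+ 2 / 2).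
    by rewrite ler_expR ler_pM2r // ler_peMl ?sqr_ge0 // exprn_ege1.
  move=> h1 h2; have E0 := expR_gt0 (normc z ^+ 2 / 2).
  rewrite -(ler_pM2r E0); apply: le_trans h2; rewrite ler_wpM2l ?normc_ge0 //.
have hc z : h z = psi 0.
  have -> : h z = h 0 by apply: (liouville eh hB').
  by rewrite /h mulr0 cexp0 mulr1.
have psiE z : psi z = psi 0 * rigid_psi a b z.
  rewrite -(hc z) /h /rigid_psi -mulrA -cexpD addrN cexp0 mulr1 //.
split; last by apply/funext.
apply/eqP; rewrite eq_le a1 andbT leNgt; apply/negP => a2.
have psi00 : 0 < normc (psi 0).
  rewrite normc_gt0; apply: contra_notN psi0 => /eqP z0; apply/funext => z.
  by rewrite psiE z0 mul0r.
have [k kE] : exists k, k = (normc a ^+ 2 - 1) / 2 by eexists.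
have k0 : 0 < k by rewrite kE divr_gt0 // subr_gt0 exprn_egt1.
have kB (x : R) : normc (psi 0) * expR (k * x ^+ 2) <= B.
  have := hB (Complex x 0); rewrite hc normcC real_normK ?num_real //.
  have E0 := expR_gt0 (x ^+ 2 / 2).
  move=> H; rewrite -(ler_pM2r E0); apply: le_trans H.
  by rewrite -[leLHS]mulrA -expRD ler_pM2l // ler_expR kE; clear; lra.
by apply: (@gaussian_unbounded _ (normc (psi 0)) k B 0 psi00 k0) => x _; exact: kB.
Qed.

End AffineSymbols.

(** * Rigid motions and inclusions between Fock spaces *)

Section RigidMotions.
Context {R : realType}.
Local Notation C := R[i].
Implicit Types (f g psi phi : C -> C) (p q : R).

Lemma fock_weightZ q (k : C) f z :
  fock_weight q (fun w => k * f w) z = normc k `^ q * fock_weight q f z.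
Proof.
by rewrite /fock_weight Normc.normcM powRM ?normc_ge0 // mulrA.
Qed.

Lemma cmeas_fock_weight_entire q f : entire f -> cmeas (fock_weight q f).
Proof.
by move=> ef; apply: cmeas_fock_weight => z; exact: (entire_cts ef).
Qed.

Lemma aint_fock_weightZ q (k : C) f : entire f ->
  aint (fock_weight q (fun w => k * f w)) = ((normc k `^ q)%:E * aint (fock_weight q f))%E.
Proof.
move=> ef; have m := cmeas_fock_weight_entire q ef.
rewrite -(aintZ m (fock_weight_ge0 q f) (powR_ge0 _ _)).
by congr (aint _); apply/funext => z; exact: fock_weightZ.
Qed.

Lemma rigid_weight q (a b : C) f z : normc a = 1 ->
  fock_weight q (fun w => rigid_psi a b w * f (a * w + b)) z =
  expR (q * normc b ^+ 2 / 2) * fock_weight q f (a * z + b).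
Proof.
move=> a1; rewrite /fock_weight Normc.normcM powRM ?normc_ge0 // normc_cexp -expRM.
rewrite mulrAC -expRD [RHS]mulrCA -expRD [RHS]mulrC; congr (expR _ * _).
rewrite [a * z + b]addrC sqr_normcD Normc.normcM a1 mul1r -mulrA.
by case: (conjc b * (a * z)) => u v /=; field.
Qed.

(** The map [w = a z + b] preserves area, and the multiplier [rigid_psi a b]
    turns the weight at [z] into the weight at [a z + b]: the operator is a
    multiple of an isometry, whatever the exponent. *)
Lemma aint_rigid_weight q (a b : C) f : normc a = 1 -> entire f ->
  aint (fock_weight q (fun w => rigid_psi a b w * f (a * w + b))) =
  ((expR (q * normc b ^+ 2 / 2))%:E * aint (fock_weight q f))%E.
Proof.
move=> a1 ef; have mf := cmeas_fock_weight_entire q ef.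
have [m1 e1] := aint_rigid b mf (fock_weight_ge0 q f) a1.
rewrite -e1 -(aintZ m1 (fun z => fock_weight_ge0 q f (a * z + b)) (expR_ge0 _)).
by congr (aint _); apply/funext => z; exact: rigid_weight.
Qed.

(** An entire function whose weighted modulus decays slowly in one direction
    as [c] tends to 1. *)
Definition gauss (c l : R) (z : C) : C := Complex l 0 * cexp (Complex (c / 2) 0 * (z * z)).

Lemma entire_gauss c l : entire (gauss c l).
Proof.
have e := entireM (entire_cst (Complex (c / 2) 0)) (entireM entire_id entire_id).
exact: (entireM (entire_cst (Complex l 0)) (entire_cexp e)).
Qed.

Lemma aint_gauss p (c l : R) : 0 < p -> 0 <= l -> 0 <= c < 1 ->
  aint (fock_weight p (gauss c l)) = (l `^ p * (2 * pi / p / Num.sqrt (1 - c ^+ 2)))%:E.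
Proof.
move=> p0 l0 /andP[c0 c1]; have c1' : 0 < 1 - c by rewrite subr_gt0.
have c2 : 0 < 1 + c by rewrite ltr_pwDl.
have e := entireM (entire_cst (Complex (c / 2) 0)) (entireM entire_id entire_id).
rewrite /gauss aint_fock_weightZ; last exact: (entire_cexp e).
rewrite normcC ger0_norm // EFinM; congr (_ * _)%E.
have := @aint_gaussian R (p * (1 - c)) (p * (1 + c)) 0 0.
rewrite !mulr_gt0 // => /(_ isT isT) G.
rewrite (_ : fock_weight _ _ = fun z : C => expR (- (p * (1 - c) * (Re z - 0) ^+ 2 / 2) - p * (1 + c) * (Im z - 0) ^+ 2 / 2)).
  rewrite G; congr (_%:E); rewrite -sqrtrM; last by rewrite divr_ge0 ?mulr_ge0 ?pi_ge0 // ltW // mulr_gt0.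
  have -> : 2 * pi / (p * (1 - c)) * (2 * pi / (p * (1 + c))) = (2 * pi / p) ^+ 2 * (1 - c ^+ 2)^-1.
    have c3 : 0 < 1 - c ^+ 2 by rewrite subr_gt0 expr_lt1.
    field; rewrite !gt_eqF //=.
  rewrite sqrtrM ?sqr_ge0 // sqrtr_sqr ger0_norm; last by rewrite divr_ge0 ?mulr_ge0 ?pi_ge0 // ltW.
  by rewrite sqrtrV // subr_ge0 expr_le1 // ltW.
apply/funext => z; rewrite /fock_weight normc_cexp -expRM -expRD; congr expR.
by rewrite sqr_normc; case: z => x y /=; field.
Qed.

(** The norm of [gauss c l] in [F^p] is governed by [(1 - c^2)^(-1/(2p))].
    Normalized in [F^p], these functions are unbounded in [F^q] for [q < p]
    as [c] tends to 1. *)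
Lemma fock_no_inclusion p q (M : R) : 0 < q -> q < p ->
  ~ op_le q (fun u : fock p => \val u) M.
Proof.
move=> q0 qp H; have p0 : 0 < p by exact: lt_trans qp.
pose e := 1 - q / p; have e0 : 0 < e by rewrite subr_gt0 ltr_pdivrMr // mul1r.
have k0 : 0 < 2 * pi / q by rewrite divr_gt0 ?mulr_gt0 ?pi_gt0.
(* Here [c = sqrt (1 - s^2)], so that the area integral of the weight is
   proportional to [l^p / s]. *)
have key s : 0 < s -> s <= 1 -> s `^ (- e) * (2 * pi / q) <= M.
  move=> s0 s1; pose c := Num.sqrt (1 - s ^+ 2).
  have s2 : 0 <= 1 - s ^+ 2 by rewrite subr_ge0 expr_le1 // ltW.
  have c2 : c ^+ 2 = 1 - s ^+ 2 by rewrite sqr_sqrtr.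
  have c01 : 0 <= c < 1.
    by rewrite sqrtr_ge0 /= -[ltRHS]sqrtr1 ltr_sqrt // gtrBl exprn_gt0.
  have sE : Num.sqrt (1 - c ^+ 2) = s.
    by rewrite c2 opprB addrC subrK sqrtr_sqr ger0_norm // ltW.
  pose l := s `^ p^-1; have l0 : 0 <= l by exact: powR_ge0.
  have lp : l `^ p = s by rewrite /l -powRrM mulVf ?gt_eqF // powRr1 // ltW.
  have w1 : aint (fock_weight p (gauss c l)) = (2 * pi / p)%:E.
    by rewrite aint_gauss // sE lp mulrCA mulfV ?mulr1 // gt_eqF.
  have gf : fock p (gauss c l).
    by apply/fockP => //; split; [exact: entire_gauss|exists (2 * pi / p); rewrite w1].
  have := H (SigSub (mem_set gf)); rewrite /= w1 => /(_ (lexx _)).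
  rewrite aint_gauss // sE lee_fin; apply: le_trans.
  rewrite [leRHS]mulrCA [leRHS]mulrC ler_wpM2r // ?(ltW k0) //.
  rewrite /l -powRrM -[s^-1]powR_inv1 ?(ltW s0) // -powRD; last by rewrite (gt_eqF s0) implybT.
  by rewrite /e opprB [p^-1 * _]mulrC.
(* The bound is violated by [s = X^(-1/e)]. *)
pose X := `|M| / (2 * pi / q) + 1.
have X1 : 1 <= X by rewrite lerDr divr_ge0 // ltW.
have X0 : 0 < X by exact: lt_le_trans X1.
have := key (X `^ (- e^-1)); rewrite powR_gt0 // -powRrM mulNr mulrN opprK mulVf ?gt_eqF // powRr1 ?(ltW X0) //.
rewrite -ler_pdivlMr // => /(_ isT) K.
have : X <= M / (2 * pi / q).
  apply: K; rewrite powRN invf_le1 ?powR_gt0 //.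
  have ei : 0 <= e^-1 by rewrite invr_ge0 ltW.
  by have := ge0_ler_powR ei (ler01 : 1 \is Num.nneg) (ltW X0) X1; rewrite powR1.
have : M / (2 * pi / q) <= `|M| / (2 * pi / q) by rewrite ler_pM2r ?invr_gt0 // ler_norm.
by rewrite /X; clear; lra.
Qed.

End RigidMotions.

(** * Bounded operators and their dependence on the symbols *)

Section BoundedOperators.
Context {R : realType}.
Local Notation C := R[i].
Implicit Types (f g psi phi : C -> C) (p q : R).

Lemma val_fock p (u : fock p) : fock p (\val u).
Proof.
exact: set_valP.
Qed.

Lemma fock_scale p (u : fock p) : 0 < p -> exists2 l : R, 0 < l &
  exists2 v : fock p, \val v = (fun z => Complex l 0 * \val u z) &
    (aint (fock_weight p (\val v)) <= (2 * pi / p)%:E)%E.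
Proof.
move=> p0; have [eu [A uA]] := (fockP _ p0).1 (val_fock u).
have A0 : 0 <= A by rewrite -lee_fin; apply: le_trans uA; exact: fock_weight_aint_ge0.
have k0 : 0 < 2 * pi / p by rewrite divr_gt0 ?mulr_gt0 ?pi_gt0.
have A1 : 0 < A + 1 by rewrite ltr_wpDl.
pose l := ((2 * pi / p) / (A + 1)) `^ p^-1.
have l0 : 0 < l by apply: powR_gt0; exact: divr_gt0.
have lp : l `^ p = (2 * pi / p) / (A + 1).
  rewrite /l -powRrM mulVf ?gt_eqF // powRr1 //; apply: ltW; exact: divr_gt0.
pose f z := Complex l 0 * \val u z.
have fA : (aint (fock_weight p f) <= (2 * pi / p)%:E)%E.
  rewrite aint_fock_weightZ // normcC gtr0_norm // lp.
  apply: le_trans (lee_wpmul2l _ uA) _; first by rewrite lee_fin divr_ge0 // ltW.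
  by rewrite -EFinM lee_fin [leLHS]mulrAC ler_pdivrMr // ler_wpM2l ?(ltW k0) // lerDl.
have ff : fock p f.
  have ef : entire f := entireM (entire_cst (Complex l 0)) eu.
  by apply/(fockP _ p0); split; [exact: ef|exists (2 * pi / p); exact: fA].
exists l; first exact: l0.
exists (SigSub (mem_set ff)); [reflexivity|exact: fA].
Qed.

(** A finite bound on the unit ball also puts the images of all the elements
    in the target space, by homogeneity. *)
Lemma bounded_wcompP p q psi phi : 0 < p -> 0 < q -> entire psi -> entire phi ->
  bounded_op q (wcomp psi phi : fock p -> C -> C) <->
  exists2 M : R, 0 <= M & op_le q (wcomp psi phi : fock p -> C -> C) M.
Proof.
move=> p0 q0 epsi ephi; split=> [[_]|TM]; first by move/op_norm_lty; apply.
split; last exact/op_norm_lty.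
case: TM => M M0 TM u; have eT := @entire_wcomp _ p psi phi u epsi ephi.
apply/fockP => //; split=> //.
have [l l0 [v vE v1]] := fock_scale u p0.
have := TM v v1.
rewrite (_ : wcomp psi phi v = fun z => Complex l 0 * wcomp psi phi u z); last first.
  by apply/funext => z; rewrite /wcomp vE mulrCA.
rewrite aint_fock_weightZ // normcC gtr0_norm // => H.
by exists (M / l `^ q); rewrite EFinM lee_pdivlMr ?powR_gt0 // muleC.
Qed.

Lemma op_le_scale p q (T : fock p -> C -> C) (k : C) (M : R) : (forall u, entire (T u)) ->
  op_le q T M -> op_le q (fun u z => k * T u z) (normc k `^ q * M).
Proof.
move=> eT TM u u1; rewrite aint_fock_weightZ // EFinM; apply: lee_wpmul2l (TM u u1).
by rewrite lee_fin powR_ge0.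
Qed.

(** The bound [(x + y)^q <= 2^q (x^q + y^q)] holds for every [q > 0], so that no
    distinction between [q < 1] and [q >= 1] arises. *)
Lemma op_le_sub p q (S T : fock p -> C -> C) (M N : R) : 0 < q ->
  (forall u, entire (S u)) -> (forall u, entire (T u)) -> op_le q S M -> op_le q T N ->
  op_le q (fun u z => S u z - T u z) (2 `^ q * (M + N)).
Proof.
move=> q0 eS eT SM TN u u1.
have mS := cmeas_fock_weight_entire q (eS u); have mT := cmeas_fock_weight_entire q (eT u).
have ST0 z : 0 <= fock_weight q (S u) z + fock_weight q (T u) z.
  by rewrite addr_ge0 ?fock_weight_ge0.
apply: (@le_trans _ _ (aint (fun z => 2 `^ q * (fock_weight q (S u) z + fock_weight q (T u) z)))).
  apply: le_aint.
  - exact: (cmeas_fock_weight_entire q (entireB (eS u) (eT u))).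
  - by apply: cmeasM; [exact: cmeas_cst|exact: cmeasD].
  - by move=> z; exact: fock_weight_ge0.
  move=> z; rewrite /fock_weight -mulrDl mulrA ler_wpM2r ?expR_ge0 //.
  have x0 := normc_ge0 (S u z); have y0 := normc_ge0 (T u z).
  have h : normc (S u z - T u z) <= 2 * Num.max (normc (S u z)) (normc (T u z)).
    apply: le_trans (ler_normcB _ _) _; rewrite mulr2n mulrDl !mul1r lerD // le_max lexx ?orbT //.
  have m0 : 0 <= Num.max (normc (S u z)) (normc (T u z)) by rewrite le_max x0.
  have m2 : 0 <= 2 * Num.max (normc (S u z)) (normc (T u z)) by rewrite mulr_ge0.
  apply: (le_trans (ge0_ler_powR (ltW q0) (normc_ge0 _ : _ \is Num.nneg) (m2 : _ \is Num.nneg) h)).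
  rewrite powRM // ler_wpM2l ?powR_ge0 //.
  by case: (leP (normc (S u z)) (normc (T u z))) => _; rewrite ?lerDl ?lerDr powR_ge0.
rewrite aintZ ?powR_ge0 //; last exact: cmeasD.
rewrite aintD //; try by move=> z; exact: fock_weight_ge0.
rewrite EFinM EFinD; apply: lee_wpmul2l; first by rewrite lee_fin powR_ge0.
by apply: leeD; [exact: SM|exact: TN].
Qed.

(** When [|a| < 1] the Gaussian in [|a z + b| + k] grows strictly slower than
    the weight decays. *)
Lemma aint_contraction_bound q (a b : C) (k : R) : 0 < q -> normc a < 1 -> 0 <= k ->
  exists2 J : R, 0 <= J & forall g (T : R), (forall z, cts g z) -> 0 <= T ->
    (forall z, normc (g z) <= T * expR ((normc (a * z + b) + k) ^+ 2 / 2)) ->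
    (aint (fock_weight q g) <= (T `^ q * J)%:E)%E.
Proof.
move=> q0 a1 k0.
have [K HK] := @affine_square_le R (normc a) (normc b + k) (normc_ge0 a) a1 (addr_ge0 (normc_ge0 b) k0).
have g1 : (1 + normc a ^+ 2) / 2 < 1.
  rewrite ltr_pdivrMr // mul1r -[2]/(1 + 1) ltrD2l expr_lt1 ?normc_ge0 //.
exists (expR (q * (K / 2)) * (2 * pi / (q * (1 - (1 + normc a ^+ 2) / 2)))).
  by rewrite mulr_ge0 ?expR_ge0 // divr_ge0 ?mulr_ge0 ?pi_ge0 ?subr_ge0 // ltW.
move=> g T gc T0 gT; apply: aint_fock_weight_gaussian_le => // z.
apply: le_trans (gT z) _; rewrite ler_wpM2l // ler_expR.
have := HK _ (normc_ge0 z); have : (normc (a * z + b) + k) ^+ 2 <= (normc a * normc z + (normc b + k)) ^+ 2.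
  apply: lerXn2r; rewrite ?nnegrE ?addr_ge0 ?mulr_ge0 ?normc_ge0 //.
  by rewrite addrA lerD2r; apply: le_trans (le_normcD _ _) _; rewrite Normc.normcM.
by clear; lra.
Qed.

Lemma fock_unit_pointwise p : 0 < p -> exists2 K : R, 0 <= K & forall u : fock p,
  (aint (fock_weight p (\val u)) <= (2 * pi / p)%:E)%E ->
  forall z, normc (\val u z) <= K * expR (normc z ^+ 2 / 2).
Proof.
move=> p0; have [K K0 HK] := fock_pointwise_root p0.
by exists ((K * (2 * pi / p)) `^ p^-1) => [|u u1 z]; [exact: powR_ge0|apply: HK => //; exact: val_entire].
Qed.

Lemma comp_contraction_bounded p q (a b : C) : 0 < p -> 0 < q -> normc a < 1 ->
  exists2 M : R, 0 <= M & op_le q (wcomp (fun=> 1) (fun z => a * z + b) : fock p -> C -> C) M.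
Proof.
move=> p0 q0 a1; have [K K0 HK] := fock_unit_pointwise p0.
have [J J0 HJ] := aint_contraction_bound b q0 a1 (lexx 0).
exists (K `^ q * J) => [|u u1]; first by rewrite mulr_ge0 ?powR_ge0.
apply: HJ => // z.
  apply: (entire_cts _ z); apply: entire_wcomp; [exact: (entire_cst 1)|exact: entire_affine].
by rewrite /wcomp mul1r addr0; exact: HK.
Qed.

(** Shrinking the symbol to 0 along [t phi] is a Lipschitz motion of the
    composition operator: the derivative of a unit vector of [F^p] is
    controlled by a Gaussian with the natural exponent, hence absorbed when
    [|a| < 1]. *)
Lemma comp_contraction_lipschitz p q (a b : C) : 0 < p -> 0 < q -> normc a < 1 ->
  exists2 J : R, 0 <= J & forall s t : R, 0 <= s <= 1 -> 0 <= t <= 1 ->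
    op_le q (fun (u : fock p) z => wcomp (fun=> 1) (fun z => Complex s 0 * (a * z + b)) u z -
       wcomp (fun=> 1) (fun z => Complex t 0 * (a * z + b)) u z) (`|s - t| `^ q * J).
Proof.
move=> p0 q0 a1; have [K K0 HK] := fock_unit_pointwise p0.
have [J J0 HJ] := aint_contraction_bound b q0 a1 (ler0n R 3).
exists ((8 * K) `^ q * J) => [|s t /andP[s0 s1] /andP[t0 t1] u u1]; first by rewrite mulr_ge0 ?powR_ge0.
rewrite mulrA -powRM ?mulr_ge0 //.
have ew (r : R) : entire (wcomp (fun=> 1) (fun z => Complex r 0 * (a * z + b)) u).
  apply: entire_wcomp; first exact: (entire_cst 1).
  exact: (entireM (entire_cst (Complex r 0)) (entire_affine a b)).
apply: HJ => [z||z]; first exact: (entire_cts (entireB (ew s) (ew t)) z).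
  by rewrite !mulr_ge0.
rewrite /wcomp !mul1r; set v := a * z + b.
have rv (r : R) : 0 <= r -> r <= 1 -> normc (Complex r 0 * v) <= normc v.
  by move=> r0 r1; rewrite Normc.normcM normcC ger0_norm // ler_piMl ?normc_ge0.
apply: le_trans (fock_lipschitz (@val_entire _ p u) K0 (HK u u1) (rv s s0 s1) (rv t t0 t1)) _.
have -> : Complex s 0 * v - Complex t 0 * v = Complex (s - t) 0 * v.
  by rewrite -mulrBl; congr (_ * _); apply/eqP; rewrite eq_complex /= subrr !eqxx.
rewrite Normc.normcM normcC.
rewrite [leLHS](_ : _ = `|s - t| * (8 * K) * (normc v * expR ((normc v + 2) ^+ 2 / 2))); last by ring.
rewrite ler_wpM2l ?mulr_ge0 //.
have v0 := normc_ge0 v; move: (normc v) v0 => r r0.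
apply: (@le_trans _ _ (expR r * expR ((r + 2) ^+ 2 / 2))).
  by rewrite ler_wpM2r ?expR_ge0 // (le_trans _ (expR_ge1Dx r)) // lerDr.
by rewrite -expRD ler_expR; move: r0; clear; nra.
Qed.

End BoundedOperators.

(** * Classification of the bounded operators *)

Section Classification.
Context {R : realType}.
Local Notation C := R[i].
Implicit Types (f g psi phi : C -> C) (p q : R).

Lemma kern0E : kern 0 = (fun=> 1 : C).
Proof.
apply/funext => z; rewrite /kern Normc.normc0 expr0n mul0r.
rewrite (_ : conjc 0 * z - Complex 0 0 = 0) ?cexp0 //.
by rewrite conjc0 mul0r sub0r; apply/eqP; rewrite eq_complex /= oppr0 !eqxx.
Qed.

Lemma wcomp_kern0 p (p0 : 0 < p) psi phi : wcomp psi phi (fkern p0 0) = psi.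
Proof.
by apply/funext => z; rewrite /wcomp /= kern0E mulr1.
Qed.

(** The kernel centred at 0 is the constant 1, so that the multiplier is itself
    a value of the operator and lies in [F^q] automatically. *)
Lemma Cw_phiP p q phi (T : fock p -> C -> C) : 0 < p -> 0 < q -> entire phi ->
  Cw_phi p q phi T <-> exists2 psi, T = wcomp psi phi & [/\ entire psi, psi <> (fun=> 0) &
    exists2 M : R, 0 <= M & op_le q T M].
Proof.
move=> p0 q0 ephi; split=> [[psi [fpsi psi0 bT] <-]|[psi -> [epsi psi0 bT]]].
  have epsi : entire psi by case: fpsi.
  by exists psi => //; split=> //; apply/bounded_wcompP.
have bT' := (@bounded_wcompP _ p q psi phi p0 q0 epsi ephi).2 bT.
exists psi => //; split=> //.
by have := bT'.1 (fkern p0 0); rewrite wcomp_kern0.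
Qed.

Lemma Cw_phi_sub p q phi (T : fock p -> C -> C) : 0 < p -> 0 < q -> entire phi ->
  Cw_phi p q phi T -> Cw p q T.
Proof.
move=> p0 q0 ephi /(Cw_phiP _ p0 q0 ephi)[psi -> [epsi psi0 bT]].
split; [by exists psi, phi|exact/bounded_wcompP|].
move=> T0; apply: psi0; rewrite -(wcomp_kern0 p0 psi phi).
by rewrite T0.
Qed.

Definition aff (a b : C) : C -> C := fun z => a * z + b.

Lemma entire_aff a b : entire (aff a b).
Proof.
exact: (entire_affine a b).
Qed.

Lemma Cw_symbols p q (T : fock p -> C -> C) : 0 < p -> 0 < q -> Cw p q T ->
  exists a b, Cw_phi p q (aff a b) T /\ (normc a < 1 \/ normc a = 1).
Proof.
move=> p0 q0 [[psi [phi [epsi ephi ->]]] bT T0].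
have psi0 : psi <> (fun=> 0).
  by move=> z0; apply: T0; rewrite z0; apply/funext => u; apply/funext => z; rewrite /wcomp mul0r.
have /(bounded_wcompP p0 q0 epsi ephi)[M M0 TM] := bT.
have [B B0 HB] := wcomp_growth p0 q0 epsi ephi TM.
have [a [b phiE]] := growth_affine epsi ephi psi0 HB.
exists a, b; split.
  apply/(Cw_phiP _ p0 q0 (@entire_aff a b)).
  by exists psi; [rewrite phiE|split=> //; exists M].
move: HB; rewrite phiE => HB.
by have [|[]] := growth_symbol epsi psi0 HB; [left|right].
Qed.

Lemma rigid_symbolE p q (a b : C) psi (M : R) : 0 < p -> 0 < q -> normc a = 1 -> entire psi ->
  psi <> (fun=> 0) -> op_le q (wcomp psi (aff a b) : fock p -> C -> C) M ->
  psi 0 != 0 /\ psi = (fun z => psi 0 * rigid_psi a b z).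
Proof.
move=> p0 q0 a1 epsi psi0 TM.
have [B B0 HB] := wcomp_growth p0 q0 epsi (@entire_aff a b) TM.
have [|[_ psiE]] := growth_symbol epsi psi0 HB; first by rewrite a1 ltxx.
split=> //; apply: contra_notN psi0 => /eqP z0; rewrite psiE z0.
by apply/funext => z; rewrite mul0r.
Qed.

(** Up to a constant factor and an isometry such an operator is the inclusion of
    [F^p] in [F^q]. *)
Lemma rigid_no_small_exponent p q (a b : C) (T : fock p -> C -> C) : 0 < q -> q < p -> normc a = 1 ->
  ~ Cw_phi p q (aff a b) T.
Proof.
move=> q0 qp a1; have p0 : 0 < p by exact: lt_trans qp.
move=> /(Cw_phiP _ p0 q0 (@entire_aff a b))[psi TE [epsi psi0 [M M0]]].
rewrite TE => TM; have [n0 psiE] := rigid_symbolE p0 q0 a1 epsi psi0 TM.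
pose k := normc (psi 0) `^ q * expR (q * normc b ^+ 2 / 2).
have k0 : 0 < k by rewrite mulr_gt0 ?expR_gt0 // powR_gt0 // normc_gt0.
apply: (@fock_no_inclusion _ p q (M / k) q0 qp) => u u1.
have eu := @val_entire _ p u.
have e1 : entire (fun z => rigid_psi a b z * \val u (a * z + b)).
  exact: (entireM (@entire_rigid_psi _ a b) (entire_comp (entire_affine a b) eu)).
have := TM u u1.
rewrite (_ : wcomp psi (aff a b) u = fun z => psi 0 * (rigid_psi a b z * \val u (a * z + b))); last first.
  by apply/funext => z; rewrite /wcomp [in LHS]psiE mulrA.
rewrite aint_fock_weightZ // aint_rigid_weight // muleA -EFinM -/k.
by rewrite [(M / k)%:E]EFinM lee_pdivlMr // muleC.
Qed.

(** The pointwise estimate bounds the [q]-th power of the weighted modulus by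
    its [p]-th power, so that [F^p] is contained in [F^q] when [p <= q]. *)
Lemma fock_inclusion p q : 0 < p -> p <= q ->
  exists2 M : R, 0 <= M & op_le q (fun u : fock p => \val u) M.
Proof.
move=> p0 pq; have q0 : 0 < q by exact: lt_le_trans pq.
have [K K0 HK] := fock_unit_pointwise p0.
have k0 : 0 <= 2 * pi / p by rewrite divr_ge0 ?mulr_ge0 ?pi_ge0 // ltW.
exists (K `^ (q - p) * (2 * pi / p)) => [|u u1]; first by rewrite mulr_ge0 ?powR_ge0.
have mu := cmeas_fock_weight_entire p (@val_entire _ p u).
apply: (@le_trans _ _ ((K `^ (q - p))%:E * aint (fock_weight p (\val u)))%E); last first.
  by rewrite EFinM; apply: lee_wpmul2l u1; rewrite lee_fin powR_ge0.
rewrite -(aintZ mu (fock_weight_ge0 p (\val u)) (powR_ge0 K (q - p))).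
apply: le_aint => [|||z].
- exact: (cmeas_fock_weight_entire q (@val_entire _ p u)).
- by apply: cmeasM => //; exact: cmeas_cst.
- by move=> z; exact: fock_weight_ge0.
have weightE r : fock_weight r (\val u) z = (normc (\val u z) * expR (- (normc z ^+ 2 / 2))) `^ r.
  by rewrite /fock_weight powRM ?normc_ge0 ?expR_ge0 // -expRM; congr (_ * expR _); ring.
rewrite !weightE; set x := normc _ * _.
have x0 : 0 <= x by rewrite mulr_ge0 ?normc_ge0 ?expR_ge0.
have xK : x <= K by rewrite /x expRN ler_pdivrMr ?expR_gt0 // HK.
have -> : x `^ q = x `^ (q - p) * x `^ p.
  by rewrite -powRD subrK // (gt_eqF q0).
by rewrite ler_wpM2r ?powR_ge0 // ge0_ler_powR ?nnegrE ?subr_ge0.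
Qed.

Lemma rigid_nonempty p q (a b : C) : 0 < p -> p <= q -> normc a = 1 ->
  Cw_phi p q (aff a b) (wcomp (rigid_psi a b) (aff a b)).
Proof.
move=> p0 pq a1; have q0 : 0 < q by exact: lt_le_trans pq.
have [M M0 HM] := fock_inclusion p0 pq.
apply/(Cw_phiP _ p0 q0 (@entire_aff a b)).
exists (rigid_psi a b) => //; split; first exact: (@entire_rigid_psi _ a b).
  by move=> /(congr1 (fun f : C -> C => f 0)) /eqP; rewrite (negbTE (cexp_neq0 _)).
exists (expR (q * normc b ^+ 2 / 2) * M) => [|u u1]; first by rewrite mulr_ge0 ?expR_ge0.
rewrite [wcomp _ _ _](_ : _ = fun z => rigid_psi a b z * \val u (a * z + b)) //.
rewrite aint_rigid_weight //; last exact: (@val_entire _ p u).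
by rewrite EFinM; apply: lee_wpmul2l (HM u u1); rewrite lee_fin expR_ge0.
Qed.

Lemma contraction_nonempty p q (a b : C) : 0 < p -> 0 < q -> normc a < 1 ->
  Cw_phi p q (aff a b) (wcomp (fun=> 1) (aff a b)).
Proof.
move=> p0 q0 a1; apply/(Cw_phiP _ p0 q0 (@entire_aff a b)).
exists (fun=> 1) => //; split.
- exact: (entire_cst 1).
- by move=> /(congr1 (fun f : C -> C => f 0)) /eqP; rewrite oner_eq0.
- exact: comp_contraction_bounded.
Qed.

Lemma normrC (a : C) : `|a| = Complex (normc a) 0.
Proof.
by [].
Qed.

Lemma S0P phi : S0 phi <-> exists a b, normc a < 1 /\ phi = aff a b.
Proof.
by split=> -[a [b [a1 ->]]]; exists a, b; split=> //; move: a1; rewrite normrC ltcR.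
Qed.

Lemma S1P phi : S1 phi <-> exists a b, normc a = 1 /\ phi = aff a b.
Proof.
split=> -[a [b [a1 ->]]]; exists a, b; split=> //.
  by move: a1; rewrite normrC => -[].
by rewrite normrC a1.
Qed.

End Classification.

(** * Separation of symbols in the operator norm *)

Section Separation.
Context {R : realType}.
Local Notation C := R[i].
Implicit Types (f g psi phi : C -> C) (p q : R).

(** The constant of the pointwise estimate depends neither on the point nor on
    the kernel. *)
Lemma kern_test p q (p0 : 0 < p) (e : R) : 0 < q -> 0 < e -> exists2 d : R, 0 < d &
  forall T : fock p -> C -> C, (forall u, entire (T u)) -> op_le q T d ->
  forall w z, normc (T (fkern p0 w) z) <= e * expR (normc z ^+ 2 / 2).
Proof.
move=> q0 e0; have [K K0 HK] := @wcomp_kern_bound R q q0.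
exists (e `^ q / K) => [|T eT Td w z]; first by rewrite divr_gt0 // powR_gt0.
have := HK p p0 _ T w z eT Td.
by rewrite [K * _]mulrC divfK ?gt_eqF // -powRrM mulfV ?gt_eqF // powRr1 // ltW.
Qed.

Lemma entire_wcompB p psi phi psi' phi' (u : fock p) : entire psi -> entire phi ->
  entire psi' -> entire phi' -> entire (fun z => wcomp psi phi u z - wcomp psi' phi' u z).
Proof.
move=> e1 e2 e3 e4.
exact: (entireB (@entire_wcomp _ p psi phi u e1 e2) (@entire_wcomp _ p psi' phi' u e3 e4)).
Qed.

Lemma normc_kern_le (w x : C) : normc (kern w x) <= expR (normc x ^+ 2 / 2).
Proof.
rewrite normc_kern ler_expR !sqr_normc.
have := sqr_ge0 (Re w - Re x); have := sqr_ge0 (Im w - Im x); clear; lra.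
Qed.

(** The kernel centred at 0 bounds the difference of the multipliers at [z]; the
    kernel centred at [phi z - phi' z] then detects the difference of the
    symbols. Neither bound involves the first multiplier. *)
Lemma wcomp_separated p q phi psi' phi' z : 0 < p -> 0 < q -> entire phi -> entire psi' -> entire phi' ->
  psi' z != 0 -> phi z != phi' z -> exists2 d : R, 0 < d & forall psi, entire psi ->
  ~ op_le q (fun (u : fock p) z => wcomp psi phi u z - wcomp psi' phi' u z) d.
Proof.
move=> p0 q0 ephi epsi' ephi' n0 pne.
(* With this centre the two values of the kernel have different moduli. *)
pose w := phi z - phi' z.
have wn : 0 < normc w by rewrite normc_gt0 subr_eq0.
have kne : kern w (phi z) - kern w (phi' z) != 0.
  rewrite subr_eq0; apply/eqP => /(congr1 (@Normc.normc R)); rewrite !normc_kern => /expR_inj H.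
  have key (u v : C) (k : R) : Re (u - v) * Re u + Im (u - v) * Im u - k =
      Re (u - v) * Re v + Im (u - v) * Im v - k -> normc (u - v) ^+ 2 = 0.
    by rewrite sqr_normc; case: u v => [x y] [x' y'] /=; clear; lra.
  have := key _ _ _ H; rewrite -/w.
  by apply/eqP; rewrite expf_eq0 gt_eqF.
pose E := expR (normc z ^+ 2 / 2).
have E0 : 0 < E by exact: expR_gt0.
pose c := normc (psi' z) * normc (kern w (phi z) - kern w (phi' z)).
have c0 : 0 < c by rewrite mulr_gt0 ?normc_gt0.
pose F := 1 + expR (normc (phi z) ^+ 2 / 2).
have F0 : 0 < F by rewrite addr_gt0 // expR_gt0.
have e0 : 0 < c / (2 * E * F) by rewrite divr_gt0 // !mulr_gt0.
have [d d0 Hd] := kern_test p0 q0 e0.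
exists d => // psi epsi Td.
have := Hd _ (fun u => @entire_wcompB p psi phi psi' phi' u epsi ephi epsi' ephi') Td.
move=> H; have h0 := H 0 z; have hw := H w z; move: h0 hw.
rewrite /wcomp /= kern0E !mulr1 -/E.
set e := c / _ * E => h0 hw.
have eE : e * (2 * F) = c by rewrite /e; field; rewrite !gt_eqF.
have : c <= e * F.
  rewrite /F [e * _]mulrDr mulr1 /c -Normc.normcM.
  have -> : psi' z * (kern w (phi z) - kern w (phi' z)) =
    (psi z * kern w (phi z) - psi' z * kern w (phi' z)) - (psi z - psi' z) * kern w (phi z) by ring.
  apply: le_trans (ler_normcB _ _) _; apply: lerD => //.
  rewrite Normc.normcM; apply: ler_pM; rewrite ?normc_ge0 //; exact: normc_kern_le.
have e1 : 0 < e by rewrite /e mulr_gt0.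
move: (e) (F) (c) e1 F0 eE => x y t x0 y0 <-; clear -x0 y0.
by rewrite leNgt => /negP; apply; rewrite mulrCA ltr_pMl ?mulr_gt0 // ltr1n.
Qed.

Lemma normc_rigid_kern (a b z : C) : normc a = 1 ->
  normc (rigid_psi a b z * kern (aff a b z) (aff a b z)) =
  expR (normc b ^+ 2 / 2) * expR (normc z ^+ 2 / 2).
Proof.
move=> a1; rewrite Normc.normcM normc_kern /rigid_psi normc_cexp -!expRD; congr expR.
rewrite -!expr2 -sqr_normc /aff [a * z + b]addrC sqr_normcD Normc.normcM a1 mul1r.
by rewrite -[conjc b * a * z]mulrA; case: (conjc b * (a * z)) => u v /=; field.
Qed.

Lemma growth_kern psi phi (B : R) (x z : C) :
  (forall z, normc (psi z) * expR (normc (phi z) ^+ 2 / 2) <= B * expR (normc z ^+ 2 / 2)) ->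
  normc (psi z * kern x (phi z)) <=
  B * expR (normc z ^+ 2 / 2) * expR (- (normc (x - phi z) ^+ 2 / 2)).
Proof.
move=> HB; rewrite Normc.normcM normc_kern.
have -> : Re x * Re (phi z) + Im x * Im (phi z) - normc x ^+ 2 / 2 =
    normc (phi z) ^+ 2 / 2 - normc (x - phi z) ^+ 2 / 2.
  by rewrite !sqr_normc; case: x (phi z) => [? ?] [? ?] /=; field.
by rewrite expRD mulrA ler_wpM2r ?expR_ge0.
Qed.

Lemma rigid_kern_quotient (a b b' z : C) :
  rigid_psi a b' z * kern (aff a b z) (aff a b' z) =
  cexp (conjc b * (b' - b)) * cexp (conjc (a * z) * (b' - b) - conjc (b' - b) * (a * z)) *
  (rigid_psi a b z * kern (aff a b z) (aff a b z)).
Proof.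
rewrite /rigid_psi /kern -!cexpD; congr cexp.
by rewrite /aff !rmorphB !rmorphD !rmorphM /=; ring.
Qed.

(** The difference of the two maps takes every value. *)
Lemma affine_separate (a a' b b' : C) (c B : R) : a' != a -> 0 < c ->
  ~ forall z, c <= B * expR (- (normc (aff a b z - aff a' b' z) ^+ 2 / 2)).
Proof.
move=> aa c0 cB; have an : a - a' != 0 by rewrite subr_eq0 eq_sym.
apply: (@gaussian_unbounded _ c 2^-1 B 0 c0) => [|x _]; first by rewrite invr_gt0.
have zE : aff a b ((Complex x 0 - (b - b')) / (a - a')) -
    aff a' b' ((Complex x 0 - (b - b')) / (a - a')) = Complex x 0.
  by rewrite /aff; field.
have := cB ((Complex x 0 - (b - b')) / (a - a')).
by rewrite zE normcC real_normK ?num_real // expRN ler_pdivlMr ?expR_gt0 // [_ / 2]mulrC.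
Qed.

(** Along the line [a z = i t d] the unimodular factor by which two rigid
    motions with the same rotation differ runs through the whole circle. *)
Lemma rigid_phase_opposite (a d : C) : normc a = 1 -> d != 0 ->
  exists z, cexp (conjc (a * z) * d - conjc d * (a * z)) = -1.
Proof.
move=> a1 dn; pose tau : R := pi / (2 * normc d ^+ 2).
exists (conjc a * (Complex 0 tau * d)).
rewrite mulrA [a * _]mulrC mul_conj_normc a1 expr1n mul1r rmorphM /=.
have -> : conjc (Complex 0 tau) * conjc d * d - conjc d * (Complex 0 tau * d) = Complex 0 (- pi).
  rewrite -mulrA mul_conj_normc [conjc d * _]mulrCA mul_conj_normc.
  apply/eqP; rewrite eq_complex /=; apply/andP; split; apply/eqP; first by ring.
  by rewrite /tau; field; rewrite gt_eqF // normc_gt0.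
by rewrite /cexp /= expR0 cosN cospi sinN sinpi; apply/eqP; rewrite eq_complex /= !mul1r !oppr0 !eqxx.
Qed.

Lemma opposite_far (rho : C) : normc (rho - 1) <= 2^-1 -> normc (- rho - 1) <= 2^-1 -> False.
Proof.
move=> h1 h2; have : normc ((rho - 1) + (- rho - 1)) <= 2^-1 + 2^-1.
  by apply: le_trans (le_normcD _ _) _; exact: lerD.
rewrite (_ : _ + _ = Complex (- 2) 0); last first.
  by case: rho {h1 h2} => x y; apply/eqP; rewrite eq_complex /=; apply/andP; split; apply/eqP; ring.
by rewrite normcC normrN ger0_norm //; clear; lra.
Qed.

(** At the kernel centred at [phi z] the operator with a rigid symbol has at
    [z] a value of constant normalized modulus. For a competitor with another
    linear part this value tends to 0 as [z] goes to infinity; for a competitor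
    with the same linear part it is obtained from the first one by a factor
    which takes two opposite values. *)
Lemma rigid_separated p q (a b : C) psi : 0 < p -> 0 < q -> normc a = 1 -> entire psi ->
  psi <> (fun=> 0) -> (exists M, op_le q (wcomp psi (aff a b) : fock p -> C -> C) M) ->
  exists2 d : R, 0 < d & forall psi' a' b' M', entire psi' -> psi' <> (fun=> 0) ->
    op_le q (wcomp psi' (aff a' b') : fock p -> C -> C) M' ->
    op_le q (fun (u : fock p) z => wcomp psi' (aff a' b') u z - wcomp psi (aff a b) u z) d ->
    aff a' b' = aff a b.
Proof.
move=> p0 q0 a1 epsi psi0 [M TM].
have [n0 psiE] := rigid_symbolE p0 q0 a1 epsi psi0 TM.
pose c := normc (psi 0) * expR (normc b ^+ 2 / 2).
have c0 : 0 < c by rewrite mulr_gt0 ?expR_gt0 ?normc_gt0.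
have c20 : 0 < c / 2 by rewrite divr_gt0.
have [d d0 Hd] := kern_test p0 q0 c20.
exists d => // psi' a' b' M' epsi' psi0' TM' Td.
have H0 := Hd _ (fun u => @entire_wcompB p psi' (aff a' b') psi (aff a b) u
  epsi' (@entire_aff _ a' b') epsi (@entire_aff _ a b)) Td.
pose A z := psi z * kern (aff a b z) (aff a b z).
pose A' z := psi' z * kern (aff a b z) (aff a' b' z).
have H z : normc (A' z - A z) <= c / 2 * expR (normc z ^+ 2 / 2) by exact: (H0 (aff a b z) z).
have AE z : normc (A z) = c * expR (normc z ^+ 2 / 2).
  by rewrite /A [psi in LHS]psiE -mulrA Normc.normcM normc_rigid_kern // mulrA.
have [aa|aa] := eqVneq a' a; last first.
  exfalso; have [B B0 HB] := wcomp_growth p0 q0 epsi' (@entire_aff _ a' b') TM'.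
  apply: (@affine_separate a a' b b' (c / 2) B aa c20) => z.
  have E0 := expR_gt0 (normc z ^+ 2 / 2).
  have h2 := growth_kern (aff a b z) z HB.
  have := ler_normcB (A' z) (A' z - A z); rewrite subKr AE => h1.
  have h3 := le_trans h1 (lerD h2 (H z)).
  move: (expR (normc z ^+ 2 / 2)) (expR (- _)) E0 h3 => e1 e2 e10 h3.
  by rewrite -(ler_pM2r e10); clear -h3; lra.
have [bb|bb] := eqVneq b' b; first by rewrite aa bb.
exfalso; subst a'.
have [n0' psiE'] := rigid_symbolE p0 q0 a1 epsi' psi0' TM'.
pose dd := b' - b.
have dn : dd != 0 by rewrite subr_eq0.
pose rho := psi' 0 / psi 0 * cexp (conjc b * dd).
have A'A z : A' z = rho * cexp (conjc (a * z) * dd - conjc dd * (a * z)) * A z.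
  rewrite /A' [psi' in LHS]psiE' -mulrA rigid_kern_quotient /A [psi in RHS]psiE /rho.
  by rewrite -/dd; field.
have hz z (s : C) : cexp (conjc (a * z) * dd - conjc dd * (a * z)) = s -> normc (rho * s - 1) <= 2^-1.
  move=> sE; have := H z; rewrite A'A sE -[X in _ - X]mul1r -mulrBl Normc.normcM AE mulrA.
  by rewrite ler_pM2r ?expR_gt0 // [_ * c]mulrC ler_pM2l.
have [z1 E1] := rigid_phase_opposite a1 dn.
apply: (@opposite_far rho).
  by rewrite -[rho]mulr1; apply: (hz 0); rewrite !mulr0 conjc0 mul0r subrr cexp0.
by have := hz z1 _ E1; rewrite mulrN1.
Qed.

End Separation.

(** * Joining points of a topological space *)

Section PathRelation.
Context {R : realType} {X : topologicalType}.
Implicit Types (x y z : X) (g h : R -> X).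

Definition clamp (t : R) : R := Num.max 0 (Num.min 1 t).

Lemma clamp_itv t : `[0, 1]%classic (clamp t).
Proof.
by rewrite /= in_itv /= /clamp le_max lexx /= ge_max ler01 ge_min lexx.
Qed.

Lemma clamp_id t : 0 <= t <= 1 -> clamp t = t.
Proof.
by move=> /andP[t0 t1]; rewrite /clamp (min_idPr t1) (max_idPr t0).
Qed.

Lemma clamp_continuous : continuous clamp.
Proof.
move=> t; apply: (@continuous_max R R (cst 0) (fun t => Num.min 1 t)); first exact: cvg_cst.
by apply: (@continuous_min R R (cst 1) id); [exact: cvg_cst|exact: cvg_id].
Qed.

(** Paths parametrized by the whole line: composing with [clamp] loses nothing
    and avoids the topology induced on the unit interval. *)
Definition joined x y := exists g, [/\ continuous g, g 0 = x & g 1 = y].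

Lemma joinedP x y : @path_joined R X x y <-> joined x y.
Proof.
split=> -[g [gc g0 g1]]; last by exists g; split=> //; exact: continuous_subspaceT.
exists (g \o clamp); split; rewrite /= ?clamp_id ?lexx ?ler01 //.
move=> t U gU; move/subspace_continuousP: gc => /(_ _ (clamp_itv t)) /(_ U gU).
rewrite /within /= => /clamp_continuous H.
have H' : nbhs t (fun s => `[0, 1]%classic (clamp s) -> U (g (clamp s))) := H.
by apply: filterS H' => s; apply; exact: clamp_itv.
Qed.

Lemma joined_sym x y : joined x y -> joined y x.
Proof.
move=> [g [gc g0 g1]]; exists (fun t => g (1 - t)); rewrite subr0 subrr; split=> // t.
apply: (@continuous_comp _ _ _ (fun t : R => 1 - t) g); last exact: gc.
by apply: cvgB; [exact: cvg_cst|exact: cvg_id].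
Qed.

Lemma joined_trans y x z : joined x y -> joined y z -> joined x z.
Proof.
move=> [g [gc g0 g1]] [h [hc h0 h1]].
pose k t := if t <= 2^-1 then g (2 * t) else h (2 * t - 1).
have lc a b : continuous (fun t : R => a * t - b).
  by move=> t; apply: cvgB; [apply: cvgM; [exact: cvg_cst|exact: cvg_id]|exact: cvg_cst].
have gc' : continuous (fun t : R => g (2 * t)).
  move=> t; apply: (@continuous_comp _ _ _ (fun t : R => 2 * t) g); last exact: gc.
  by apply: cvgM; [exact: cvg_cst|exact: cvg_id].
have hc' : continuous (fun t : R => h (2 * t - 1)).
  by move=> t; apply: (@continuous_comp _ _ _ (fun t : R => 2 * t - 1) h); [exact: lc|exact: hc].
exists k; split; last 2 first.
- by rewrite /k mulr0 invr_ge0 ler0n.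
- by rewrite /k leNgt invf_lt1 ?ltr1n //= mulr1 -[2]/(1 + 1) addrK.
move=> t U kU; rewrite -[_ U]/(nbhs t (fun s => U (k s))); move: kU; rewrite /k.
have gU : nbhs (g (2 * t)) U -> nbhs t (fun s => U (g (2 * s))) := gc' t U.
have hU : nbhs (h (2 * t - 1)) U -> nbhs t (fun s => U (h (2 * s - 1))) := hc' t U.
case: (ltgtP t 2^-1) => t2 kU.
- by apply: filterS2 (gU kU) (lt_nbhsl t2) => s sU st; rewrite (ltW st).
- by apply: filterS2 (hU kU) (lt_nbhsr t2) => s sU st; rewrite leNgt st.
- have kU' : nbhs (h (2 * t - 1)) U by move: kU; rewrite t2 mulfV // g1 -h0 subrr.
  by apply: filterS2 (gU kU) (hU kU') => s sg sh; case: ifP.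
Qed.

(** The parameter interval is connected, so that a path cannot leave a clopen
    set. *)
Lemma joined_clopen (A : set X) x y : open A -> closed A -> joined x y -> A x -> A y.
Proof.
move=> oA cA [g [gc g0 g1]] Ax.
have c01 := @segment_connected R 0 1.
have : `[0, 1]%classic `&` (g @^-1` A) = `[0, 1]%classic.
  apply: c01.
  - by exists 0; split; rewrite /= ?in_itv /= ?lexx ?ler01 // g0.
  - by exists (g @^-1` A) => //; apply: open_comp => // t _; exact: gc.
  - by exists (g @^-1` A) => //; apply: preimage_closed => // t _; exact: gc.
move=> /seteqP[_ /(_ 1)]; rewrite /= in_itv /= lexx ler01 => /(_ isT) [_].
by rewrite g1.
Qed.

End PathRelation.

(** * Paths of operators *)

Section OperatorPaths.
Context {R : realType}.
Local Notation C := R[i].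
Implicit Types (f g psi phi : C -> C).
Variables (p q : R) (p0 : 0 < p) (q0 : 0 < q).
Implicit Types (x y : Cw_space p q) (T : fock p -> C -> C).

(** A Lipschitz family of operators is a path; the exponent [q] appears
    because [op_le] bounds the [q]-th power of the norm. *)
Lemma joined_holder (G : R -> fock p -> C -> C) (J : R) x y : 0 <= J ->
  (forall t, 0 <= t <= 1 -> Cw p q (G t)) ->
  (forall s t, 0 <= s <= 1 -> 0 <= t <= 1 ->
     op_le q (fun u z => G s u z - G t u z) (`|s - t| `^ q * J)) ->
  \val x = G 0 -> \val y = G 1 -> @joined R _ x y.
Proof.
move=> J0 GC GJ x0 y1.
have cl (t : R) : 0 <= clamp t <= 1 by have := clamp_itv t; rewrite /= in_itv.
exists (fun t => SigSub (mem_set (GC (clamp t) (cl t)))); split.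
- move=> t U; rewrite nbhsE => -[V [Vo Vt] VU].
  have [e e0 He] := (Vo : Cw_open V) _ Vt.
  have [d d0 Hd] := @op_le_op_dist_lt R p q e p0 q0 e0.
  have J1 : 0 < J + 1 by rewrite ltr_wpDl.
  have dJ : 0 < d / (J + 1) by rewrite divr_gt0.
  have [r rE] : exists r, r = (d / (J + 1)) `^ q^-1 by eexists.
  have r0 : 0 < r by rewrite rE powR_gt0.
  have rq : r `^ q = d / (J + 1) by rewrite rE -powRrM mulVf ?gt_eqF // powRr1 // ltW.
  have /cvgrPdist_lt/(_ r r0) := @clamp_continuous R t.
  rewrite -[X in _ -> X]/(nbhs t (fun s => U (SigSub (mem_set (GC (clamp s) (cl s)))))).
  apply: filterS => s st; apply: VU; apply: He; apply: Hd.
  apply: op_le_mono (GJ (clamp s) (clamp t) (cl s) (cl t)).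
  apply: (@le_trans _ _ (r `^ q * J)).
    rewrite ler_wpM2r // ge0_ler_powR ?nnegrE ?(ltW q0) ?(ltW r0) //.
    by rewrite distrC ltW.
  by rewrite rq mulrAC ler_pdivrMr // ler_wpM2l ?(ltW d0) // lerDl.
- by apply: val_inj; rewrite /= clamp_id ?lexx ?ler01.
- by apply: val_inj; rewrite /= clamp_id ?lexx ?ler01.
Qed.

Definition seg psi1 psi2 (t : R) : C -> C :=
  fun z => Complex (1 - t) 0 * psi1 z + Complex t 0 * psi2 z.

Lemma joined_segment phi psi1 psi2 (M1 M2 : R) x y : entire phi -> entire psi1 -> entire psi2 ->
  0 <= M1 -> 0 <= M2 ->
  op_le q (wcomp psi1 phi : fock p -> C -> C) M1 -> op_le q (wcomp psi2 phi : fock p -> C -> C) M2 ->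
  (forall t, 0 <= t <= 1 -> seg psi1 psi2 t <> (fun=> 0)) ->
  \val x = wcomp psi1 phi -> \val y = wcomp psi2 phi -> @joined R _ x y.
Proof.
move=> ephi e1 e2 M10 M20 h1 h2 nz xE yE.
have w1 (u : fock p) := @entire_wcomp R p psi1 phi u e1 ephi.
have w2 (u : fock p) := @entire_wcomp R p psi2 phi u e2 ephi.
have w3 (k : C) psi (u : fock p) : entire (wcomp psi phi u) -> entire (fun z => k * wcomp psi phi u z).
  by move=> e; exact: (entireM (entire_cst k) e).
apply: (@joined_holder (fun t => wcomp (seg psi1 psi2 t) phi) (2 `^ q * (M1 + M2))).
- by rewrite mulr_ge0 ?powR_ge0 // addr_ge0.
- move=> t t01; apply: (Cw_phi_sub p0 q0 ephi); apply/(Cw_phiP _ p0 q0 ephi).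
  exists (seg psi1 psi2 t); first by [].
  split; [|exact: nz|].
    exact: (entireD (entireM (entire_cst (Complex (1 - t) 0)) e1) (entireM (entire_cst (Complex t 0)) e2)).
  exists (2 `^ q * (normc (Complex (1 - t) 0) `^ q * M1 + normc (Complex (- t) 0) `^ q * M2)).
    by rewrite mulr_ge0 ?powR_ge0 // addr_ge0 // mulr_ge0 ?powR_ge0.
  have -> : wcomp (seg psi1 psi2 t) phi = fun (u : fock p) z =>
      Complex (1 - t) 0 * wcomp psi1 phi u z - Complex (- t) 0 * wcomp psi2 phi u z.
    apply/funext => u; apply/funext => z; rewrite /wcomp /seg.
    have -> : Complex (- t) 0 = - Complex t 0 :> C by apply/eqP; rewrite eq_complex /= oppr0 !eqxx.
    by ring.
  apply: (@op_le_sub R p q _ _ _ _ q0 (fun u => w3 _ _ u (w1 u)) (fun u => w3 _ _ u (w2 u))).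
    exact: (@op_le_scale R p q _ _ _ w1).
  exact: (@op_le_scale R p q _ _ _ w2).
- move=> s t _ _.
  have -> : (fun (u : fock p) z => wcomp (seg psi1 psi2 s) phi u z - wcomp (seg psi1 psi2 t) phi u z) =
      fun (u : fock p) z => Complex (t - s) 0 * (wcomp psi1 phi u z - wcomp psi2 phi u z).
    apply/funext => u; apply/funext => z; rewrite /wcomp /seg.
    have cD (k l : R) : Complex (k - l) 0 = Complex k 0 - Complex l 0 :> C.
      by apply/eqP; rewrite eq_complex /= subrr !eqxx.
    by rewrite !cD; ring.
  rewrite distrC -normcC; apply: op_le_scale.
    by move=> u; exact: (entireB (w1 u) (w2 u)).
  exact: (@op_le_sub R p q _ _ _ _ q0 w1 w2).
- rewrite xE; congr (wcomp _ _); apply/funext => z; rewrite /seg subr0.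
  by rewrite -[Complex 1 0]/(1 : C) -[Complex 0 0]/(0 : C) mul1r mul0r addr0.
- rewrite yE; congr (wcomp _ _); apply/funext => z; rewrite /seg subrr.
  by rewrite -[Complex 1 0]/(1 : C) -[Complex 0 0]/(0 : C) mul1r mul0r add0r.
Qed.

Lemma nonzero_point psi : psi <> (fun=> 0) -> exists z, psi z != 0.
Proof.
move=> n0; apply: contrapT => H; apply: n0; apply/funext => z; apply/eqP.
by apply/negPn/negP => nz; apply: H; exists z.
Qed.

Lemma Cw_lift T : Cw p q T -> exists x : Cw_space p q, \val x = T.
Proof.
by move=> h; exists (SigSub (mem_set h)).
Qed.

(** Two multipliers are joined by their segment, or, when it meets 0, through
    the multiplier [i psi1]. *)
Lemma joined_same_symbol phi x y : entire phi ->
  Cw_phi p q phi (\val x) -> Cw_phi p q phi (\val y) -> @joined R _ x y.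
Proof.
move=> ephi /(Cw_phiP _ p0 q0 ephi)[psi1 xE [e1 n1 [M1 M10]]].
rewrite xE => h1 /(Cw_phiP _ p0 q0 ephi)[psi2 yE [e2 n2 [M2 M20]]]; rewrite yE => h2.
have [nz|/existsNP[t /not_implyP[t01 /contrapT tz]]] := pselect (forall t, 0 <= t <= 1 -> seg psi1 psi2 t <> (fun=> 0)).
  exact: (joined_segment ephi e1 e2 M10 M20 h1 h2 nz xE yE).
have [z1 nz1] := nonzero_point n1; have [z2 nz2] := nonzero_point n2.
pose psi z := Complex 0 1 * psi1 z.
have e : entire psi by exact: (entireM (entire_cst (Complex 0 1)) e1).
have i0 : Complex 0 1 != 0 :> C by rewrite eq_complex /= oner_eq0 andbF.
have h : op_le q (wcomp psi phi : fock p -> C -> C) M1.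
  have -> : wcomp psi phi = fun (u : fock p) z => Complex 0 1 * wcomp psi1 phi u z.
    by apply/funext => u; apply/funext => z; rewrite /wcomp mulrA.
  have := @op_le_scale R p q _ (Complex 0 1) _ (fun u => @entire_wcomp R p psi1 phi u e1 ephi) h1.
  by rewrite normc_i powR1 mul1r.
have [m mE] : exists m : Cw_space p q, \val m = wcomp psi phi.
  apply: Cw_lift; apply: (Cw_phi_sub p0 q0 ephi); apply/(Cw_phiP _ p0 q0 ephi).
  exists psi; first by [].
  split; [exact: e| |by exists M1].
  move=> /(congr1 (fun f : C -> C => f z1)) /eqP; rewrite /psi mulf_eq0 (negbTE i0) /= => E.
  by rewrite E in nz1.
apply: (@joined_trans R _ m).
  apply: (joined_segment ephi e1 e M10 M10 h1 h _ xE mE) => s _ /(congr1 (fun f : C -> C => f z1)).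
  rewrite /seg /psi mulrA -mulrDl => /eqP; rewrite mulf_eq0 (negbTE nz1) orbF.
  rewrite eq_complex /= => /andP[/eqP E1 /eqP E2].
  have s0 : s = 0 by move: E2; rewrite mulr1 mul0r addr0 add0r.
  by move/eqP: E1; rewrite s0 !mul0r !subr0 addr0 oner_eq0.
apply: (joined_segment ephi e e2 M10 M20 h h2 _ mE yE) => s _ sz.
(* [psi2] is eliminated between the two vanishing combinations. *)
have Ez z : Complex (- (s * (1 - t))) (t * (1 - s)) * psi1 z = 0.
  have := congr1 (fun f : C -> C => f z) sz; have := congr1 (fun f : C -> C => f z) tz.
  rewrite /seg /psi => E1 E2.
  rewrite -[RHS](subrr (0 : C)) -{1}(mulr0 (Complex t 0)) -{1}E2 -(mulr0 (Complex s 0)) -E1.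
  have cE : Complex (- (s * (1 - t))) (t * (1 - s)) =
     Complex t 0 * (Complex (1 - s) 0 * Complex 0 1) - Complex s 0 * Complex (1 - t) 0.
    by apply/eqP; rewrite eq_complex /=; apply/andP; split; apply/eqP; ring.
  by rewrite cE; ring.
have := Ez z1; move=> /eqP; rewrite mulf_eq0 (negbTE nz1) orbF eq_complex /= => /andP[/eqP E1 /eqP E2].
have t0 : t != 0.
  apply/eqP => t0; have := congr1 (fun f : C -> C => f z1) tz.
  rewrite /seg t0 subr0 -[Complex 1 0]/(1 : C) -[Complex 0 0]/(0 : C) mul1r mul0r addr0.
  by move/eqP; apply/negP.
have s1 : s = 1.
  by move/eqP: E2; rewrite mulf_eq0 (negbTE t0) subr_eq0 => /eqP ->.
have t1 : t = 1 by move/eqP: E1; rewrite s1 mul1r oppr_eq0 subr_eq0 => /eqP.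
have := congr1 (fun f : C -> C => f z2) tz.
rewrite /seg t1 subrr -[Complex 1 0]/(1 : C) -[Complex 0 0]/(0 : C) mul1r mul0r add0r.
by move/eqP; apply/negP.
Qed.

Lemma joined_contraction (a b : C) x y : normc a < 1 -> \val x = wcomp (fun=> 1) (aff a b) ->
  \val y = wcomp (fun=> 1) (aff 0 0) -> @joined R _ x y.
Proof.
move=> a1 xE yE; have [J J0 HJ] := comp_contraction_lipschitz b p0 q0 a1.
have affE (t : R) : (fun z => Complex t 0 * (a * z + b)) = aff (Complex t 0 * a) (Complex t 0 * b).
  by apply/funext => z; rewrite /aff mulrDr mulrA.
have rev (t : R) : 0 <= t <= 1 -> 0 <= 1 - t <= 1.
  by move=> /andP[t0 t1]; rewrite subr_ge0 t1 gerBl.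
apply: (@joined_holder (fun t => wcomp (fun=> 1) (fun z => Complex (1 - t) 0 * (a * z + b))) J x y J0).
- move=> t /rev/andP[t0 t1]; rewrite affE.
  apply: (Cw_phi_sub p0 q0 (@entire_aff R _ _)); apply: contraction_nonempty => //.
  rewrite Normc.normcM normcC ger0_norm //; apply: le_lt_trans a1.
  by rewrite ler_piMl ?normc_ge0.
- move=> s t s01 t01; have := HJ _ _ (rev s s01) (rev t t01).
  by have -> : `|1 - s - (1 - t)| = `|s - t| by rewrite distrC; congr `|_|; ring.
- rewrite xE; congr (wcomp _ _); apply/funext => z; rewrite subr0.
  by rewrite -[Complex 1 0]/(1 : C) mul1r.
- rewrite yE; congr (wcomp _ _); apply/funext => z; rewrite subrr.
  by rewrite -[Complex 0 0]/(0 : C) /aff !mul0r addr0.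
Qed.

Lemma Cw0P T : Cw0 p q T <-> exists a b, normc a < 1 /\ Cw_phi p q (aff a b) T.
Proof.
split=> [[phi /S0P[a [b [a1 ->]]] h]|[a [b [a1 h]]]]; first by exists a, b.
by exists (aff a b) => //; apply/S0P; exists a, b.
Qed.

(** Every operator is joined to the one with multiplier 1, and from there to
    the evaluation at 0. *)
Lemma joined_Cw0 x y : Cw0 p q (\val x) -> Cw0 p q (\val y) -> @joined R _ x y.
Proof.
move=> /Cw0P[a [b [a1 hx]]] /Cw0P[a' [b' [a1' hy]]].
have lift c d : normc c < 1 -> exists m : Cw_space p q, \val m = wcomp (fun=> 1) (aff c d).
  move=> c1; apply: Cw_lift; apply: (Cw_phi_sub p0 q0 (@entire_aff R c d)).
  exact: contraction_nonempty.
have [m mE] := lift a b a1; have [m' mE'] := lift a' b' a1'.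
have [n nE] : exists m : Cw_space p q, \val m = wcomp (fun=> 1) (aff 0 0).
  by apply: lift; rewrite Normc.normc0.
apply: (@joined_trans R _ m).
  by apply: (joined_same_symbol (@entire_aff R a b) hx); rewrite mE; exact: contraction_nonempty.
apply: (@joined_trans R _ n); first exact: joined_contraction mE nE.
apply: (@joined_trans R _ m'); first by apply: joined_sym; exact: joined_contraction mE' nE.
by apply: (joined_same_symbol (@entire_aff R a' b') _ hy); rewrite mE'; exact: contraction_nonempty.
Qed.

End OperatorPaths.

(** * Path components *)

Section Components.
Context {R : realType}.
Local Notation C := R[i].
Implicit Types (f g psi phi : C -> C).
Variables (p q : R) (p0 : 0 < p) (q0 : 0 < q).
Implicit Types (x y : Cw_space p q) (T : fock p -> C -> C).

Lemma aff_inj (a a' b b' z w : C) : z != w -> aff a b z = aff a' b' z -> aff a b w = aff a' b' w ->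
  a = a' /\ b = b'.
Proof.
rewrite /aff => zw hz hw; have : (a - a') * (z - w) = 0.
  by rewrite (_ : _ * _ = (a * z + b - (a' * z + b')) - (a * w + b - (a' * w + b'))); [rewrite hz hw !subrr|ring].
move/eqP; rewrite mulf_eq0 !subr_eq0 (negbTE zw) orbF => /eqP aa; split=> //.
by move: hz; rewrite aa => /addrI.
Qed.

(** The zeros of [psi] near 0 are isolated, and two distinct affine maps agree
    in at most one point. *)
Lemma aff_separate psi (a a' b b' : C) : entire psi -> psi <> (fun=> 0) -> aff a b <> aff a' b' ->
  exists2 z, psi z != 0 & aff a b z != aff a' b' z.
Proof.
move=> e n ne; have [k [L [L0 kL]]] := entire_order e n.
have [r r0 Hr] : exists2 r : R, 0 < r & forall z, z != 0 -> normc z < r -> psi z != 0.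
  have l0 : 0 < normc L / 2 by rewrite divr_gt0 // normc_gt0.
  have [r r0 H] := kL _ l0; exists r => // z z0 zr; apply/negP => /eqP pz.
  have := H z z0 zr; rewrite pz mul0r sub0r normcN leNgt => /negP; apply.
  by rewrite ltr_pdivrMr // ltr_pMr ?normc_gt0 // ltr1n.
have near s : 0 < s -> s < r -> psi (Complex s 0) != 0.
  move=> s0 sr; apply: Hr; last by rewrite normcC gtr0_norm.
  by rewrite -normc_gt0 normcC gtr0_norm.
have r2 : 0 < r / 2 by rewrite divr_gt0.
have r3 : 0 < r / 3 by rewrite divr_gt0.
have lt2 : r / 2 < r by rewrite ltr_pdivrMr // ltr_pMr // ltr1n.
have lt3 : r / 3 < r by rewrite ltr_pdivrMr // ltr_pMr // ltr1n.
have [e2|n2] := eqVneq (aff a b (Complex (r / 2) 0)) (aff a' b' (Complex (r / 2) 0)); last first.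
  by exists (Complex (r / 2) 0) => //; exact: near.
have [e3|n3] := eqVneq (aff a b (Complex (r / 3) 0)) (aff a' b' (Complex (r / 3) 0)); last first.
  by exists (Complex (r / 3) 0) => //; exact: near.
exfalso; have z23 : Complex (r / 2) 0 != Complex (r / 3) 0.
  rewrite eq_complex /= eqxx andbT; apply/eqP => E.
  have : r * (2^-1 - 3^-1) = 0 by rewrite mulrBr E subrr.
  by apply/eqP; rewrite mulf_neq0 ?gt_eqF // subr_gt0 ltf_pV2 ?posrE ?ltr_nat.
by apply: ne; have [-> ->] := aff_inj z23 e2 e3.
Qed.

Lemma Cw_symbol_unique T (a a' b b' : C) : Cw_phi p q (aff a b) T -> Cw_phi p q (aff a' b') T ->
  aff a b = aff a' b'.
Proof.
move=> /(Cw_phiP _ p0 q0 (@entire_aff R a b))[psi TE [e _ _]].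
move=> /(Cw_phiP _ p0 q0 (@entire_aff R a' b'))[psi' TE' [e' n' _]].
apply: contrapT => ne; have [z nz zne] := aff_separate e' n' ne.
have [d d0 H] := wcomp_separated p0 q0 (@entire_aff R a b) e' (@entire_aff R a' b') nz zne.
apply: (H psi e) => u u1; rewrite -TE -TE'.
have -> : fock_weight q (fun z => T u z - T u z) = (fun z : C => 0 * 1).
  by apply/funext => w; rewrite /fock_weight subrr Normc.normc0 powR0 ?gt_eqF // !mul0r.
by rewrite aintZ ?mul0e ?lee_fin ?(ltW d0) //; exact: cmeas_cst.
Qed.

Lemma Cw_phi_open (a b : C) : normc a = 1 -> open (\val @^-1` Cw_phi p q (aff a b) : set (Cw_space p q)).
Proof.
move=> a1; suff H : @Cw_open R p q (\val @^-1` Cw_phi p q (aff a b)) by exact: H.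
move=> T hT; have /(Cw_phiP _ p0 q0 (@entire_aff R a b))[psi TE [e n [M M0 TM]]] : Cw_phi p q (aff a b) (\val T) := hT.
have TM' : exists M, op_le q (wcomp psi (aff a b) : fock p -> C -> C) M by exists M; rewrite -TE.
have [d d0 Hd] := rigid_separated p0 q0 a1 e n TM'.
have [r r0 Hr] := @op_dist_lt_op_le R p q d p0 q0 d0.
exists r => // S /Hr; rewrite TE => ST.
have SC : Cw p q (\val S) by exact: set_valP.
have [a' [b' [hS _]]] := Cw_symbols p0 q0 SC.
have := hS => /(Cw_phiP _ p0 q0 (@entire_aff R a' b'))[psi' SE [e' n' [M' M0' SM]]].
rewrite SE in ST SM.
by have hS' := hS; rewrite (Hd psi' a' b' M' e' n' SM ST) in hS'; exact: hS'.
Qed.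

(** An operator with another symbol is separated from the whole set at a
    single point. *)
Lemma Cw_phi_closed (a b : C) : closed (\val @^-1` Cw_phi p q (aff a b) : set (Cw_space p q)).
Proof.
rewrite -openC; suff H : @Cw_open R p q (~` (\val @^-1` Cw_phi p q (aff a b))) by exact: H.
move=> T nT; have TC : Cw p q (\val T) by exact: set_valP.
have [a' [b' [hT _]]] := Cw_symbols p0 q0 TC.
have ne : aff a b <> aff a' b' by move=> E; apply: nT; rewrite -[(_ @^-1` _) T]/(Cw_phi p q (aff a b) (\val T)) E.
have := hT => /(Cw_phiP _ p0 q0 (@entire_aff R a' b'))[psi' TE [e' n' _]].
have [z nz zne] := aff_separate e' n' ne.
have [d d0 Hd] := wcomp_separated p0 q0 (@entire_aff R a b) e' (@entire_aff R a' b') nz zne.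
have [r r0 Hr] := @op_dist_lt_op_le R p q d p0 q0 d0.
exists r => // S /Hr; rewrite TE => ST hS.
have /(Cw_phiP _ p0 q0 (@entire_aff R a b))[psi SE [e _ _]] : Cw_phi p q (aff a b) (\val S) := hS.
by rewrite SE in ST; exact: (Hd psi e ST).
Qed.

Lemma component_rigid (a b : C) x : normc a = 1 -> Cw_phi p q (aff a b) (\val x) ->
  @path_component R _ x = \val @^-1` Cw_phi p q (aff a b).
Proof.
move=> a1 hx; apply/seteqP; split=> y.
  by move=> /(joinedP x y) xy; exact: (joined_clopen (@Cw_phi_open a b a1) (@Cw_phi_closed a b) xy hx).
by move=> hy; apply/(joinedP x y); exact: (joined_same_symbol p0 q0 (@entire_aff R a b) hx hy).
Qed.

(** A path leaving this set would arrive in a set which is open and closed and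
    contains none of its points. *)
Lemma component_contraction x : Cw0 p q (\val x) ->
  @path_component R _ x = \val @^-1` Cw0 p q.
Proof.
move=> hx; apply/seteqP; split=> y h; last by apply/(joinedP x y); exact: joined_Cw0.
have yC : Cw p q (\val y) by exact: set_valP.
have [a [b [hy [a1|a1]]]] := Cw_symbols p0 q0 yC; first by apply/Cw0P; exists a, b.
exfalso; have yx := joined_sym ((joinedP x y).1 h).
have hx' := joined_clopen (@Cw_phi_open a b a1) (@Cw_phi_closed a b) yx hy.
move/Cw0P: hx => [a' [b' [a1' hx]]].
have E := Cw_symbol_unique hx' hx.
have E0 : aff a b 0 = aff a' b' 0 by rewrite E.
have E1 : aff a b 1 = aff a' b' 1 by rewrite E.
have n01 : 0 != 1 :> C by rewrite eq_sym oner_eq0.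
by have [aa _] := aff_inj n01 E0 E1; rewrite -aa a1 ltxx in a1'.
Qed.

Lemma Cw_decomposition : Cw p q = Cw0 p q `|` \bigcup_(phi in S1) Cw_phi p q phi.
Proof.
apply/seteqP; split=> T.
  move=> /(Cw_symbols p0 q0)[a [b [h [a1|a1]]]]; first by left; apply/Cw0P; exists a, b.
  by right; exists (aff a b) => //; apply/S1P; exists a, b.
move=> [/Cw0P[a [b [_ h]]]|[phi /S1P[a [b [_ ->]]] h]];
  exact: (Cw_phi_sub p0 q0 (@entire_aff R a b) h).
Qed.

End Components.

Theorem theorem4p9 (R : realType) (p q : R) (hp : 0 < p) (hq : 0 < q) :
  (q < p -> path_connected R (Cw_space p q)) /\
  (p <= q ->
     Cw p q = Cw0 p q `|` \bigcup_(phi in S1) Cw_phi p q phi /\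
     path_components R (Cw_space p q) =
       [set (\val @^-1` Cw0 p q : set (Cw_space p q))] `|`
       [set (\val @^-1` Cw_phi p q phi : set (Cw_space p q)) | phi in S1]).
Proof.
have symb (x : Cw_space p q) := Cw_symbols hp hq (set_valP x : Cw p q (\val x)).
split=> [qp x y|pq].
  have all0 (z : Cw_space p q) : Cw0 p q (\val z).
    have [a [b [h [a1|a1]]]] := symb z; first by apply/Cw0P; exists a, b.
    by case: (rigid_no_small_exponent hq qp a1 h).
  by apply/joinedP; exact: joined_Cw0.
split; first exact: Cw_decomposition.
apply/seteqP; split=> A.
  move=> [x _ <-]; have [a [b [h [a1|a1]]]] := symb x.
    by left; apply: component_contraction => //; apply/Cw0P; exists a, b.
  right; exists (aff a b); first by apply/S1P; exists a, b.
  by rewrite (component_rigid hp hq a1 h).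
move=> [->|[phi /S1P[a [b [a1 ->]]] <-]].
  have h0 : normc (0 : R[i]) < 1 by rewrite Normc.normc0.
  have h := contraction_nonempty 0 hp hq h0.
  have [x xE] := Cw_lift (Cw_phi_sub hp hq (@entire_aff R 0 0) h).
  exists x => //; apply: component_contraction => //.
  by apply/Cw0P; exists 0, 0; rewrite xE.
have h := rigid_nonempty b hp pq a1.
have [x xE] := Cw_lift (Cw_phi_sub hp hq (@entire_aff R a b) h).
by exists x => //; apply: component_rigid => //; rewrite xE.
Qed.
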